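(* Let $V$ be a Banach $\mathbb O$-bimodule, $T\in\mathscr B_{\mathcal{RO}}(V)$ power-associative, $U\subseteq\mathbb O$ a $T$-left-admissible domain, $J\in\mathbb S$ and $m\in\mathbb N$. Then $$\frac1{2\pi}\int_{\partial(U\cap\mathbb C_J)}(R_s-T)^{\circledcirc-}\odot(ds_J\,s^m)=T^m.$$
   Context: $\mathbb O$ is the real octonion algebra with basis $e_0=1,\dots,e_7$, conjugation $\bar x$, norm $|x|$; $\mathbb S=\{J:J^2=-1\}$, $\mathbb C_J=\mathbb R+\mathbb RJ$. An $\mathbb O$-bimodule is a real vector space $M$ with real-bilinear left and right multiplications by $\mathbb O$ (with $1x=x1=x$) whose associators $[p,q,x]=(pq)x-p(qx)$, $[p,x,q]=(px)q-p(xq)$, $[x,p,q]=(xp)q-x(pq)$ satisfy $[p,q,x]=[q,x,p]=[x,p,q]=-[q,p,x]$. $\operatorname{Re}M=\{m: pm=mp,\ [p,q,m]=0\ \forall p,q\}$; every $x=\sum_ix_ie_i$ uniquely with $x_i\in\operatorname{Re}M$, $\operatorname{Re}x:=x_0$. A Banach $\mathbb O$-bimodule has a complete norm with $\|px\|=\|xp\|=|p|\|x\|$. $\mathscr B_{\mathbb R}(V)$: bounded real-linear operators, ordinary powers; invertible means in $\mathscr B_{\mathbb R}(V)$; $R_sv=vs$. $B_p(f,x)=f(x)p-f(xp)$; $\mathscr B_{\mathcal{RO}}(V)$: bounded real-linear $f$ with $\operatorname{Re}B_p(f,x)=0\ \forall p,x$; it is a Banach $\mathbb O$-bimodule (operator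 norm) via $(p\odot f)(x)=pf(x)+B_p(f,x)$, $(f\odot p)(x)=f(px)-B_p(f,x)$. $T$ is power-associative if $T^n\in\mathscr B_{\mathcal{RO}}(V)$ for all $n$. For invertible $S$, $S^{\circledcirc-}=\operatorname{ext}(S^{-1}|_{\operatorname{Re}V})$ with $(\operatorname{ext}h)(\sum x_ie_i)=\sum h(x_i)e_i$. $S$ is $\mathbb C_J$-extendable power associative if $S^n(v\lambda)=S^n(v)\lambda$ for $n\ge1,v\in\operatorname{Re}V,\lambda\in\mathbb C_J$; $\rho_J^*(T)=\{s\in\mathbb C_J:R_s-T$ invertible and $(R_s-T)^{-1}$ $\mathbb C_J$-extendable power associative$\}$, $\sigma^*(T)=\mathbb O\setminus\bigcup_J\rho^*_J(T)$. $U\subseteq\mathbb O$ is axially symmetric if $x+yI\in U$ ($x,y\in\mathbb R$, $I\in\mathbb S$) implies $x+yK\in U$ for all $K\in\mathbb S$; it is a slice domain if it is a domain, $U\cap\mathbb R\ne\emptyset$ and each $U\cap\mathbb C_K$ is a domain in $\mathbb C_K$. $U$ is $T$-left-admissible if it is an axially symmetric slice domain containing $\sigma^*(T)$ such that for every $K\in\mathbb S$, $\partial(U\cap\mathbb C_K)$ is a finite union of continuously differentiable Jordan curves. Integrals over $\partial(U\cap\mathbb C_J)$ are taken with positive orientation: if $s:[a,b]\to\mathbb C_J$ is a piecewise $C^1$ parametrization, $ds_J:=-ds\,J$ and $\int F(s)\odot(ds_Jh(s)):=\int_a^bF(s(t))\odot\big(-s'(t)Jh(s(t))\big)dt$ (Bochner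 integral in $\mathscr B_{\mathcal{RO}}(V)$).
   Formalization: The formal statement covers only U with U∩C_J bounded (positive orientation means total winding number 1 on U∩C_J and 0 outside its closure); for unbounded U, e.g. U={|s|>1} and T=2·id, the stated formula is false. *)

(* Defs.v *)
From HB Require Import structures.
From mathcomp Require Import all_boot all_order all_algebra.
From mathcomp Require Import all_classical all_reals all_analysis.
Set Implicit Arguments. Unset Strict Implicit. Unset Printing Implicit Defensive.
Import Order.TTheory GRing.Theory Num.Theory.
Import numFieldNormedType.Exports.
Local Open Scope classical_set_scope.
Local Open Scope ring_scope.

Section Octonions.
Variable R : realType.

Definition oct := 'rV[R]_8.

Definition obasis (i : 'I_8) : oct := delta_mx 0 i.
Definition one_o : oct := obasis ord0.

(** Multiplication table (Baez's convention: e_i e_{i+1} = e_{i+3}, indices mod 7). *)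
Definition fano : seq (nat * nat * nat) :=
  [:: (1,2,4); (2,3,5); (3,4,6); (4,5,7); (5,6,1); (6,7,2); (7,1,3)]%N.
Definition cyc (i j k : nat) : bool :=
  has (fun t => let: (a, b, c) := t in
        [|| (i, j, k) == (a, b, c), (i, j, k) == (b, c, a) | (i, j, k) == (c, a, b)]) fano.
Definition octc (i j k : nat) : R :=
  if i == 0%N then (j == k)%:R
  else if j == 0%N then (i == k)%:R
  else if i == j then - (k == 0%N)%:R
  else if cyc i j k then 1 else if cyc j i k then -1 else 0.

Definition omul (x y : oct) : oct :=
  \row_(k < 8) \sum_(i < 8) \sum_(j < 8) x 0 i * y 0 j * octc i j k.

(** ordinary powers s^m (left multiplication; octonions are power-associative) *)
Definition opow (s : oct) (m : nat) : oct := iter m (omul s) one_o.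

Definition onorm (x : oct) : R := Num.sqrt (\sum_(i < 8) x 0 i ^+ 2).

Definition in_S (J : oct) : Prop := omul J J = - one_o.

Definition cJ (J : oct) (x y : R) : oct := x *: one_o + y *: J.
Definition in_CJ (J : oct) (s : oct) : Prop := exists x y : R, s = cJ J x y.

Definition sliceJ (U : set oct) (J : oct) : set (R * R) := [set p | U (cJ J p.1 p.2)].

Definition bdry (A : set (R * R)) : set (R * R) := closure A `\` interior A.

Record pcurve := PCurve { ca : R; cb : R; cx : R -> R; cy : R -> R }.

Definition C1_jordan (c : pcurve) : Prop :=
  ca c < cb c /\
  (forall t, derivable (cx c) t 1) /\ (forall t, derivable (cy c) t 1) /\
  continuous (derive1 (cx c)) /\ continuous (derive1 (cy c)) /\
  cx c (ca c) = cx c (cb c) /\ cy c (ca c) = cy c (cb c) /\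
  (forall t u, ca c <= t < cb c -> ca c <= u < cb c ->
     (cx c t, cy c t) = (cx c u, cy c u) -> t = u).

Definition curve_img (c : pcurve) : set (R * R) :=
  [set z | exists2 t, ca c <= t <= cb c & z = (cx c t, cy c t)].

Definition tagged_part (a b : R) (p tg : seq R) (d : R) : Prop :=
  size p = (size tg).+1 /\ p`_0 = a /\ p`_(size tg) = b /\
  (forall i, (i < size tg)%N ->
     p`_i <= tg`_i <= p`_i.+1 /\ 0 < p`_i.+1 - p`_i < d).

Definition is_rint (f : R -> R) (a b l : R) : Prop :=
  forall e, 0 < e -> exists2 d, 0 < d & forall p tg, tagged_part a b p tg d ->
    `| \sum_(i < size tg) (p`_i.+1 - p`_i) * f tg`_i - l | < e.

Definition wind_integrand (c : pcurve) (z : R * R) (t : R) : R :=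
  ((cx c t - z.1) * (derive1 (cy c)) t - (cy c t - z.2) * (derive1 (cx c)) t) /
  ((cx c t - z.1) ^+ 2 + (cy c t - z.2) ^+ 2).

(** the family cs (finitely many C^1 Jordan curves) parametrizes the boundary of D,
    and is positively oriented: total winding number 1 around points of D,
    0 around points outside the closure of D *)
Definition pos_bdry_param (D : set (R * R)) (n : nat) (cs : 'I_n -> pcurve) : Prop :=
  (forall k, C1_jordan (cs k)) /\
  bdry D = \bigcup_(k in [set: 'I_n]) curve_img (cs k) /\
  (forall z, ~ bdry D z -> exists w : 'I_n -> R,
     (forall k, is_rint (wind_integrand (cs k) z) (ca (cs k)) (cb (cs k)) (w k)) /\
     \sum_(k < n) w k = (if pselect (D z) then 2 * pi else 0)).

End Octonions.

Section Bimodule.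
Variable R : realType.
Variable V : completeNormedModType R.
Variable lm : oct R -> V -> V.
Variable rm : V -> oct R -> V.

Definition assoc_ppx (p q : oct R) (x : V) : V := lm (omul p q) x - lm p (lm q x).
Definition assoc_pxq (p : oct R) (x : V) (q : oct R) : V := rm (lm p x) q - lm p (rm x q).
Definition assoc_xpq (x : V) (p q : oct R) : V := rm (rm x p) q - rm x (omul p q).

Definition banach_O_bimodule : Prop :=
  (forall p x y, lm p (x + y) = lm p x + lm p y) /\
  (forall p q x, lm (p + q) x = lm p x + lm q x) /\
  (forall (r : R) p x, lm (r *: p) x = r *: lm p x) /\
  (forall (r : R) p x, lm p (r *: x) = r *: lm p x) /\
  (forall p x y, rm (x + y) p = rm x p + rm y p) /\
  (forall p q x, rm x (p + q) = rm x p + rm x q) /\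
  (forall (r : R) p x, rm x (r *: p) = r *: rm x p) /\
  (forall (r : R) p x, rm (r *: x) p = r *: rm x p) /\
  (forall x, lm (one_o R) x = x) /\ (forall x, rm x (one_o R) = x) /\
  (forall p q x,
     assoc_ppx p q x = assoc_pxq q x p /\
     assoc_pxq q x p = assoc_xpq x p q /\
     assoc_xpq x p q = - assoc_ppx q p x) /\
  (forall p x, `| lm p x | = onorm p * `| x |) /\
  (forall p x, `| rm x p | = onorm p * `| x |).

Definition ReV (m : V) : Prop :=
  (forall p, lm p m = rm m p) /\ (forall p q, assoc_ppx p q m = 0).

(** decomposition x = sum_i x_i e_i with x_i in Re V (it exists and is unique) *)
Definition decomp (x : V) (xs : 'I_8 -> V) : Prop :=
  (forall i, ReV (xs i)) /\ x = \sum_(i < 8) rm (xs i) (obasis R i).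

Definition ocomp (x : V) : 'I_8 -> V :=
  match pselect (exists xs, decomp x xs) with
  | left H => proj1_sig (cid H)
  | right _ => fun _ => 0
  end.

Definition ReP (x : V) : V := ocomp x ord0.

Definition bdd_lin (f : V -> V) : Prop :=
  (forall x y, f (x + y) = f x + f y) /\ (forall (r : R) x, f (r *: x) = r *: f x) /\
  (exists C : R, forall x, `| f x | <= C * `| x |).

Definition Bp (f : V -> V) (p : oct R) (x : V) : V := rm (f x) p - f (rm x p).

Definition in_BRO (f : V -> V) : Prop :=
  bdd_lin f /\ forall p x, ReP (Bp f p x) = 0.

Definition odot_r (f : V -> V) (p : oct R) : V -> V := fun x => f (lm p x) - Bp f p x.

Definition power_assoc (T : V -> V) : Prop := forall n, in_BRO (iter n T).

Definition invertible (S : V -> V) : Prop :=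
  exists g, bdd_lin g /\ cancel S g /\ cancel g S.

Definition opinv (S : V -> V) : V -> V :=
  match pselect (exists g, bdd_lin g /\ cancel S g /\ cancel g S) with
  | left H => proj1_sig (cid H)
  | right _ => id
  end.

Definition ext (h : V -> V) : V -> V :=
  fun x => \sum_(i < 8) rm (h (ocomp x i)) (obasis R i).

Definition circ_inv (S : V -> V) : V -> V := ext (opinv S).

Definition Rs (s : oct R) : V -> V := fun v => rm v s.

Definition RsT (T : V -> V) (s : oct R) : V -> V := fun v => rm v s - T v.

Definition CJ_ext_pa (J : oct R) (S : V -> V) : Prop :=
  forall n, (0 < n)%N -> forall v, ReV v -> forall lam, in_CJ J lam ->
    iter n S (rm v lam) = rm (iter n S v) lam.

Definition rhoJ (T : V -> V) (J : oct R) (s : oct R) : Prop :=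
  in_CJ J s /\ invertible (RsT T s) /\ CJ_ext_pa J (opinv (RsT T s)).

Definition sigmaS (T : V -> V) (s : oct R) : Prop :=
  ~ (exists J, in_S J /\ rhoJ T J s).

Definition axially_symmetric (U : set (oct R)) : Prop :=
  forall (x y : R) (I : oct R), in_S I -> U (cJ I x y) ->
    forall K, in_S K -> U (cJ K x y).

Definition slice_domain (U : set (oct R)) : Prop :=
  open U /\ connected U /\ (exists r : R, U (r *: one_o R)) /\
  forall K, in_S K -> open (sliceJ U K) /\ connected (sliceJ U K).

Definition left_admissible (T : V -> V) (U : set (oct R)) : Prop :=
  axially_symmetric U /\ slice_domain U /\ (forall s, sigmaS T s -> U s) /\
  forall K, in_S K -> exists n (cs : 'I_n -> pcurve R),
    (forall k, C1_jordan (cs k)) /\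
    bdry (sliceJ U K) = \bigcup_(k in [set: 'I_n]) curve_img (cs k).

Definition is_oint (F : R -> V -> V) (a b : R) (L : V -> V) : Prop :=
  forall e, 0 < e -> exists2 d, 0 < d & forall p tg, tagged_part a b p tg d ->
    forall v, `| \sum_(i < size tg) (p`_i.+1 - p`_i) *: F tg`_i v - L v | <= e * `| v |.

Definition contour_integrand (T : V -> V) (J : oct R) (m : nat) (c : pcurve R)
  : R -> V -> V := fun t =>
  let s := cJ J (cx c t) (cy c t) in
  let s' := cJ J ((derive1 (cx c)) t) ((derive1 (cy c)) t) in
  odot_r (circ_inv (RsT T s)) (omul (omul (- s') J) (opow s m)).

End Bimodule.

(* Main.v *)
(** Right multiplication by [J] makes [V] a complex Banach space with [rm v (x + yJ) = (x + iy) v].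
    Since [V] is the direct sum of the [(Re V) e_i] and [ext h (.) p] acts by
    [sum x_i e_i |-> sum (h(x_i) p) e_i], the claim reduces to [oint S_s v s^m ds = 2 pi i T^m v]
    for [v] in [Re V], [S_s] being the inverse of [R_s - T].  These operators are only real linear, but
    on [Re V] the iterates of [T] and of the extendable [S_s] commute with [C_J]; this gives
    [S_w S_z v = (S_z v - S_w v) / (w - z)] there, and it persists on a neighbourhood of each good point.

    The value [P v = oint S_s v ds = 2 pi i v] is obtained as in Dixon's proof of Cauchy's theorem: the
    function equal to [oint S_s v / (s - z) ds] inside the contour and to [2 pi i S_z v - P S_z v]
    outside is entire and vanishes at infinity, hence is zero; then [z] tends to infinity in
    [z S_z v -> v].  Higher powers follow from [T S_s v = s S_s v - v].

    At a real point outside [U] the resolvent is only known to be extendable along some unit [J'],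
    possibly not [J].  Such a point is a limit of nonreal points outside [U], because the boundary is
    made of Jordan curves; and extendability along [J] spreads from a point to a disc whose radius
    depends only on the norm of the resolvent. *)

Require Import Defs.
From HB Require Import structures.
From mathcomp Require Import all_boot all_order all_algebra ring lra.
From mathcomp Require Import all_classical all_reals all_analysis.
From mathcomp Require Import complex.
Set Implicit Arguments. Unset Strict Implicit. Unset Printing Implicit Defensive.
Import Order.TTheory GRing.Theory Num.Theory.
Import numFieldNormedType.Exports.
Local Open Scope classical_set_scope.
Local Open Scope ring_scope.

(** * Linear identities in modules *)

Section LinearExpressions.
Variables (R : comPzRingType) (V : lmodType R).

Inductive lexp : Type :=
| LVar of nat | LZero | LAdd of lexp & lexp | LOpp of lexp | LScale of R & lexp
| LMuln of lexp & nat.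

Fixpoint leval (env : seq V) (e : lexp) : V :=
  match e with
  | LVar n => env`_n
  | LZero => 0
  | LAdd a b => leval env a + leval env b
  | LOpp a => - leval env a
  | LScale r a => r *: leval env a
  | LMuln a n => leval env a *+ n
  end.

Fixpoint lcoef (e : lexp) (i : nat) : R :=
  match e with
  | LVar n => if n == i then 1 else 0
  | LZero => 0
  | LAdd a b => lcoef a i + lcoef b i
  | LOpp a => - lcoef a i
  | LScale r a => r * lcoef a i
  | LMuln a n => n%:R * lcoef a i
  end.

Fixpoint lwf (n : nat) (e : lexp) : bool :=
  match e with
  | LVar k => (k < n)%N
  | LZero => true
  | LAdd a b => lwf n a && lwf n b
  | LOpp a | LScale _ a | LMuln a _ => lwf n a
  end.

Lemma leval_coef env e : lwf (size env) e ->
  leval env e = \sum_(i < size env) lcoef e i *: env`_i.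
Proof.
elim: e => [n|a|a IHa b IHb|a IHa|r a IHa|a IHa n] /=.
- move=> ns; rewrite (bigD1 (Ordinal ns)) //= eqxx scale1r big1 ?addr0//.
  move=> i; rewrite -val_eqE /= eq_sym => /negPf ->.
  by rewrite scale0r.
- by rewrite big1// => i _; rewrite scale0r.
- move=> /andP[/IHa -> /IHb ->]; rewrite -big_split /=.
  by apply: eq_bigr => i _; rewrite scalerDl.
- move=> /IHa ->; rewrite -sumrN; apply: eq_bigr => i _; by rewrite scaleNr.
- move=> /IHa ->; rewrite scaler_sumr; apply: eq_bigr => i _; by rewrite scalerA.
- move=> /IHa ->; rewrite -sumrMnl; apply: eq_bigr => i _.
  by rewrite -scalerA scaler_nat.
Qed.

Fixpoint lall (P : nat -> Prop) (k n : nat) : Prop :=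
  match n with 0 => True | n'.+1 => P k /\ lall P k.+1 n' end.

Lemma lallP P k n : lall P k n -> forall i, (i < n)%N -> P (k + i)%N.
Proof.
elim: n k => // n IH k [Pk H] [|i] ?; rewrite ?addn0//.
by rewrite -addSnnS; apply: IH.
Qed.

Lemma lexp_eq env e1 e2 : lwf (size env) e1 && lwf (size env) e2 ->
  lall (fun i => lcoef e1 i = lcoef e2 i) 0 (size env) -> leval env e1 = leval env e2.
Proof.
move=> /andP[w1 w2] /lallP H; rewrite !leval_coef//; apply: eq_bigr => i _.
by rewrite (H i).
Qed.
End LinearExpressions.

Ltac lmod_in a l :=
  match l with
  | nil => constr:(false)
  | cons a _ => constr:(true)
  | cons _ ?l' => lmod_in a l'
  end.
Ltac lmod_pos a l :=
  match l with
  | cons a _ => constr:(0%N)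
  | cons _ ?l' => let n := lmod_pos a l' in constr:(S n)
  end.
Ltac lmod_env l e :=
  match e with
  | (?a + ?b)%R => let l1 := lmod_env l a in lmod_env l1 b
  | (- ?a)%R => lmod_env l a
  | (_ *: ?a)%R => lmod_env l a
  | (?a *+ _)%R => lmod_env l a
  | (0)%R => l
  | _ => let b := lmod_in e l in
         match b with true => l | false => constr:(cons e l) end
  end.
Ltac lmod_reif R l e :=
  match e with
  | (?a + ?b)%R => let x := lmod_reif R l a in let y := lmod_reif R l b in
                   constr:(LAdd x y)
  | (- ?a)%R => let x := lmod_reif R l a in constr:(LOpp x)
  | (?r *: ?a)%R => let x := lmod_reif R l a in constr:(LScale r x)
  | (?a *+ ?n)%R => let x := lmod_reif R l a in constr:(LMuln x n)
  | (0)%R => constr:(@LZero R)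
  | _ => let n := lmod_pos e l in constr:(@LVar R n)
  end.
Ltac lmod_with R tac :=
  match goal with
  | |- @eq ?T ?a ?b =>
    let l0 := lmod_env (@nil T) a in
    let l := lmod_env l0 b in
    let x := lmod_reif R l a in
    let y := lmod_reif R l b in
    apply: (@lexp_eq R _ l x y);
    [ by [] | rewrite /=; repeat split; tac ]
  end.

(** * Octonion arithmetic *)

Ltac lmod := match goal with R : Real.type |- _ =>
  lmod_with (R : GRing.ComPzRing.type) ltac:(ring) end.

Definition oidx (i j : nat) : nat :=
  if i == 0%N then j else if j == 0%N then i else if i == j then 0%N
  else find (fun k => cyc i j k || cyc j i k) (iota 0 8).
Definition osgn (i j : nat) : bool :=
  (i != 0%N) && (j != 0%N) && ((i == j) || ~~ cyc i j (oidx i j)).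

Section OctonionBasis.
Variable R : realType.
Local Notation oct := (oct R).
Definition oe (i : nat) : oct := obasis R (inord i).
Local Notation e := oe.

Lemma octcE i j k : (i < 8)%N -> (j < 8)%N -> (k < 8)%N ->
  octc R i j k = (-1) ^+ osgn i j * (k == oidx i j)%:R.
Proof.
pose c (i j k : nat) : int := if i == 0%N then (j == k)%:R
  else if j == 0%N then (i == k)%:R
  else if i == j then - (k == 0%N)%:R
  else if cyc i j k then 1 else if cyc j i k then -1 else 0.
have -> : octc R i j k = (c i j k)%:~R.
  rewrite /octc /c; do 5?[case: ifP => _]; rewrite ?rmorphN ?rmorph1 ?rmorph0//.
  - by case: (j == k).
  - by case: (i == k).
  - by case: (k == 0%N).
move=> li lj lk.
have : all (fun i => all (fun j => all (fun k =>
   c i j k == (-1) ^+ osgn i j * (k == oidx i j)%:R) (iota 0 8)) (iota 0 8)) (iota 0 8).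
  by vm_compute.
move=> /allP/(_ i); rewrite mem_iota => /(_ li) /allP/(_ j).
rewrite mem_iota => /(_ lj) /allP/(_ k); rewrite mem_iota => /(_ lk) /eqP ->.
rewrite rmorphM /= rmorph_sign; case: (_ == _) => //=.
Qed.

Lemma oidx_lt i j : (i < 8)%N -> (j < 8)%N -> (oidx i j < 8)%N.
Proof.
move=> li lj.
have : all (fun i => all (fun j => (oidx i j < 8)%N) (iota 0 8)) (iota 0 8) by vm_compute.
move=> /allP/(_ i); rewrite mem_iota => /(_ li) /allP/(_ j).
by rewrite mem_iota => /(_ lj).
Qed.

Lemma omulDl (x y z : oct) : omul (x + y) z = omul x z + omul y z.
Proof.
apply/rowP => k; rewrite !mxE -big_split; apply: eq_bigr => i _ /=.
by rewrite -big_split; apply: eq_bigr => j _; rewrite /= !mxE; ring.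
Qed.
Lemma omulDr (x y z : oct) : omul z (x + y) = omul z x + omul z y.
Proof.
apply/rowP => k; rewrite !mxE -big_split; apply: eq_bigr => i _ /=.
by rewrite -big_split; apply: eq_bigr => j _; rewrite /= !mxE; ring.
Qed.
Lemma omulZl a (x y : oct) : omul (a *: x) y = a *: omul x y.
Proof.
apply/rowP => k; rewrite !mxE mulr_sumr; apply: eq_bigr => i _ /=.
by rewrite mulr_sumr; apply: eq_bigr => j _; rewrite /= !mxE; ring.
Qed.
Lemma omulZr a (x y : oct) : omul x (a *: y) = a *: omul x y.
Proof.
apply/rowP => k; rewrite !mxE mulr_sumr; apply: eq_bigr => i _ /=.
by rewrite mulr_sumr; apply: eq_bigr => j _; rewrite /= !mxE; ring.
Qed.

Lemma omul_basis i j : (i < 8)%N -> (j < 8)%N ->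
  omul (e i) (e j) = (-1) ^+ osgn i j *: e (oidx i j).
Proof.
move=> li lj; apply/rowP => k; rewrite !mxE /=.
rewrite (bigD1 (inord i)) //= [X in _ + X]big1 ?addr0; last first.
  move=> a /negPf ai; rewrite big1// => b _; rewrite mxE ai.
  by rewrite andbF !mul0r.
rewrite (bigD1 (inord j)) //= [X in _ + X]big1 ?addr0; last first.
  by move=> a /negPf ai; rewrite !mxE ai andbF mulr0 mul0r.
rewrite !mxE !eqxx !mul1r octcE ?inordK//.
by rewrite -(inj_eq val_inj) /= !inordK ?oidx_lt.
Qed.

Lemma one_oE : one_o R = e 0%N.
Proof. by rewrite /one_o /oe; congr obasis; apply/val_inj; rewrite /= inordK. Qed.

Lemma oct_basis_sum (x : oct) : x = \sum_(i < 8) x 0 i *: obasis R i.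
Proof. exact: row_sum_delta. Qed.

Lemma omul1o (x : oct) : omul (one_o R) x = x.
Proof.
rewrite (oct_basis_sum x); apply: (big_ind (fun y => omul (one_o R) y = y)).
- by rewrite -(scale0r 0) omulZr !scale0r.
- by move=> a b Ha Hb; rewrite omulDr Ha Hb.
move=> i _; rewrite omulZr.
have -> : obasis R i = e i by rewrite /oe inord_val.
by rewrite one_oE omul_basis //= /oidx /= /osgn /= scale1r.
Qed.
Lemma omulo1 (x : oct) : omul x (one_o R) = x.
Proof.
rewrite (oct_basis_sum x); apply: (big_ind (fun y => omul y (one_o R) = y)).
- by rewrite -(scale0r 0) omulZl !scale0r.
- by move=> a b Ha Hb; rewrite omulDl Ha Hb.
move=> i _; rewrite omulZl.
have -> : obasis R i = e i by rewrite /oe inord_val.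
rewrite one_oE omul_basis //= /oidx /osgn andbF /= scale1r.
by case: eqP => [->|].
Qed.

End OctonionBasis.

(** * Octonion bimodules *)

Section BimoduleAlgebra.
Variables (R : realType) (V : completeNormedModType R).
Variables (lm : oct R -> V -> V) (rm : V -> oct R -> V).
Hypothesis HV : banach_O_bimodule lm rm.
Local Notation e := (oe R).
Local Notation A := (assoc_ppx lm).
Implicit Types (x y : V) (p q a b c : oct R).

Lemma lmDr p x y : lm p (x + y) = lm p x + lm p y.
Proof. by case: HV. Qed.
Lemma lmDl p q x : lm (p + q) x = lm p x + lm q x.
Proof. by case: HV => _ []. Qed.
Lemma lmZl (r : R) p x : lm (r *: p) x = r *: lm p x.
Proof. by case: HV => _ [_ []]. Qed.
Lemma lmZr (r : R) p x : lm p (r *: x) = r *: lm p x.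
Proof. by case: HV => _ [_ [_ []]]. Qed.
Lemma rmDl p x y : rm (x + y) p = rm x p + rm y p.
Proof. by case: HV => _ [_ [_ [_ []]]]. Qed.
Lemma rmDr p q x : rm x (p + q) = rm x p + rm x q.
Proof. by case: HV => _ [_ [_ [_ [_ []]]]]. Qed.
Lemma rmZr (r : R) p x : rm x (r *: p) = r *: rm x p.
Proof. by case: HV => _ [_ [_ [_ [_ [_ []]]]]]. Qed.
Lemma rmZl (r : R) p x : rm (r *: x) p = r *: rm x p.
Proof. by case: HV => _ [_ [_ [_ [_ [_ [_ []]]]]]]. Qed.
Lemma lm1 x : lm (one_o R) x = x.
Proof. by case: HV => _ [_ [_ [_ [_ [_ [_ [_ []]]]]]]]. Qed.
Lemma rm1 x : rm x (one_o R) = x.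
Proof. by case: HV => _ [_ [_ [_ [_ [_ [_ [_ [_ []]]]]]]]]. Qed.
Lemma assoc_pxqE p q x : assoc_pxq lm rm q x p = A p q x.
Proof. by case: HV => _ [_ [_ [_ [_ [_ [_ [_ [_ [_ []]]]]]]]]] /(_ p q x)[-> _]. Qed.
Lemma assoc_xpqE p q x : assoc_xpq rm x p q = A p q x.
Proof.
case: HV => _ [_ [_ [_ [_ [_ [_ [_ [_ [_ []]]]]]]]]] /(_ p q x)[-> [->]] //.
Qed.
Lemma assocC p q x : A p q x = - A q p x.
Proof.
rewrite -assoc_xpqE.
by case: HV => _ [_ [_ [_ [_ [_ [_ [_ [_ [_ []]]]]]]]]] /(_ p q x)[_ [_ ->]].
Qed.
Lemma norm_lm p x : `|lm p x| = onorm p * `|x|.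
Proof. by case: HV => _ [_ [_ [_ [_ [_ [_ [_ [_ [_ [_ []]]]]]]]]]]. Qed.
Lemma norm_rm p x : `|rm x p| = onorm p * `|x|.
Proof. by case: HV => _ [_ [_ [_ [_ [_ [_ [_ [_ [_ [_ []]]]]]]]]]]. Qed.

Lemma lmN p x : lm p (- x) = - lm p x.
Proof. by rewrite -scaleN1r lmZr scaleN1r. Qed.
Lemma lmNl p x : lm (- p) x = - lm p x.
Proof. by rewrite -scaleN1r lmZl scaleN1r. Qed.
Lemma rmN p x : rm x (- p) = - rm x p.
Proof. by rewrite -scaleN1r rmZr scaleN1r. Qed.
Lemma rmNl p x : rm (- x) p = - rm x p.
Proof. by rewrite -scaleN1r rmZl scaleN1r. Qed.
Lemma lm0 p : lm p 0 = 0.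
Proof. by rewrite -(scale0r (0:V)) lmZr !scale0r. Qed.
Lemma rm0 p : rm 0 p = 0.
Proof. by rewrite -(scale0r (0:V)) rmZl !scale0r. Qed.
Lemma rm0r x : rm x 0 = 0.
Proof. by rewrite -(scale0r (0:oct R)) rmZr !scale0r. Qed.

Definition bimodE := (lmDr, lmDl, lmZl, lmZr, rmDl, rmDr, rmZr, rmZl, lmN, lmNl, rmN, rmNl).

Let T1 a b c x : A b c (rm x a) - A (omul a b) c x + A a (omul b c) x
  - rm x (omul (omul a b) c - omul a (omul b c)) - rm (A a b x) c = 0.
Proof. by rewrite -!assoc_xpqE /assoc_xpq !bimodE; lmod. Qed.
Let T2 a b c x : A b c (lm a x) - A c a (rm x b) + A (omul b c) a x
  - lm a (A b c x) - rm (A b a x) c = 0.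
Proof.
rewrite -(assoc_xpqE b c (lm a x)) -(assoc_xpqE b c x) -(assoc_pxqE c a) -(assoc_pxqE (omul b c) a).
by rewrite -(assoc_pxqE b a) /assoc_xpq /assoc_pxq !bimodE; lmod.
Qed.
Let T4 a b c x : A (omul a b) c x - A a (omul b c) x + A a b (lm c x)
  - lm a (A b c x) - lm (omul (omul a b) c - omul a (omul b c)) x = 0.
Proof. by rewrite /assoc_ppx !bimodE; lmod. Qed.

(* Cyclic sums of the Teichmüller identity with the module element in the first, second and fourth place. *)
Lemma assoc_cyclic a b c (n : oct R) x :
  omul (omul a b) c - omul a (omul b c) = n ->
  omul (omul b c) a - omul b (omul c a) = n ->
  omul (omul c a) b - omul c (omul a b) = n ->
  A (omul a b) c x + A (omul b c) a x + A (omul c a) b x = lm n x - rm x n.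
Proof.
move=> h1 h2 h3.
have a1 := T1 a b c x; have a2 := T1 b c a x; have a3 := T1 c a b x.
have b1 := T2 a b c x; have b2 := T2 b c a x; have b3 := T2 c a b x.
have c1 := T4 a b c x; have c2 := T4 b c a x; have c3 := T4 c a b x.
rewrite ?h1 ?h2 ?h3 in a1 a2 a3 b1 b2 b3 c1 c2 c3.
rewrite !(assocC a (omul b c)) !(assocC b (omul c a)) !(assocC c (omul a b)) in a1 a2 a3 c1 c2 c3.
rewrite !(assocC b a) !(assocC c b) !(assocC a c) !rmNl in b1 b2 b3.
apply: (@scalerI _ _ 3%:R); first by rewrite pnatr_eq0.
have c0 (u v w : V) : u = 0 -> v = 0 -> w = 0 -> u + v + w = 0.
  by move=> -> -> ->; rewrite !addr0.
have d0 (u v w y z : V) : u = 0 -> v = 0 -> w = 0 -> y - z = u - v - w -> y = z.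
  by move=> -> -> ->; rewrite !subr0 => /subr0_eq.
apply: (d0 _ _ _ _ _ (c0 _ _ _ c1 c2 c3) (c0 _ _ _ b1 b2 b3) (c0 _ _ _ a1 a2 a3)).
lmod.
Qed.

Local Notation L i := (lm (e i)).

Definition Lw (w : seq nat) (x : V) : V := foldr (fun i y => L i y) x w.

Lemma Lw_cat w1 w2 x : Lw (w1 ++ w2) x = Lw w1 (Lw w2 x).
Proof. exact: foldr_cat. Qed.

Lemma lm_basis i j x : (0 < i < 8)%N -> (0 < j < 8)%N ->
  L i (L j x) = (-1) ^+ osgn i j *: L (oidx i j) x - A (e i) (e j) x.
Proof.
by move=> /andP[_ li] /andP[_ lj]; rewrite /assoc_ppx omul_basis// lmZl opprB addrC subrK.
Qed.

Lemma lm_sq i x : (0 < i < 8)%N -> L i (L i x) = - x.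
Proof.
move=> li; rewrite lm_basis//.
have -> : A (e i) (e i) x = 0.
  have := assocC (e i) (e i) x => /eqP; rewrite -addr_eq0 -mulr2n.
  by rewrite -scaler_nat scaler_eq0 pnatr_eq0 /= => /eqP.
move: li; rewrite /osgn /oidx eqxx; case: i => //= i _.
by rewrite -one_oE lm1 subr0 expr1 scaleN1r.
Qed.

Lemma osgn_oidxC i j : (0 < i < 8)%N -> (0 < j < 8)%N -> i != j ->
  (oidx i j == oidx j i) && (osgn i j == ~~ osgn j i).
Proof.
move=> li lj ij.
have : all (fun i => all (fun j => [&& (0 < i)%N, (0 < j)%N & i != j] ==>
  (oidx i j == oidx j i) && (osgn i j == ~~ osgn j i)) (iota 0 8)) (iota 0 8).
  by vm_compute.
move: li lj => /andP[i0 li] /andP[j0 lj].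
move=> /allP/(_ i); rewrite mem_iota => /(_ li) /allP/(_ j).
by rewrite mem_iota => /(_ lj); rewrite i0 j0 ij.
Qed.

Lemma lm_anti i j x : (0 < i < 8)%N -> (0 < j < 8)%N -> i != j ->
  L i (L j x) = - L j (L i x).
Proof.
move=> li lj ij; rewrite !lm_basis// (assocC (e i)).
have /andP[/eqP -> /eqP ->] := osgn_oidxC li lj ij.
by case: osgn; rewrite /= ?expr0 ?expr1; lmod.
Qed.

(* Insertion of a Clifford generator into a sorted word; the boolean is the sign. *)
Fixpoint cins (i : nat) (w : seq nat) : bool * seq nat :=
  match w with
  | [::] => (false, [:: i])
  | j :: w' => if i == j then (true, w') else if (i < j)%N then (false, i :: w)
               else let r := cins i w' in (~~ r.1, j :: r.2)
  end.
Definition cnf (w : seq nat) : bool * seq nat :=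
  foldr (fun i r => let r' := cins i r.2 in (r.1 (+) r'.1, r'.2)) (false, [::]) w.

Lemma lm_sign (b : bool) p x : lm p ((-1) ^+ b *: x) = (-1) ^+ b *: lm p x.
Proof. exact: lmZr. Qed.

Definition cok := all (fun i => 0 < i < 8)%N.

Lemma cinsP i w x : (0 < i < 8)%N -> cok w ->
  L i (Lw w x) = (-1) ^+ (cins i w).1 *: Lw (cins i w).2 x.
Proof.
move=> li; elim: w => [|j w IH] /=; first by rewrite scale1r.
move=> /andP[lj lw]; case: eqP => [->|/eqP ij] /=.
  by rewrite lm_sq// expr1 scaleN1r.
case: ifP => _ /=; first by rewrite expr0 scale1r.
rewrite lm_anti// IH// lm_sign -scaleNr; congr (_ *: _).
by case: (cins i w).1; rewrite /= ?expr1 ?expr0 ?opprK.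
Qed.

Lemma cok_cins i w : (0 < i < 8)%N -> cok w -> cok (cins i w).2.
Proof.
move=> li; elim: w => [|j w IH] /=; first by rewrite li.
move=> /andP[lj lw]; case: eqP => // _; case: ifP => _ /=; first by rewrite li lj.
by rewrite lj IH.
Qed.

Lemma cnfP w x : cok w -> Lw w x = (-1) ^+ (cnf w).1 *: Lw (cnf w).2 x.
Proof.
move=> lw; suff [] : Lw w x = (-1) ^+ (cnf w).1 *: Lw (cnf w).2 x /\ cok (cnf w).2 by [].
elim: w lw => [|i w IH] /=; first by rewrite scale1r.
move=> /andP[li /IH[-> cw]]; split; last exact: cok_cins.
by rewrite lm_sign cinsP// scalerA signr_addb.
Qed.

Lemma Lw_eq w1 w2 x : cok w1 -> cok w2 -> cnf w1 = cnf w2 -> Lw w1 x = Lw w2 x.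
Proof. by move=> h1 h2 h; rewrite (cnfP x h1) (cnfP x h2) h. Qed.

End BimoduleAlgebra.

Definition lines : seq (seq nat) :=
  [:: [:: 1;2;4]; [:: 2;3;5]; [:: 3;4;6]; [:: 4;5;7]; [:: 5;6;1]; [:: 6;7;2]; [:: 7;1;3]]%N.

Arguments oidx : simpl never.
Arguments osgn : simpl never.

Section BimoduleAlgebra2.
Variables (R : realType) (V : completeNormedModType R).
Variables (lm : oct R -> V -> V) (rm : V -> oct R -> V).
Hypothesis HV : banach_O_bimodule lm rm.
Local Notation e := (oe R).
Local Notation A := (assoc_ppx lm).
Local Notation L i := (lm (e i)).
Local Notation Lw := (Lw lm).
Local Notation lin := (bimodE HV).
Implicit Types (x y : V).

Definition bimul (i : nat) (x : V) : V := L i (rm x (e i)).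

Lemma assoc_diag p x : A p p x = 0.
Proof.
have := assocC HV p p x => /eqP; rewrite -addr_eq0 -mulr2n.
by rewrite -scaler_nat scaler_eq0 pnatr_eq0 /= => /eqP.
Qed.

Lemma rm_sq i x : (0 < i < 8)%N -> rm (rm x (e i)) (e i) = - x.
Proof.
move=> /andP[i0 i8]; have := assoc_xpqE HV (e i) (e i) x.
rewrite assoc_diag /assoc_xpq => /subr0_eq ->.
rewrite omul_basis// /osgn /oidx eqxx; case: i i0 {i8} => //= i _.
by rewrite expr1 scaleN1r (rmN HV) -one_oE (rm1 HV).
Qed.

Lemma bimul_invol i x : (0 < i < 8)%N -> bimul i (bimul i x) = x.
Proof.
move=> li; rewrite /bimul.
have := assoc_pxqE HV (e i) (e i) (rm x (e i)).
rewrite assoc_diag /assoc_pxq => /subr0_eq ->.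
by rewrite (lm_sq HV)// rm_sq// opprK.
Qed.

Definition rot (k i : nat) : nat := ((i.-1 + k) %% 7).+1.

Lemma bimulD i x y : bimul i (x + y) = bimul i x + bimul i y.
Proof. by rewrite /bimul !lin. Qed.
Lemma bimulZ i r x : bimul i (r *: x) = r *: bimul i x.
Proof. by rewrite /bimul !lin. Qed.

Lemma LwD w x y : Lw w (x + y) = Lw w x + Lw w y.
Proof. by elim: w => //= i w ->; rewrite lin. Qed.
Lemma LwZ w r x : Lw w (r *: x) = r *: Lw w x.
Proof. by elim: w => //= i w ->; rewrite lin. Qed.
Lemma LwN w x : Lw w (- x) = - Lw w x.
Proof. by rewrite -scaleN1r LwZ scaleN1r. Qed.

Definition Lc (c : bool * seq nat) (x : V) := (-1) ^+ c.1 *: Lw c.2 x.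

Lemma bimul_cyclic (a b c p : nat) x :
  cok [:: a; b; c; p; oidx a b; oidx b c; oidx c a] ->
  let ok a b c := [&& oidx (oidx a b) c == p, osgn (oidx a b) c == osgn a b,
    oidx c (oidx a b) == p & osgn c (oidx a b) != osgn a b] in
  ok a b c -> ok b c a -> ok c a b ->
  Lc (osgn a b, [:: p; oidx a b; c]) x + Lc (osgn b c, [:: p; oidx b c; a]) x
  + Lc (osgn c a, [:: p; oidx c a; b]) x = 2 *: bimul p x - x.
Proof.
move=> /= /and5P[la lb lc lp /and4P[l1 l2 l3 _]].
move=> /and4P[/eqP h1 /eqP h2 /eqP h3 /negPf h4] /and4P[/eqP h5 /eqP h6 /eqP h7 /negPf h8].
move=> /and4P[/eqP h9 /eqP h10 /eqP h11 /negPf h12].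
have lt8 i : (0 < i < 8)%N -> (i < 8)%N by case/andP.
have E (i j : nat) : (0 < i < 8)%N -> (0 < j < 8)%N ->
    omul (e i) (e j) = (-1) ^+ osgn i j *: e (oidx i j).
  by move=> /lt8 li /lt8 lj; exact: omul_basis.
have S (b1 b2 : bool) : (b1 == b2) = false -> b1 = ~~ b2 by case: b1 b2 => [] [].
have K (s t : bool) (q : oct R) :
   (-1) ^+ s *: ((-1) ^+ s *: q) - (-1) ^+ t *: ((-1) ^+ (~~ t) *: q) = 2 *: q.
  by rewrite !scalerA -!signr_addb addbb addbN addbb expr0 expr1; lmod.
have /(_ (2 *: e p) x) := @assoc_cyclic _ _ _ _ HV (e a) (e b) (e c).
rewrite !E// !omulZl !omulZr !E// h1 h2 h3 h5 h6 h7 h9 h10 h11.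
rewrite (S _ _ h4) (S _ _ h8) (S _ _ h12) !K => /(_ erefl erefl erefl).
rewrite /assoc_ppx !omulZl !E// h1 h2 h5 h6 h9 h10 !scalerA -!signr_addb !addbb !expr0 !scale1r !lin.
move=> H; rewrite /Lc /= /bimul.
have := congr1 (L p) H; rewrite !lin !(lm_sq HV)// => {}H.
have d (u v y z : V) : u = v -> y - z = v - u -> y = z.
  by move=> ->; rewrite subrr => /subr0_eq.
apply: (d _ _ _ _ H).
move: (_ ^+ osgn a b) (_ ^+ osgn b c) (_ ^+ osgn c a) => s1 s2 s3.
lmod.
Qed.

Lemma big_seq3 (I : Type) (F : I -> V) i j k :
  \sum_(l <- [:: i; j; k]) F l = F i + F j + F k.
Proof. by rewrite !big_cons big_nil addr0 addrA. Qed.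

Definition lines_at (p : nat) : seq (seq nat) :=
  [:: [:: p; rot p 1; rot p 3]; [:: p; rot p 4; rot p 5]; [:: p; rot p 2; rot p 6]]%N.

Definition cnfs (c : bool * seq nat) := (c.1 (+) (cnf c.2).1, (cnf c.2).2).

Lemma Lc_cnfs c x : cok c.2 -> Lc c x = Lc (cnfs c) x.
Proof. by move=> ok; rewrite /Lc (cnfP HV x ok) scalerA -signr_addb. Qed.

Lemma Lw_cnf w x : cok w -> Lw w x = Lc (cnf w) x.
Proof. exact: (cnfP HV). Qed.

Lemma lines_at_sum p x : (0 < p < 8)%N ->
  \sum_(c <- map cnf (lines_at p)) Lc c x = 2 *: bimul p x - x.
Proof.
move=> lp; have lp8 : p \in iota 1 7 by rewrite mem_iota.
pose a := rot p.-1 2; pose b := rot p.-1 3; pose c := rot p.-1 6.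
pose ok p a b c := [&& oidx (oidx a b) c == p, osgn (oidx a b) c == osgn a b,
    oidx c (oidx a b) == p & osgn c (oidx a b) != osgn a b].
pose ws p a b c := [:: (osgn a b, [:: p; oidx a b; c]); (osgn b c, [:: p; oidx b c; a]);
   (osgn c a, [:: p; oidx c a; b])].
have : all (fun p => let a := rot p.-1 2 in let b := rot p.-1 3 in let c := rot p.-1 6 in
   [&& cok [:: a; b; c; p; oidx a b; oidx b c; oidx c a], ok p a b c, ok p b c a, ok p c a b &
    all (fun c => cok c.2) (ws p a b c) &&
    perm_eq (map cnf (lines_at p)) (map cnfs (ws p a b c))]) (iota 1 7).
  by vm_compute.
move=> /allP/(_ _ lp8); rewrite -/a -/b -/c.
move=> /and5P[h1 h2 h3 h4 /andP[h5 h8]].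
rewrite (perm_big _ h8) big_map big_seq3.
have S3 c1 c2 c3 : all (fun c => cok c.2) [:: c1; c2; c3] ->
    Lc (cnfs c1) x + Lc (cnfs c2) x + Lc (cnfs c3) x = Lc c1 x + Lc c2 x + Lc c3 x.
  by move=> /and4P[? ? ? _]; rewrite -!Lc_cnfs.
rewrite (S3 _ _ _ h5).
exact: (bimul_cyclic x h1 h2 h3 h4).
Qed.

Definition concurrent (p : nat) (s t u : seq nat) : bool :=
  [&& cok s, cok t & cok u] &&
  perm_eq (map cnf [:: s; t; u]) (map cnf (lines_at p)) &&
  all (fun w => cnf (w ++ w) == (false, [::])) [:: s; t; u] &&
  [&& cnf (s ++ t) == cnf (t ++ s), cnf (s ++ u) == cnf (u ++ s),
      cnf (t ++ u) == cnf (u ++ t), cnf (s ++ t ++ u ++ t) == cnf (s ++ u) &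
      cnf (s ++ t ++ u ++ s) == cnf (t ++ u)].

(* With w = T_s T_t T_u and Y = T_s + T_t + T_u = 2 U - 1, the relation U^2 = 1 gives
   w Y = - Y and Y (Y + 2) = 3, hence w = -1. *)
Lemma line_mul p s t u x : (0 < p < 8)%N -> concurrent p s t u ->
  Lw (s ++ t) x = - Lw u x.
Proof.
move=> lp /andP[/andP[/andP[/and3P[os ot ou] hp] /and4P[ss tt uu _]]].
move=> /and5P[/eqP c1 /eqP c2 /eqP c3 /eqP c4 /eqP c5].
have cc w1 w2 : cok w1 -> cok w2 -> cok (w1 ++ w2).
  by rewrite /cok all_cat => -> ->.
have inv w y : cok w -> cnf (w ++ w) == (false, [::]) -> Lw w (Lw w y) = y.
  move=> ow /eqP h; rewrite -Lw_cat -[RHS]/(Lw [::] y).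
  by apply: (Lw_eq HV) => //; exact: cc.
have com w1 w2 y : cok w1 -> cok w2 -> cnf (w1 ++ w2) = cnf (w2 ++ w1) ->
    Lw w1 (Lw w2 y) = Lw w2 (Lw w1 y).
  move=> o1 o2 h; rewrite -!Lw_cat; apply: (Lw_eq HV) => //; exact: cc.
have Y y : Lw s y + Lw t y + Lw u y = 2 *: bimul p y - y.
  rewrite -(lines_at_sum y lp) -(perm_big _ hp) big_map big_seq3.
  by rewrite -!Lw_cnf.
pose Z y := Lw s y + Lw t y + Lw u y.
have ZZ y : Z (Z y) = 3%:R *: y - 2%:R *: Z y.
  have -> : Z (Z y) = 2 *: bimul p (Z y) - Z y by rewrite -Y.
  rewrite /Z Y bimulD bimulZ bimul_invol// -scaleN1r bimulZ; lmod.
have ZZ' y : Z (Z y) = 3%:R *: y + 2%:R *: (Lw s (Lw t y) + Lw s (Lw u y) + Lw t (Lw u y)).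
  rewrite {1}/Z /Z !LwD !inv// (com t s)// (com u s)// (com u t)//; lmod.
pose w y := Lw s (Lw t (Lw u y)).
have wZ y : w (Z y) = - Z y.
  have -> : w (Z y) = Lw s (Lw t y) + Lw s (Lw u y) + Lw t (Lw u y).
    have e1 : Lw s (Lw t (Lw u (Lw s y))) = Lw t (Lw u y).
      by rewrite -!Lw_cat -!catA; apply: (Lw_eq HV); rewrite ?cc//.
    have e2 : Lw s (Lw t (Lw u (Lw t y))) = Lw s (Lw u y).
      by rewrite -!Lw_cat -!catA; apply: (Lw_eq HV); rewrite ?cc//.
    rewrite /w /Z !LwD (inv u)// e1 e2; lmod.
  have : 2%:R *: (Lw s (Lw t y) + Lw s (Lw u y) + Lw t (Lw u y)) = 2%:R *: - Z y.
    have := ZZ' y; rewrite ZZ => /addrI <-; lmod.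
  by apply: scalerI; rewrite pnatr_eq0.
have wE y : w y = - y.
  have wD a b : w (a + b) = w a + w b by rewrite /w !LwD.
  have wS r a : w (r *: a) = r *: w a by rewrite /w !LwZ.
  have ZD a b : Z (a + b) = Z a + Z b by rewrite /Z !LwD; lmod.
  have ZS r a : Z (r *: a) = r *: Z a by rewrite /Z !LwZ; lmod.
  have : 3%:R *: w y = 3%:R *: - y.
    have -> : 3%:R *: w y = w (Z (Z y + 2%:R *: y)).
      by rewrite ZD ZS ZZ -wS; congr w; lmod.
    by rewrite wZ ZD ZS ZZ; lmod.
  by apply: scalerI; rewrite pnatr_eq0.
rewrite Lw_cat -[in LHS](inv u x ou uu) -[LHS]/(w (Lw u x)); exact: wE.
Qed.

Definition third (t s : seq nat) : seq nat :=
  nth [::] lines (find (fun u => has (fun p => concurrent p t s u) (iota 1 7)) lines).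

Lemma thirdP t : t \in lines ->
  (forall s x, s \in rem t lines -> Lw t (Lw s x) = - Lw (third t s) x) /\
  perm_eq (map (third t) (rem t lines)) (rem t lines).
Proof.
have : all (fun t => perm_eq (map (third t) (rem t lines)) (rem t lines) &&
   all (fun s => has (fun u => has (fun p => concurrent p t s u) (iota 1 7)) lines) (rem t lines))
   lines by vm_compute.
move=> /allP H /H /andP[hp /allP hs]; split => // s x /hs h.
have := nth_find [::] h; rewrite -/(third t s) => /hasP[p].
by rewrite mem_iota -Lw_cat => lp; exact: line_mul.
Qed.

Lemma line_sq t x : t \in lines -> Lw t (Lw t x) = x.
Proof.
have : all (fun t => cok (t ++ t) && (cnf (t ++ t) == (false, [::]))) lines by vm_compute.
move=> /allP H /H /andP[ok /eqP h]; rewrite -Lw_cat -[RHS]/(Lw [::] x).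
exact: (Lw_eq HV).
Qed.

(* The products [Lw t] over the seven lines are commuting involutions whose common (-1)-eigenspace
   is [Re V]; this is the projection onto it. *)
Definition reproj (x : V) : V := 8%:R^-1 *: (x - \sum_(t <- lines) Lw t x).

Lemma Lw_reproj t x : t \in lines -> Lw t (reproj x) = - reproj x.
Proof.
move=> tl; have [H hp] := thirdP tl.
rewrite /reproj LwZ -scalerN; congr (_ *: _).
rewrite LwD LwN; have -> : Lw t (\sum_(s <- lines) Lw s x) = \sum_(s <- lines) Lw t (Lw s x).
  by elim/big_rec2: _ => [|s a b _ <-]; rewrite ?LwD// -(scale0r 0) LwZ !scale0r.
rewrite !(perm_big _ (perm_to_rem tl)) !big_cons line_sq//.
have -> : \sum_(s <- rem t lines) Lw t (Lw s x) = - \sum_(s <- rem t lines) Lw s x.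
  rewrite (eq_big_seq _ (fun s => H s x)) sumrN -(big_map (third t) xpredT (fun s => Lw s x)).
  by rewrite (perm_big _ hp).
by rewrite !opprB addrA.
Qed.

Lemma lm_mul_reproj i j x : (i < 8)%N -> (j < 8)%N ->
  L i (L j (reproj x)) = lm (omul (e i) (e j)) (reproj x).
Proof.
move=> li lj; case: (posnP i) => [->|i0]; first by rewrite -one_oE (lm1 HV) omul1o.
case: (posnP j) => [->|j0]; first by rewrite -one_oE (lm1 HV) omulo1.
have {}li : (0 < i < 8)%N by rewrite i0.
have {}lj : (0 < j < 8)%N by rewrite j0.
case: (eqVneq i j) => [->|ij].
  rewrite (lm_sq HV)//; case/andP: lj => _ lj; rewrite omul_basis//.
  have [-> ->] : osgn j j = true /\ oidx j j = 0%N.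
    by rewrite /osgn /oidx eqxx; case: (j) j0.
  by rewrite expr1 scaleN1r (lmNl HV) -one_oE (lm1 HV).
have chk : all (fun i => all (fun j => (i != j) ==> [&& cok [:: oidx i j; i; j] &
   has (fun t => cok t && (cnf [:: oidx i j; i; j] == (osgn i j (+) (cnf t).1, (cnf t).2)))
     lines]) (iota 1 7)) (iota 1 7).
  by vm_compute.
have := allP chk i; rewrite mem_iota => /(_ li) /allP/(_ j).
rewrite mem_iota => /(_ lj); rewrite ij implyTb => /andP[ok /hasP[t tl /andP[okt /eqP h]]].
have := Lw_cnf (reproj x) ok; rewrite h /Lc signr_addb -scalerA -[X in _ *: X](cnfP HV _ okt).
rewrite (Lw_reproj x tl) -[Lw _ _]/(L (oidx i j) (L i (L j (reproj x)))) => /(congr1 (L (oidx i j))).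
case/and4P: ok => lk _ _ _; rewrite (lm_sq HV _ lk) scalerN (lmN HV) (lmZr HV) => /oppr_inj ->.
case/andP: li => _ li; case/andP: lj => _ lj.
rewrite (omul_basis _ li lj) (lmZl HV); exact (lmZr HV _ _ _).
Qed.
End BimoduleAlgebra2.

Section OctonionReal.
Variable R : realType.
Local Notation oct := (oct R).
Local Notation e := (oe R).

Lemma oe_ord (i : 'I_8) : e i = obasis R i.
Proof. by rewrite /oe inord_val. Qed.

Lemma oct_ind (P : oct -> Prop) :
  (forall p q, P p -> P q -> P (p + q)) -> (forall r p, P p -> P (r *: p)) ->
  (forall i, (i < 8)%N -> P (e i)) -> forall p, P p.
Proof.
move=> PD PZ Pe p; rewrite (oct_basis_sum p); apply: (big_ind P) => //.
  by rewrite -(scale0r (e 0)); apply: PZ; exact: Pe.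
move=> i _; apply: PZ; rewrite -oe_ord.
exact: Pe.
Qed.

Lemma oct_addE (p q : oct) i : (p + q) 0 i = p 0 i + q 0 i.
Proof. by rewrite mxE. Qed.
Lemma oct_scaleE r (p : oct) i : (r *: p) 0 i = r * p 0 i.
Proof. by rewrite mxE. Qed.

Lemma oct_coord0 k : (k < 8)%N -> e k 0 ord0 = (k == 0%N)%:R.
Proof. by move=> lk; rewrite mxE eqxx /= -val_eqE /= inordK// eq_sym. Qed.

Local Opaque oidx osgn oe omul.

Lemma omul_real_comm (p q : oct) : omul p q 0 ord0 = omul q p 0 ord0.
Proof.
elim/oct_ind: p => [p p' Hp Hp'|r p Hp|i li].
- by rewrite omulDl omulDr !oct_addE Hp Hp'.
- by rewrite omulZl omulZr !oct_scaleE Hp.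
elim/oct_ind: q => [p p' Hp Hp'|r p Hp|j lj].
- by rewrite omulDl omulDr !oct_addE Hp Hp'.
- by rewrite omulZl omulZr !oct_scaleE Hp.
rewrite !omul_basis// !oct_scaleE !oct_coord0 ?oidx_lt//.
have : all (fun i => all (fun j => ((oidx i j == 0) == (oidx j i == 0%N)) &&
   ((oidx i j == 0%N) ==> (osgn i j == osgn j i))) (iota 0 8)) (iota 0 8) by vm_compute.
move=> /allP/(_ i); rewrite mem_iota => /(_ li) /allP/(_ j); rewrite mem_iota => /(_ lj).
by case/andP => /eqP <-; case: (_ == _) => /= [/eqP ->|]; rewrite ?mulr0.
Qed.

Lemma omul_real_assoc (p q r : oct) :
  omul (omul p q) r 0 ord0 = omul p (omul q r) 0 ord0.
Proof.
elim/oct_ind: p => [p p' Hp Hp'|s p Hp|i li].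
- by rewrite !omulDl !oct_addE Hp Hp'.
- by rewrite !omulZl !oct_scaleE Hp.
elim/oct_ind: q => [p p' Hp Hp'|s p Hp|j lj].
- by rewrite omulDr !omulDl omulDr !oct_addE Hp Hp'.
- by rewrite omulZr !omulZl omulZr !oct_scaleE Hp.
elim/oct_ind: r => [p p' Hp Hp'|s p Hp|k lk].
- by rewrite !omulDr !oct_addE Hp Hp'.
- by rewrite !omulZr !oct_scaleE Hp.
rewrite (omul_basis _ li lj) (omul_basis _ lj lk) omulZl omulZr.
rewrite (omul_basis _ (oidx_lt li lj) lk) (omul_basis _ li (oidx_lt lj lk)) !oct_scaleE.
have lk1 := oidx_lt (oidx_lt li lj) lk; have lk2 := oidx_lt li (oidx_lt lj lk).
have : all (fun i => all (fun j => all (fun k =>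
   ((oidx (oidx i j) k == 0) == (oidx i (oidx j k) == 0%N)) &&
   ((oidx (oidx i j) k == 0%N) ==> (osgn i j (+) osgn (oidx i j) k ==
     osgn j k (+) osgn i (oidx j k)))) (iota 0 8)) (iota 0 8)) (iota 0 8) by vm_compute.
move=> /allP/(_ i); rewrite mem_iota => /(_ li) /allP/(_ j); rewrite mem_iota => /(_ lj).
move=> /allP/(_ k); rewrite mem_iota => /(_ lk).
move: (oidx (oidx i j) k) (oidx i (oidx j k)) (osgn i j) (osgn _ k) (osgn j k) (osgn i _) lk1 lk2.
move=> k1 k2 b1 b2 b3 b4 lk1 lk2 /andP[/eqP h].
rewrite (oct_coord0 lk1) (oct_coord0 lk2) -h !mulrA -!signr_addb.
by case: (_ == _) => /= [/eqP ->|]; rewrite ?mulr0.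
Qed.

Local Transparent oe.
Lemma onorm_basis k : (k < 8)%N -> onorm (e k) = 1.
Proof.
move=> lk; rewrite /onorm (bigD1 (inord k)) //= big1 ?addr0.
  by rewrite mxE !eqxx expr1n sqrtr1.
by move=> i /negPf ik; rewrite mxE ik andbF expr0n.
Qed.
End OctonionReal.

Local Opaque oidx osgn oe omul.

Section BimoduleDecomposition.
Variables (R : realType) (V : completeNormedModType R).
Variables (lm : oct R -> V -> V) (rm : V -> oct R -> V).
Hypothesis HV : banach_O_bimodule lm rm.
Local Notation e := (oe R).
Local Notation A := (assoc_ppx lm).
Local Notation L i := (lm (e i)).
Local Notation Lw := (Lw lm).
Local Notation lin := (bimodE HV).
Local Notation reproj := (reproj lm).
Local Notation ReV := (Defs.ReV lm rm).
Implicit Types (x y m : V) (p q : oct R).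

Lemma reproj_commute x p : lm p (reproj x) = rm (reproj x) p.
Proof.
elim/oct_ind: p => [p q Hp Hq|r p Hp|i li].
- by rewrite (lmDl HV) (rmDr HV) Hp Hq.
- by rewrite (lmZl HV) (rmZr HV) Hp.
case: (posnP i) => [->|i0]; first by rewrite -one_oE (lm1 HV) (rm1 HV).
have {}li : (0 < i < 8)%N by rewrite i0.
have := lines_at_sum HV (reproj x) li.
have -> : \sum_(c <- map cnf (lines_at i)) Lc lm c (reproj x) = - 3%:R *: reproj x.
  have H c : c \in map cnf (lines_at i) -> Lc lm c (reproj x) = - reproj x.
    have : all (fun i => all (fun c => has (fun t => cok t && (cnf t == c)) lines)
       (map cnf (lines_at i))) (iota 1 7) by vm_compute.
    move=> /allP/(_ i); rewrite mem_iota => /(_ li) /allP h /h /hasP[t tl /andP[ok /eqP <-]].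
    by rewrite -(Lw_cnf HV _ ok) (Lw_reproj HV).
  by rewrite (eq_big_seq _ H) big_map big_seq3; lmod.
move=> h; have {}h : bimul lm rm i (reproj x) = - reproj x.
  apply: (@scalerI _ _ 2%:R); first by rewrite pnatr_eq0.
  move/eqP: h; rewrite eq_sym subr_eq => /eqP ->; lmod.
have := congr1 (L i) h; rewrite /bimul (lm_sq HV _ li) (lmN HV) => /oppr_inj.
by [].
Qed.

Lemma reproj_assoc x p q : lm p (lm q (reproj x)) = lm (omul p q) (reproj x).
Proof.
elim/oct_ind: p => [p p' Hp Hp'|r p Hp|i li].
- by rewrite (lmDl HV) omulDl (lmDl HV) Hp Hp'.
- by rewrite (lmZl HV) omulZl (lmZl HV) Hp.
elim/oct_ind: q => [p p' Hp Hp'|r p Hp|j lj].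
- by rewrite (lmDl HV) (lmDr HV) omulDr (lmDl HV) Hp Hp'.
- by rewrite (lmZl HV) (lmZr HV) omulZr (lmZl HV) Hp.
exact: (lm_mul_reproj HV).
Qed.

Lemma ReV_reproj x : ReV (reproj x).
Proof.
split=> [p|p q]; first exact: reproj_commute.
by rewrite /assoc_ppx reproj_assoc subrr.
Qed.

Lemma ReV_lm m p : ReV m -> lm p m = rm m p.
Proof. by case. Qed.
Lemma ReV_lmlm m p q : ReV m -> lm p (lm q m) = rm m (omul p q).
Proof. by case=> [<- /(_ p q)]; rewrite /assoc_ppx => /subr0_eq. Qed.
Lemma ReV_rmrm m p q : ReV m -> rm (rm m p) q = rm m (omul p q).
Proof. by case=> _ /(_ p q); rewrite -(assoc_xpqE HV) => /subr0_eq. Qed.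
Lemma ReV_lmrm m p q : ReV m -> lm p (rm m q) = rm m (omul p q).
Proof. by move=> H; rewrite -(ReV_lm _ H) ReV_lmlm. Qed.

Lemma ReV_Z r m : ReV m -> ReV (r *: m).
Proof.
move=> [h1 h2]; split=> [p|p q]; first by rewrite !lin h1.
by have := h2 p q; rewrite /assoc_ppx !lin -scalerBr => ->; rewrite scaler0.
Qed.

Lemma Lw_L_comm t k x : t \in lines -> (0 < k < 8)%N ->
  Lw t (L k x) = (-1) ^+ (k \notin t) *: L k (Lw t x).
Proof.
move=> tl lk.
have : all (fun t => all (fun k => cok (t ++ [:: k]) &&
   (cnf (t ++ [:: k]) == ((k \notin t) (+) (cnf (k :: t)).1, (cnf (k :: t)).2)))
   (iota 1 7)) lines by vm_compute.
move=> /allP/(_ _ tl)/allP/(_ k); rewrite mem_iota => /(_ lk) /andP[ok /eqP h].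
have ok' : cok (k :: t).
  by move: ok; rewrite /cok all_cat /= => /andP[-> /andP[-> _]].
have := Lw_cnf HV x ok; rewrite h Lw_cat /Lc signr_addb -scalerA -[X in _ *: X](cnfP HV _ ok').
by [].
Qed.

Lemma line_sum_sign t : t \in lines -> \sum_(k <- iota 1 7) (-1) ^+ (k \notin t) = -1 :> R.
Proof.
have H u : map (fun k => k \notin u) (iota 1 7) = map (fun k => k \notin u) (iota 1 7) by [].
rewrite -(big_map (fun k => k \notin t) xpredT (fun b : bool => (-1) ^+ b)).
have : all (fun t => perm_eq (map (fun k => k \notin t) (iota 1 7))
   [:: false; false; false; true; true; true; true]) lines by vm_compute.
by move=> /allP h /h hp; rewrite (perm_big _ hp) !big_cons big_nil /=; ring.
Qed.

Lemma point_sum_sign k : (0 < k < 8)%N -> \sum_(t <- lines) (-1) ^+ (k \notin t) = -1 :> R.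
Proof.
rewrite -(big_map (fun t => k \notin t) xpredT (fun b : bool => (-1) ^+ b)).
have : all (fun k => perm_eq (map (fun t => k \notin t) lines)
   [:: false; false; false; true; true; true; true]) (iota 1 7) by vm_compute.
move=> /allP h lk; have {}h := h k; rewrite mem_iota in h.
by rewrite (perm_big _ (h lk)) !big_cons big_nil /=; ring.
Qed.

Lemma Lw_ReV t m : ReV m -> t \in lines -> Lw t m = - m.
Proof.
move=> hm tl.
have : all (fun t => if t is [:: a; b; c] then [&& (a < 8)%N, (b < 8)%N, (c < 8)%N,
   oidx b c == a, ~~ osgn b c, oidx a a == 0%N & osgn a a] else false) lines by vm_compute.
move=> /allP/(_ _ tl).
case: t {tl} => [//|a [//|b [//|c [|//]]]] /and5P[la lb lc /eqP h1 /and3P[/negPf h2 /eqP h3 h4]].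
rewrite /= (ReV_lmlm _ _ hm) (omul_basis _ lb lc) h1 h2 expr0 scale1r (ReV_lmrm _ _ hm).
by rewrite (omul_basis _ la la) h3 h4 expr1 scaleN1r (rmN HV) -one_oE (rm1 HV).
Qed.

Lemma reproj_ReV_basis m k : ReV m -> (k < 8)%N -> reproj (rm m (e k)) = (k == 0%N)%:R *: m.
Proof.
move=> hm lk; case: (posnP k) => [->|k0].
  rewrite -one_oE (rm1 HV) /reproj (eq_big_seq _ (fun t => @Lw_ReV t m hm)).
  rewrite !big_cons big_nil [RHS]scale1r.
  have -> : forall u : V, u - (- u + (- u + (- u + (- u + (- u + (- u + (- u + 0))))))) = 8%:R *: u.
    by move=> u; lmod.
  by rewrite scalerA mulVf ?scale1r// pnatr_eq0.
rewrite scale0r -(ReV_lm _ hm) /reproj.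
have {}lk : (0 < k < 8)%N by rewrite k0.
rewrite (eq_big_seq _ (fun t tl => Lw_L_comm m tl lk)).
under eq_big_seq => t tl do rewrite (Lw_ReV hm tl) (lmN HV).
by rewrite -scaler_suml point_sum_sign// scaleN1r opprK subrr scaler0.
Qed.

Lemma reprojD x y : reproj (x + y) = reproj x + reproj y.
Proof.
rewrite /reproj; under eq_bigr do rewrite (LwD HV).
by rewrite big_split /= -scalerDr opprD addrACA.
Qed.
Lemma reprojZ r x : reproj (r *: x) = r *: reproj x.
Proof.
rewrite /reproj; under eq_bigr do rewrite (LwZ HV).
by rewrite -scaler_sumr -scalerBr !scalerA mulrC.
Qed.
Lemma reprojN x : reproj (- x) = - reproj x.
Proof. by rewrite -scaleN1r reprojZ scaleN1r. Qed.

Lemma reproj_rm m q : ReV m -> reproj (rm m q) = q 0 ord0 *: m.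
Proof.
move=> hm; elim/oct_ind: q => [p q Hp Hq|r p Hp|i li].
- by rewrite (rmDr HV) reprojD Hp Hq oct_addE scalerDl.
- by rewrite (rmZr HV) reprojZ Hp oct_scaleE scalerA.
by rewrite reproj_ReV_basis// oct_coord0.
Qed.

Definition comp (i : nat) (x : V) : V := if i == 0%N then reproj x else - reproj (L i x).

Lemma compD i x y : comp i (x + y) = comp i x + comp i y.
Proof. by rewrite /comp (lmDr HV) !reprojD opprD; case: ifP. Qed.
Lemma compZ i r x : comp i (r *: x) = r *: comp i x.
Proof. by rewrite /comp (lmZr HV) !reprojZ; case: ifP => // _; rewrite scalerN. Qed.
Lemma ReV_comp i x : ReV (comp i x).
Proof.
rewrite /comp; case: ifP => _; first exact: ReV_reproj.
by rewrite -scaleN1r; apply: ReV_Z; exact: ReV_reproj.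
Qed.

Lemma decomposition x : x = \sum_(i < 8) rm (comp i x) (obasis R i).
Proof.
transitivity (\sum_(0 <= i < 8) rm (comp i x) (e i)); last first.
  by rewrite big_mkord; apply: eq_bigr => i _; rewrite oe_ord.
have -> : \sum_(0 <= i < 8) rm (comp i x) (e i) =
    reproj x + \sum_(i <- iota 1 7) rm (comp i x) (e i).
  by rewrite /index_iota /= big_cons {1}/comp eqxx -one_oE (rm1 HV).
have H i : i \in iota 1 7 -> rm (comp i x) (e i) =
    8%:R^-1 *: (x - \sum_(t <- lines) (-1) ^+ (i \notin t) *: Lw t x).
  rewrite mem_iota => /[dup] li /andP[i0 _].
  rewrite /comp (gtn_eqF i0) (rmNl HV) -reproj_commute /reproj (lmZr HV) -scalerN; congr (_ *: _).
  rewrite (lmDr HV) (lmN HV) (lm_sq HV _ li) opprD !opprK.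
  congr (_ + _).
  under eq_big_seq => t tl do rewrite (Lw_L_comm x tl li).
  rewrite -sumrN.
  transitivity (\sum_(t <- lines) L i ((-1) ^+ (i \notin t) *: L i (Lw t x))).
    by elim/big_rec2: _ => [|t a b _ <-]; rewrite ?(lm0 HV)// (lmDr HV).
  by apply: eq_bigr => t _; rewrite (lmZr HV) (lm_sq HV _ li) scalerN.
rewrite (eq_big_seq _ H) -scaler_sumr /reproj -scalerDr sumrB exchange_big /=.
under [X in _ + (_ - X)]eq_big_seq => t tl do rewrite -scaler_suml line_sum_sign// scaleN1r.
rewrite sumrN opprK.
have -> : \sum_(i <- [:: 1; 2; 3; 4; 5; 6; 7]%N) x = 7%:R *: x.
  by rewrite !big_cons big_nil; lmod.
have -> : forall s : V, x - s + (7%:R *: x + s) = 8%:R *: x by move=> s; lmod.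
by rewrite scalerA mulVf ?scale1r// pnatr_eq0.
Qed.

Lemma comp_rm i m q : (i < 8)%N -> ReV m -> comp i (rm m q) = q 0 (inord i) *: m.
Proof.
move=> li hm; rewrite /comp; case: (posnP i) => [->|i0].
  by rewrite reproj_rm//; congr (_ *: _); congr (_ _ _); apply/val_inj; rewrite /= inordK.
rewrite (ReV_lmrm _ _ hm) reproj_rm// -scaleNr; congr (_ *: _).
elim/oct_ind: q => [p p' Hp Hp'|r p Hp|j lj].
- by rewrite omulDr !oct_addE opprD Hp Hp'.
- by rewrite omulZr !oct_scaleE -mulrN Hp.
rewrite omul_basis// oct_scaleE oct_coord0 ?oidx_lt// mxE eqxx /= -val_eqE /= !inordK//.
have : all (fun i => all (fun j => ((oidx i j == 0%N) == (i == j)) &&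
   ((i == j) ==> osgn i j)) (iota 0 8)) (iota 1 7) by vm_compute.
move=> /allP/(_ i); rewrite mem_iota i0 => /(_ li) /allP/(_ j); rewrite mem_iota => /(_ lj).
by case/andP => /eqP ->; case: (_ == _) => /= [->|_]; rewrite ?mulr0 ?oppr0// expr1 mulr1 opprK.
Qed.

Lemma comp_unique x xs : decomp lm rm x xs -> forall i, xs i = comp i x.
Proof.
move=> [hr ->] i.
have -> : comp i (\sum_(j < 8) rm (xs j) (obasis R j)) = \sum_(j < 8) (i == j)%:R *: xs j.
  transitivity (\sum_(j < 8) comp i (rm (xs j) (obasis R j))).
    elim/big_rec2: _ => [|j a b _ <-]; last by rewrite compD.
    by rewrite -(scale0r 0) compZ !scale0r.
  apply: eq_bigr => j _; rewrite comp_rm// inord_val mxE eqxx //=.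
rewrite (bigD1 i)//= eqxx scale1r big1 ?addr0// => j /negPf.
by rewrite eq_sym => ->; rewrite scale0r.
Qed.

Lemma ocompE x i : ocomp lm rm x i = comp i x.
Proof.
rewrite /ocomp; case: pselect => [H|]; first by case: cid => xs /= /comp_unique.
case; exists (fun i : 'I_8 => comp i x); split=> [j|]; [exact: ReV_comp|exact: decomposition].
Qed.

Lemma RePE x : ReP lm rm x = reproj x.
Proof. by rewrite /ReP ocompE. Qed.

Lemma norm_Lb i x : (i < 8)%N -> `|L i x| = `|x|.
Proof. by move=> li; rewrite (norm_lm HV) onorm_basis// mul1r. Qed.

Lemma norm_reproj x : `|reproj x| <= `|x|.
Proof.
rewrite /reproj normrZ ger0_norm ?invr_ge0// ler_pdivrMl//.
apply: (le_trans (ler_normB _ _)).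
have -> : 8%:R * `|x| = `|x| + 7%:R * `|x| by ring.
rewrite lerD2l; apply: (le_trans (ler_norm_sum _ _ _)).
have H t : t \in lines -> `|Lw t x| = `|x|.
  have : all (fun t => all (fun i => (i < 8)%N) t) lines by vm_compute.
  move=> /allP h /h; elim: t => //= i t IH /andP[li /IH <-]; exact: norm_Lb.
by rewrite (eq_big_seq _ H) !big_cons big_nil le_eqVlt; apply/orP; left; apply/eqP; ring.
Qed.

Lemma norm_comp i x : (i < 8)%N -> `|comp i x| <= `|x|.
Proof.
move=> li; rewrite /comp; case: ifP => _; first exact: norm_reproj.
by rewrite normrN; apply: (le_trans (norm_reproj _)); rewrite norm_Lb.
Qed.

Lemma reproj_trace y p : reproj (lm p y) = reproj (rm y p).
Proof.
rewrite (decomposition y); elim/big_ind: _ => [|a b Ha Hb|i _].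
- by rewrite (lm0 HV) (rm0 HV).
- by rewrite !lin !reprojD Ha Hb.
rewrite (ReV_lmrm _ _ (ReV_comp i y)) (ReV_rmrm _ _ (ReV_comp i y)).
by rewrite !reproj_rm; try exact: ReV_comp; rewrite omul_real_comm.
Qed.

Lemma reproj_trace_assoc y p q : reproj (rm (rm y p) q) = reproj (rm y (omul p q)).
Proof.
rewrite (decomposition y); elim/big_ind: _ => [|a b Ha Hb|i _].
- by rewrite !(rm0 HV).
- by rewrite !lin !reprojD Ha Hb.
have h := ReV_comp i y; rewrite !(ReV_rmrm _ _ h) !reproj_rm//; congr (_ *: _).
exact: omul_real_assoc.
Qed.

Lemma reproj_separates y : (forall p, reproj (rm y p) = 0) -> y = 0.
Proof.
move=> H; rewrite (decomposition y) big1// => i _.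
suff -> : comp i y = 0 by rewrite (rm0 HV).
rewrite /comp; case: ifP => _; first by rewrite -(rm1 HV y).
by rewrite reproj_trace H oppr0.
Qed.

Lemma BRO_rm f m p : in_BRO lm rm f -> ReV m -> f (rm m p) = rm (f m) p.
Proof.
move=> [_ hf] hm; apply/esym/eqP; rewrite -subr_eq0; apply/eqP.
apply: reproj_separates => q; rewrite (rmDl HV) (rmNl HV) reprojD reprojN.
have hB r x : reproj (rm (f x) r) = reproj (f (rm x r)).
  have := hf r x; rewrite RePE /Bp reprojD reprojN => /eqP.
  by rewrite subr_eq0 => /eqP.
by rewrite reproj_trace_assoc !hB (ReV_rmrm _ _ hm) subrr.
Qed.

Lemma ext_rm h m q : (forall x y, h (x + y) = h x + h y) ->
  (forall (r : R) x, h (r *: x) = r *: h x) -> ReV m ->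
  ext lm rm h (rm m q) = rm (h m) q.
Proof.
move=> hD hZ hm; rewrite /ext {2}(oct_basis_sum q).
transitivity (\sum_(i < 8) rm (h m) (q 0 i *: obasis R i)).
  apply: eq_bigr => i _; rewrite ocompE comp_rm// inord_val hZ.
  by rewrite (rmZl HV) (rmZr HV).
by elim/big_rec2: _ => [|i a b _ ->]; rewrite ?(rm0r HV)// (rmDr HV).
Qed.

Lemma rm_alt x p q : rm x (omul p q) - rm (rm x q) p + rm x (omul q p) = rm (rm x p) q.
Proof.
have h1 := assoc_xpqE HV p q x; have h2 := assoc_xpqE HV q p x.
have := assocC HV p q x; rewrite -h1 -h2 /assoc_xpq => /eqP; rewrite -subr_eq0 => /eqP h.
apply/eqP; rewrite -subr_eq0; apply/eqP; rewrite -[RHS]oppr0 -h; lmod.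
Qed.

Lemma odot_ext h p x : (forall x y, h (x + y) = h x + h y) ->
  (forall (r : R) x, h (r *: x) = r *: h x) ->
  odot_r lm rm (ext lm rm h) p x = \sum_(i < 8) rm (rm (h (comp i x)) p) (obasis R i).
Proof.
move=> hD hZ.
have eD y z : ext lm rm h (y + z) = ext lm rm h y + ext lm rm h z.
  rewrite /ext -big_split; apply: eq_bigr => i _.
  by rewrite !ocompE compD hD (rmDl HV).
have eZ r y : ext lm rm h (r *: y) = r *: ext lm rm h y.
  rewrite /ext scaler_sumr; apply: eq_bigr => i _.
  by rewrite !ocompE compZ hZ (rmZl HV).
have oD y z : odot_r lm rm (ext lm rm h) p (y + z) =
   odot_r lm rm (ext lm rm h) p y + odot_r lm rm (ext lm rm h) p z.
  rewrite /odot_r /Bp (lmDr HV) (rmDl HV) !eD (rmDl HV); lmod.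
rewrite {1}(decomposition x).
transitivity (\sum_(i < 8) odot_r lm rm (ext lm rm h) p (rm (comp i x) (obasis R i))).
  elim/big_rec2: _ => [|i a b _ <-]; last by rewrite oD.
  rewrite /odot_r /Bp (lm0 HV) (rm0 HV); have -> : ext lm rm h 0 = 0.
    by rewrite -(scale0r (0:V)) eZ !scale0r.
  by rewrite (rm0 HV) !subr0.
apply: eq_bigr => i _; have hm := ReV_comp i x; rewrite /odot_r /Bp (ReV_lmrm _ _ hm).
rewrite (ReV_rmrm _ _ hm) !ext_rm// -rm_alt; lmod.
Qed.
End BimoduleDecomposition.

(** * Primitives of continuous vector-valued functions *)

Section Uniformity.
Variable R : realType.

Lemma compact_uniform (X : topologicalType) (K : set X) (P : nat -> X -> Prop) :
  compact K -> (forall n m x, (n <= m)%N -> P n x -> P m x) ->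
  (forall x, K x -> exists N, \forall y \near x, K y -> P N y) ->
  exists N, forall x, K x -> P N x.
Proof.
move=> /compact_near_coveringP cK Pm H.
have : \forall N \near \oo, K `<=` (fun x => K x -> P N x).
  apply: cK => x Kx; have [N HN] := H x Kx.
  exists ([set y | K y -> P N y], [set n | (N <= n)%N]) => /=.
    by split=> //; exact: nbhs_infty_ge.
  move=> [y n] /= [h1 h2] Ky; exact: Pm h2 (h1 Ky).
move=> [N _ HN]; exists N => x Kx; exact: (HN N (leqnn N) x Kx Kx).
Qed.

Lemma segment_uniform (a b : R) (P : nat -> R -> Prop) :
  (forall n m x, (n <= m)%N -> P n x -> P m x) ->
  (forall t, a <= t <= b -> exists N, exists2 d, 0 < d &
     forall u, a <= u <= b -> `|u - t| < d -> P N u) ->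
  exists N, forall t, a <= t <= b -> P N t.
Proof.
move=> Pm H; apply: (@compact_uniform R [set t | a <= t <= b] P _ Pm).
  by rewrite (_ : [set t | _] = `[a, b]%classic) ?set_itvcc//; exact: segment_compact.
move=> t /= /H[N [d d0 Hd]]; exists N; apply/nbhs_normP; exists d => //= u.
by rewrite /= distrC => ud hu; exact: Hd.
Qed.

Lemma small_inv (d : R) : 0 < d -> exists n : nat, n.+1%:R^-1 < d.
Proof. by move=> /ltr_add_invr[n]; rewrite add0r => ?; exists n. Qed.

Lemma small_div (c d : R) : 0 < d -> exists n0 : nat, forall n, (n0 <= n)%N -> c / n.+1%:R < d.
Proof.
move=> d0; exists (Num.bound (`|c| / d)) => n hn.
apply: (le_lt_trans (ler_norm _)); rewrite normrM [`|_^-1|]ger0_norm ?invr_ge0//.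
rewrite ltr_pdivrMr// mulrC -ltr_pdivrMr//.
have h0 : 0 <= `|c| / d by rewrite divr_ge0// ltW.
by apply: (lt_le_trans (archi_boundP h0)); rewrite ler_nat (leq_trans hn).
Qed.
End Uniformity.

Section Primitive.
Variables (R : realType) (W : normedModType R).
Implicit Types (g G H : R -> W) (a b c d e t u : R).

Lemma chop H a b c d : 0 < d -> a <= b ->
  (forall t u, a <= t -> t <= u -> u <= b -> u - t < d -> `|H u - H t| <= c * (u - t)) ->
  `|H b - H a| <= c * (b - a).
Proof.
move=> d0 ab Hc; have [n0 /(_ n0 (leqnn _))] := small_div (b - a) d0.
set N := n0.+1; set h := (b - a) / N%:R => hd.
have h0 : 0 <= h by rewrite divr_ge0// subr_ge0.
have Nh : N%:R * h = b - a by rewrite mulrC divfK// pnatr_eq0.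
pose t (i : nat) := a + i%:R * h.
have t0 : t 0%N = a by rewrite /t mul0r addr0.
have tN : t N = b by rewrite /t Nh; ring.
have tS i : t i.+1 = t i + h by rewrite /t -natr1; ring.
rewrite -[in H b]tN -[in H a]t0 -(telescope_sumr (fun i => H (t i)))//.
apply: (le_trans (ler_norm_sum _ _ _)).
have -> : c * (b - a) = \sum_(0 <= i < N) c * (t i.+1 - t i).
  by rewrite -mulr_sumr telescope_sumr// tN t0.
rewrite big_nat [leRHS]big_nat; apply: ler_sum => i /andP[_ iN].
apply: Hc.
- by rewrite /t lerDl mulr_ge0.
- by rewrite tS lerDl.
- by rewrite -tN /t lerD2l ler_wpM2r// ler_nat.
- by rewrite tS addrAC subrr add0r.
Qed.

Definition primitive g G a b := forall e, 0 < e -> exists2 d, 0 < d &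
  forall t s u, a <= t -> t <= s -> s <= u -> u <= b -> u - t < d ->
  `|G u - G t - (u - t) *: g s| <= e * (u - t).

Lemma prim_sub g G a b a' b' : a <= a' -> b' <= b ->
  primitive g G a b -> primitive g G a' b'.
Proof.
move=> aa bb P e e0; have [d d0 Hd] := P e e0; exists d => // t s u h1 h2 h3 h4.
by apply: Hd => //; [exact: le_trans h1|exact: le_trans bb].
Qed.

Lemma prim_bound g G a b M : a <= b -> primitive g G a b ->
  (forall t, a <= t <= b -> `|g t| <= M) -> `|G b - G a| <= M * (b - a).
Proof.
move=> ab P gM; apply/ler_addgt0Pr => e e0.
pose e1 := e / (b - a + 1).
have ba : 0 < b - a + 1 by rewrite ltr_wpDl// subr_ge0.
have e10 : 0 < e1 by rewrite divr_gt0.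
have [d d0 Hd] := P e1 e10.
apply: (@le_trans _ _ ((M + e1) * (b - a))).
  apply: (chop d0 ab) => t u h1 h2 h3 h4.
  have := Hd t t u h1 (lexx _) h2 h3 h4.
  rewrite mulrDl => h; rewrite -(subrK ((u - t) *: g t) (G u - G t)) addrC.
  apply: (le_trans (ler_normD _ _)); apply: lerD => //.
  rewrite normrZ ger0_norm ?subr_ge0// mulrC ler_wpM2r ?subr_ge0//.
  by apply: gM; rewrite h1 (le_trans h2).
rewrite mulrDl lerD2l /e1 -mulrA; apply: ler_piMr; first exact: ltW.
by rewrite mulrC ler_pdivrMr// mul1r lerDl.
Qed.

Lemma prim_ext g g' G a b : (forall t, a <= t <= b -> g t = g' t) ->
  primitive g G a b -> primitive g' G a b.
Proof.
move=> E P e e0; have [d d0 Hd] := P e e0; exists d => // t s u h1 h2 h3 h4 h5.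
by rewrite -E; [exact: Hd|rewrite (le_trans h1 h2) (le_trans h3 h4)].
Qed.

Lemma prim_add g G g' G' a b : primitive g G a b -> primitive g' G' a b ->
  primitive (fun t => g t + g' t) (fun t => G t + G' t) a b.
Proof.
move=> P P' e e0; have e20 : 0 < e / 2 by rewrite divr_gt0.
have [d d0 Hd] := P _ e20; have [d' d'0 Hd'] := P' _ e20.
exists (Num.min d d'); first by rewrite lt_min d0.
move=> t s u h1 h2 h3 h4; rewrite lt_min => /andP[h5 h6].
have -> : G u + G' u - (G t + G' t) - (u - t) *: (g s + g' s) =
  (G u - G t - (u - t) *: g s) + (G' u - G' t - (u - t) *: g' s) by lmod.
rewrite (le_trans (ler_normD _ _))// [e](splitr e) mulrDl.
by apply: lerD; [exact: Hd|exact: Hd'].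
Qed.

Lemma prim_cst (v : W) a b : primitive (fun=> v) (fun t => t *: v) a b.
Proof.
move=> e e0; exists 1 => // t s u h1 h2 h3 h4 _.
rewrite -scalerBl subrr normr0; apply: mulr_ge0; first exact: ltW.
by rewrite subr_ge0 (le_trans h2).
Qed.

Lemma prim_modulus g G a b e d : primitive g G a b ->
  (forall t u, a <= t <= b -> a <= u <= b -> `|t - u| < d -> `|g t - g u| <= e) ->
  forall t s u, a <= t -> t <= s -> s <= u -> u <= b -> u - t < d ->
  `|G u - G t - (u - t) *: g s| <= e * (u - t).
Proof.
move=> P M t s u h1 h2 h3 h4 h5.
have tu := le_trans h2 h3.
have P' : primitive (fun r => g r + - g s) (fun r => G r + r *: (- g s)) t u.
  by apply: prim_add; [exact: prim_sub P|exact: prim_cst].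
have := prim_bound tu P'; rewrite (_ : _ - _ = G u - G t - (u - t) *: g s); last by lmod.
apply=> r /andP[tr ru]; apply: M.
- by rewrite (le_trans h1 tr) (le_trans ru).
- by rewrite (le_trans h1 h2) (le_trans h3).
apply: le_lt_trans h5; rewrite ler_norml; apply/andP; split; lra.
Qed.

Definition ucont g a b := forall e, 0 < e -> exists2 d, 0 < d &
  forall t u, a <= t <= b -> a <= u <= b -> `|t - u| < d -> `|g t - g u| <= e.

Lemma ucont_local g a b :
  (forall t e, a <= t <= b -> 0 < e -> exists2 d, 0 < d &
     forall u, a <= u <= b -> `|u - t| < d -> `|g u - g t| <= e) ->
  ucont g a b.
Proof.
move=> L e e0.
pose P (N : nat) t := forall u, a <= u <= b -> `|t - u| < N.+1%:R^-1 -> `|g t - g u| <= e.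
have [] := @segment_uniform R a b P.
- move=> n m x nm Pn u hu h; apply: Pn => //; apply: (lt_le_trans h).
  by rewrite lef_pV2 ?posrE// ler_nat.
- move=> t ht; have e20 : 0 < e / 2 by rewrite divr_gt0.
  have [d d0 Hd] := L t _ ht e20.
  have d20 : 0 < d / 2 by rewrite divr_gt0.
  have [N HN] := small_inv d20; exists N; exists (d / 2) => // u hu ut w hw uw.
  rewrite -(subrK (g t) (g u)) -addrA (le_trans (ler_normD _ _))// [e](splitr e) lerD//.
    by apply: Hd => //; apply: (lt_trans ut); lra.
  rewrite distrC; apply: Hd => //; rewrite -(subrK u w) -addrA.
  apply: (le_lt_trans (ler_normD _ _)); rewrite [d](splitr d) ltrD// distrC.
  exact: lt_trans uw HN.
by move=> N HN; exists N.+1%:R^-1 => // t u ht hu htu; exact: HN.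
Qed.
End Primitive.

Section PrimitiveExists.
Variables (R : realType) (W : completeNormedModType R).
Implicit Types (g G H : R -> W) (a b c d e t u : R).

Let knot a b n (i : nat) : R := a + i%:R * ((b - a) / n.+1%:R).
Let step a b n (i : nat) t := Num.min t (knot a b n i.+1) - Num.min t (knot a b n i).
Let approx g a b n t : W := \sum_(0 <= i < n.+1) step a b n i t *: g (knot a b n i).

Let knot_bnd a b n i : a <= b -> (i <= n.+1)%N -> a <= knot a b n i <= b.
Proof.
move=> ab iN; have h0 : 0 <= (b - a) / n.+1%:R by rewrite divr_ge0// subr_ge0.
rewrite /knot lerDl mulr_ge0//= -lerBrDl.
rewrite -[leRHS](@divfK _ n.+1%:R) ?pnatr_eq0// mulrC ler_wpM2l//.
by rewrite ler_nat.
Qed.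

Let clamp_ge0 (t u p q : R) : t <= u -> p <= q ->
  0 <= (Num.min u q - Num.min u p) - (Num.min t q - Num.min t p).
Proof. by rewrite /Num.min; do 4?[case: ltP => ?]; lra. Qed.

Let approx_prim g a b n e d : a <= b ->
  (forall t u, a <= t <= b -> a <= u <= b -> `|t - u| < d -> `|g t - g u| <= e) ->
  (b - a) / n.+1%:R < d / 2 ->
  forall t s u, a <= t -> t <= s -> s <= u -> u <= b -> u - t < d / 2 ->
  `|approx g a b n u - approx g a b n t - (u - t) *: g s| <= e * (u - t).
Proof.
move=> ab M hd t s u h1 h2 h3 h4 h5.
set h := (b - a) / n.+1%:R in hd.
have h0 : 0 <= h by rewrite divr_ge0// subr_ge0.
pose w i := step a b n i u - step a b n i t.
have kS i : knot a b n i.+1 = knot a b n i + h by rewrite /knot -natr1 -/h; ring.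
have tu := le_trans h2 h3.
have step_sum x : a <= x <= b -> \sum_(0 <= i < n.+1) step a b n i x = x - a.
  move=> /andP[ax xb]; rewrite (telescope_sumr (fun i => Num.min x (knot a b n i)))//.
  have -> : knot a b n n.+1 = b.
    by rewrite /knot mulrC divfK ?pnatr_eq0//; ring.
  by rewrite /knot mul0r addr0 (min_l xb) (min_r ax).
have sw : \sum_(0 <= i < n.+1) w i = u - t.
  by rewrite sumrB !step_sum ?h1 ?h4 ?(le_trans h1 tu) ?(le_trans tu h4)//; ring.
have w0 i : 0 <= w i.
  rewrite /w /step kS; apply: clamp_ge0 => //; by rewrite lerDl.
have -> : approx g a b n u - approx g a b n t - (u - t) *: g s =
   \sum_(0 <= i < n.+1) w i *: (g (knot a b n i) - g s).
  rewrite -sw scaler_suml -sumrB -sumrB; apply: eq_bigr => i _.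
  by rewrite /w; lmod.
apply: (le_trans (ler_norm_sum _ _ _)).
rewrite -sw mulr_sumr big_nat [leRHS]big_nat; apply: ler_sum => i /andP[_ iN].
rewrite normrZ (ger0_norm (w0 i)) mulrC.
have [->|wi] := eqVneq (w i) 0; first by rewrite !mulr0.
apply: ler_wpM2r => //; apply: M.
- by apply: knot_bnd => //; exact: ltnW.
- by rewrite (le_trans h1 h2) (le_trans h3).
suff [k1 k2] : knot a b n i <= u /\ t <= knot a b n i + h.
  by rewrite ltr_norml; apply/andP; split; lra.
move: wi; rewrite /w /step kS; move: (knot a b n i) => k wi.
split; rewrite leNgt; apply/negP => hk; move/negP: wi; apply; apply/eqP.
  have [? ? ? ?] : [/\ u <= k + h, u <= k, t <= k + h & t <= k] by split; lra.
  by rewrite !min_l// !subrr.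
have [? ? ? ?] : [/\ k + h <= u, k <= u, k + h <= t & k <= t] by split; lra.
by rewrite !min_r// !subrr.
Qed.

Lemma prim_exists g a b : a <= b -> ucont g a b -> exists G, primitive g G a b.
Proof.
move=> ab uc; pose A := approx g a b.
have Aa n : A n a = 0.
  rewrite /A /approx big_nat big1// => i /andP[_ iN]; rewrite /step !min_l.
  - by rewrite subrr scale0r.
  - by have /andP[] := @knot_bnd a b n i ab (ltnW iN).
  - by have /andP[] := @knot_bnd a b n i.+1 ab iN.
have C x e : a <= x <= b -> 0 < e -> exists n0, forall n m, (n0 <= n)%N -> (n0 <= m)%N ->
    `|A n x - A m x| <= e.
  move=> /andP[ax xb] e0; pose e1 := e / (2 * (b - a + 1)).
  have ba : 0 < b - a + 1 by rewrite ltr_wpDl// subr_ge0.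
  have e10 : 0 < e1 by rewrite divr_gt0// mulr_gt0.
  have [d d0 Hd] := uc _ e10.
  have d20 : 0 < d / 2 by rewrite divr_gt0.
  have [n0 Hn] := small_div (b - a) d20; exists n0 => n m hn hm.
  have := @chop R W (fun t => A n t - A m t) a x (2 * e1) (d / 2) d20 ax.
  rewrite !Aa !subr0 => H; apply: (le_trans (H _)).
    move=> t u h1 h2 h3 h4; have ub := le_trans h3 xb.
    have k1 := approx_prim ab Hd (Hn n hn) h1 (lexx t) h2 ub h4.
    have k2 := approx_prim ab Hd (Hn m hm) h1 (lexx t) h2 ub h4.
    have -> : A n u - A m u - (A n t - A m t) = (A n u - A n t - (u - t) *: g t)
       - (A m u - A m t - (u - t) *: g t) by lmod.
    apply: (le_trans (ler_normB _ _)); have -> : 2 * e1 * (u - t) = e1 * (u - t) + e1 * (u - t) by ring.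
    exact: lerD.
  have -> : 2 * e1 = e / (b - a + 1) by rewrite /e1; field; exact: lt0r_neq0.
  rewrite -mulrA; apply: ler_piMr; first exact: ltW.
  by rewrite mulrC ler_pdivrMr// mul1r; lra.
pose G x := lim (A n x @[n --> \oo]).
have cvG x : a <= x <= b -> A n x @[n --> \oo] --> G x.
  move=> hx; apply/cauchy_cvgP; apply: cauchy_exP => e e0.
  have e20 : 0 < e / 2 by rewrite divr_gt0.
  have [n0 Hn] := C x _ hx e20; exists (A n0 x).
  exists n0 => // n /= hn; rewrite -ball_normE /=.
  by apply: (le_lt_trans (Hn _ _ (leqnn _) hn)); lra.
have close x e : a <= x <= b -> 0 < e -> exists n0, forall n, (n0 <= n)%N -> `|G x - A n x| <= e.
  move=> hx e0; have /cvgrPdist_le/(_ e e0)[n0 _ Hn] := cvG x hx.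
  by exists n0 => n hn; exact: Hn.
exists G => e e0; have [d d0 Hd] := uc _ e0.
have d20 : 0 < d / 2 by rewrite divr_gt0.
exists (d / 2) => // t s u h1 h2 h3 h4 h5; apply/ler_addgt0Pr => z z0.
have z20 : 0 < z / 2 by rewrite divr_gt0.
have ht : a <= t <= b by rewrite h1 (le_trans h2)// (le_trans h3).
have hu : a <= u <= b by rewrite h4 (le_trans h1)// (le_trans h2).
have [n1 H1] := close t _ ht z20; have [n2 H2] := close u _ hu z20.
have [n3 H3] := small_div (b - a) d20.
pose n := maxn n1 (maxn n2 n3).
have l1 : (n1 <= n)%N by rewrite leq_max leqnn.
have l2 : (n2 <= n)%N by rewrite !leq_max leqnn orbT.
have l3 : (n3 <= n)%N by rewrite !leq_max leqnn !orbT.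
have k := approx_prim ab Hd (H3 n l3) h1 h2 h3 h4 h5.
have -> : G u - G t - (u - t) *: g s = (A n u - A n t - (u - t) *: g s)
  + ((G u - A n u) - (G t - A n t)) by lmod.
apply: (le_trans (ler_normD _ _)); apply: lerD => //.
by apply: (le_trans (ler_normB _ _)); rewrite [z](splitr z) lerD ?H1 ?H2.
Qed.
End PrimitiveExists.

Import ComplexField.

Section TaggedSums.
Variables (R : realType) (W : normedModType R).
Implicit Types (g G : R -> W) (a b e d : R).

Lemma tagged_sum g G a b e d p tg :
  (forall t s u, a <= t -> t <= s -> s <= u -> u <= b -> u - t < d ->
     `|G u - G t - (u - t) *: g s| <= e * (u - t)) ->
  tagged_part a b p tg d ->
  `|\sum_(i < size tg) (p`_i.+1 - p`_i) *: g tg`_i - (G b - G a)| <= e * (b - a).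
Proof.
move=> H [_ [pa [pb st]]].
have mono i j : (i <= j)%N -> (j <= size tg)%N -> p`_i <= p`_j.
  elim: j => [|j IH]; first by rewrite leqn0 => /eqP ->.
  rewrite leq_eqVlt ltnS => /orP[/eqP -> //|ij] jl.
  apply: (le_trans (IH ij (ltnW jl))); have [_ /andP[h _]] := st _ jl.
  by rewrite -subr_ge0 ltW.
have -> : b - a = \sum_(0 <= i < size tg) (p`_i.+1 - p`_i).
  by rewrite (telescope_sumr (fun i => p`_i))// pb pa.
have -> : G b - G a = \sum_(0 <= i < size tg) (G p`_i.+1 - G p`_i).
  by rewrite (telescope_sumr (fun i => G p`_i))// pb pa.
rewrite -(big_mkord xpredT (fun i => (p`_i.+1 - p`_i) *: g tg`_i)) -sumrB mulr_sumr.
apply: (le_trans (ler_norm_sum _ _ _)); rewrite big_nat [leRHS]big_nat.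
apply: ler_sum => i /andP[_ il]; rewrite distrC.
have [/andP[h1 h2] /andP[h3 h4]] := st i il.
apply: H => //; first by rewrite -pa; apply: mono => //; exact: ltnW.
by rewrite -pb; exact: mono.
Qed.

Lemma tagged_part_exists a b d : a < b -> 0 < d -> exists p tg, tagged_part a b p tg d.
Proof.
move=> ab d0; have [n /(_ n (leqnn _)) hd] := small_div (b - a) d0.
set h := (b - a) / n.+1%:R in hd.
have h0 : 0 < h by rewrite divr_gt0// subr_gt0.
exists (mkseq (fun i => a + i%:R * h) n.+2), (mkseq (fun i => a + i%:R * h) n.+1).
have E i : (i < n.+2)%N -> (mkseq (fun i => a + i%:R * h) n.+2)`_i = a + i%:R * h.
  by move=> ?; rewrite nth_mkseq.
rewrite /tagged_part !size_mkseq; split=> //; split; first by rewrite E// mul0r addr0.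
split; first by rewrite E// /h mulrC divfK ?pnatr_eq0//; ring.
move=> i il; rewrite (E i.+1)// (E i) ?(ltnW (ltnS _ _))//; last exact: (leq_trans il).
rewrite nth_mkseq// lexx /= -natr1; have -> : a + (i%:R + 1) * h - (a + i%:R * h) = h by ring.
by rewrite h0 hd mulrDl mul1r addrA lerDl ltW.
Qed.
End TaggedSums.

Section Integral.
Variables (R : realType) (W : completeNormedModType R).
Implicit Types (g G : R -> W) (a b e d : R).

(* Defaults to [0] when [g] has no uniform primitive. *)
Definition integ a b g : W :=
  match pselect (exists G, primitive g G a b) with
  | left H => projT1 (cid H) b - projT1 (cid H) a
  | right _ => 0
  end.

Lemma prim_map (W' : normedModType R) (f : W -> W') (C : R) g G a b :
  (forall x y, f (x + y) = f x + f y) -> (forall (r : R) x, f (r *: x) = r *: f x) ->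
  0 <= C -> (forall x, `|f x| <= C * `|x|) -> primitive g G a b ->
  primitive (fun t => f (g t)) (fun t => f (G t)) a b.
Proof.
move=> fD fZ C0 fC P e e0; have e10 : 0 < e / (C + 1) by rewrite divr_gt0// ltr_wpDl.
have [d d0 Hd] := P _ e10; exists d => // t s u h1 h2 h3 h4 h5.
have fN x : f (- x) = - f x by rewrite -scaleN1r fZ scaleN1r.
have -> : f (G u) - f (G t) - (u - t) *: f (g s) = f (G u - G t - (u - t) *: g s).
  by rewrite !fD !fN fZ.
apply: (le_trans (fC _)); apply: (@le_trans _ _ ((C + 1) * `|G u - G t - (u - t) *: g s|)).
  by apply: ler_wpM2r => //; rewrite lerDl.
rewrite mulrC -ler_pdivlMr ?ltr_wpDl// mulrAC; exact: Hd.
Qed.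

Lemma integE g G a b : a <= b -> primitive g G a b -> integ a b g = G b - G a.
Proof.
move=> ab P; rewrite /integ; case: pselect => [H|]; last by case; exists G.
case: cid => G' /= P'.
have P2 : primitive (fun t => - g t) (fun t => - G t) a b.
  apply: (@prim_map W (fun x => - x) 1 g G) => //; first by move=> x y; rewrite opprD.
  - by move=> r x; rewrite scalerN.
  - by move=> x; rewrite normrN mul1r.
have := prim_bound ab (prim_add P' P2) (M := 0).
rewrite mul0r => H0; apply/eqP; rewrite -subr_eq0 -normr_le0.
have -> : G' b - G' a - (G b - G a) = G' b - G b - (G' a - G a) by lmod.
by apply: H0 => t _; rewrite subrr normr0.
Qed.

Definition cont_on g a b := forall t, a <= t <= b -> {for t, continuous g}.

Lemma ucont_cont g a b : cont_on g a b -> ucont g a b.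
Proof.
move=> C; apply: ucont_local => t e ht e0.
have /cvgrPdist_le/(_ e e0)/nbhs_normP[d d0 Hd] := C t ht.
by exists d => // u _ ut; rewrite distrC; apply: Hd; rewrite /= distrC.
Qed.

Lemma integ_prim g a b : a <= b -> ucont g a b -> exists2 G, primitive g G a b & integ a b g = G b - G a.
Proof. by move=> ab /(prim_exists ab)[G P]; exists G => //; exact: integE. Qed.

Lemma integD g g' a b : a <= b -> ucont g a b -> ucont g' a b ->
  integ a b (fun t => g t + g' t) = integ a b g + integ a b g'.
Proof.
move=> ab /(integ_prim ab)[G P ->] /(integ_prim ab)[G' P' ->].
by rewrite (integE ab (prim_add P P')); lmod.
Qed.

Lemma integ_ext g g' a b : a <= b -> ucont g a b -> (forall t, a <= t <= b -> g t = g' t) ->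
  integ a b g = integ a b g'.
Proof.
move=> ab /(integ_prim ab)[G P ->] E.
by rewrite (integE ab (prim_ext E P)).
Qed.

Lemma integ_bound g a b M : a <= b -> ucont g a b ->
  (forall t, a <= t <= b -> `|g t| <= M) -> `|integ a b g| <= M * (b - a).
Proof. by move=> ab /(integ_prim ab)[G P ->] gM; exact: prim_bound P gM. Qed.

Lemma integ_cat g a c b : a <= c -> c <= b -> ucont g a b ->
  integ a b g = integ a c g + integ c b g.
Proof.
move=> ac cb U; have ab := le_trans ac cb; have [G P ->] := integ_prim ab U.
by rewrite (integE ac (prim_sub (lexx _) cb P)) (integE cb (prim_sub ac (lexx _) P)); lmod.
Qed.
End Integral.

Lemma integ_map (R : realType) (W W' : completeNormedModType R) (f : W -> W') (C : R) g a b :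
  (forall x y, f (x + y) = f x + f y) -> (forall (r : R) x, f (r *: x) = r *: f x) ->
  0 <= C -> (forall x, `|f x| <= C * `|x|) -> a <= b -> ucont g a b ->
  integ a b (fun t => f (g t)) = f (integ a b g).
Proof.
move=> fD fZ C0 fC ab /(integ_prim ab)[G P ->].
have fN x : f (- x) = - f x by rewrite -scaleN1r fZ scaleN1r.
by rewrite (integE ab (prim_map fD fZ C0 fC P)) fD fN.
Qed.

Section RealIntegral.
Variable R : realType.
Implicit Types (f df : R -> R) (a b : R).

Lemma prim_C1 f df a b : (forall t, a <= t <= b -> is_derive t 1 f (df t)) ->
  ucont (df : R -> R^o) a b -> primitive (df : R -> R^o) (f : R -> R^o) a b.
Proof.
move=> D U e e0; have [d d0 Hd] := U _ e0; exists d => // t s u h1 h2 h3 h4 h5.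
have tu := le_trans h2 h3.
have [||c] := @MVT_segment R f df t u tu.
- move=> x; rewrite in_itv /= => /andP[/ltW x1 /ltW x2]; apply: D.
  by rewrite (le_trans h1 x1) (le_trans x2 h4).
- apply: derivable_within_continuous => x; rewrite in_itv /= => /andP[x1 x2].
  have /D[] : a <= x <= b by rewrite (le_trans h1 x1) (le_trans x2 h4).
  by [].
rewrite in_itv /= => /andP[c1 c2] ->.
rewrite -[(u - t) *: _]/((u - t) * df s) [df c * _]mulrC -mulrBr normrM ger0_norm ?subr_ge0//.
rewrite mulrC ler_wpM2r ?subr_ge0//; apply: Hd.
- by rewrite (le_trans h1 c1) (le_trans c2 h4).
- by rewrite (le_trans h1 h2) (le_trans h3 h4).
by apply: le_lt_trans h5; rewrite ler_norml; apply/andP; split; lra.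
Qed.

Lemma rint_unique (g G : R -> R^o) a b l : a < b -> primitive g G a b ->
  is_rint g a b l -> l = G b - G a.
Proof.
move=> ab P I; apply/eqP; rewrite -subr_eq0 -normr_le0; apply/ler_addgt0Pr => e e0; rewrite add0r.
have e20 : 0 < e / 2 by rewrite divr_gt0.
have [d1 d10 H1] := I _ e20.
have e30 : 0 < e / 2 / (b - a) by rewrite divr_gt0// subr_gt0.
have [d2 d20 H2] := P _ e30.
have [p [tg T]] : exists p tg, tagged_part a b p tg (Num.min d1 d2).
  by apply: tagged_part_exists => //; rewrite lt_min d10.
have sub d : Num.min d1 d2 <= d -> tagged_part a b p tg d.
  move=> hd; case: T => ? [? [? T]]; split=> //; split=> //; split=> // i /T[-> /andP[-> h]].
  by split=> //; rewrite (lt_le_trans h).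
have m1 : Num.min d1 d2 <= d1 by rewrite ge_min lexx.
have m2 : Num.min d1 d2 <= d2 by rewrite ge_min lexx orbT.
have k1 := H1 _ _ (sub d1 m1); have := tagged_sum H2 (sub d2 m2).
rewrite divfK ?subr_eq0 ?gt_eqF//.
set s := \sum_(i < _) _ in k1; rewrite -[\sum_(i < _) _]/s => k2.
have -> : l - (G b - G a) = (s - (G b - G a)) - (s - l) by ring.
by rewrite [e]splitr (le_trans (ler_normB _ _))// lerD// ltW.
Qed.
End RealIntegral.

(** * Calculus of complex-valued functions *)

Local Notation Re := complex.Re.
Local Notation Im := complex.Im.
Local Notation normc := Normc.normc.

Section ComplexCalculus.
Variable R : realType.
Local Notation C := R[i].
Implicit Types (z w : C) (f g : R -> C) (t : R).

Lemma cReD z w : Re (z + w) = Re z + Re w. Proof. by case: z w => [a b] [c d]. Qed.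
Lemma cImD z w : Im (z + w) = Im z + Im w. Proof. by case: z w => [a b] [c d]. Qed.
Lemma cReN z : Re (- z) = - Re z. Proof. by case: z. Qed.
Lemma cImN z : Im (- z) = - Im z. Proof. by case: z. Qed.
Lemma cReM z w : Re (z * w) = Re z * Re w - Im z * Im w.
Proof. by case: z w => [a b] [c d]. Qed.
Lemma cImM z w : Im (z * w) = Re z * Im w + Im z * Re w.
Proof. by case: z w => [a b] [c d]. Qed.
Lemma cReV z : Re z^-1 = Re z / (Re z ^+ 2 + Im z ^+ 2).
Proof. by case: z. Qed.
Lemma cImV z : Im z^-1 = - (Im z / (Re z ^+ 2 + Im z ^+ 2)).
Proof. by case: z. Qed.
Lemma complex_ext z w : Re z = Re w -> Im z = Im w -> z = w.
Proof. by case: z w => [a b] [c d] /= -> ->. Qed.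

Lemma normcE z : normc z = Num.sqrt (Re z ^+ 2 + Im z ^+ 2).
Proof. by case: z. Qed.
Lemma normc_ge0 z : 0 <= normc z. Proof. by rewrite normcE sqrtr_ge0. Qed.
Lemma normc_sq z : normc z ^+ 2 = Re z ^+ 2 + Im z ^+ 2.
Proof. by rewrite normcE sqr_sqrtr// addr_ge0// sqr_ge0. Qed.
Lemma normc_gt0 z : (0 < normc z) = (z != 0).
Proof.
rewrite lt_neqAle normc_ge0 andbT eq_sym; apply/idP/idP; apply: contra => /eqP.
  by move=> ->; rewrite Normc.normc0.
by move=> /Normc.eq0_normc ->.
Qed.
Lemma normc_Re z : `|Re z| <= normc z.
Proof. by rewrite normcE -sqrtr_sqr ler_sqrt ?lerDl ?sqr_ge0// addr_ge0// sqr_ge0. Qed.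
Lemma normc_Im z : `|Im z| <= normc z.
Proof. by rewrite normcE -sqrtr_sqr ler_sqrt ?lerDr ?sqr_ge0// addr_ge0// sqr_ge0. Qed.
Lemma normc_le z : normc z <= `|Re z| + `|Im z|.
Proof.
rewrite -(@ler_pXn2r _ 2)// ?nnegrE ?normc_ge0 ?addr_ge0// normc_sq.
rewrite -(real_normK (num_real (Re z))) -(real_normK (num_real (Im z))).
by have := mulr_ge0 (normr_ge0 (Re z)) (normr_ge0 (Im z)); nra.
Qed.
Lemma normc_triangle z w : normc (z + w) <= normc z + normc w.
Proof. exact: le_normcD. Qed.
Lemma normc_sub z w : normc (z - w) = normc (w - z).
Proof. by rewrite -normcN opprB. Qed.
Lemma normcBl z w : normc z - normc w <= normc (z - w).
Proof. by rewrite lerBlDr -{1}(subrK w z) normc_triangle. Qed.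
Lemma normc_real (x : R) : normc x%:C%C = `|x|.
Proof. by rewrite normcE /= expr0n addr0 sqrtr_sqr. Qed.

Definition cderiv f (df : C) t :=
  is_derive t 1 (fun u => Re (f u)) (Re df) /\ is_derive t 1 (fun u => Im (f u)) (Im df).

Definition cc f t := {for t, continuous (fun u => Re (f u))} /\
  {for t, continuous (fun u => Im (f u))}.

Lemma cderiv_cc f df t : cderiv f df t -> cc f t.
Proof.
by move=> [[/derivable1_diffP h1 _] [/derivable1_diffP h2 _]]; split; apply: differentiable_continuous.
Qed.

Lemma cderiv_cst z t : cderiv (fun=> z) 0 t.
Proof. by split => /=; exact: is_derive_cst. Qed.

Lemma cderivD f df g dg t : cderiv f df t -> cderiv g dg t ->
  cderiv (fun u => f u + g u) (df + dg) t.
Proof.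
move=> [f1 f2] [g1 g2]; split.
  rewrite cReD (_ : (fun u => _) = (fun u => Re (f u)) + (fun u => Re (g u))).
    exact: is_deriveD.
  by apply/funext => u; rewrite cReD.
rewrite cImD (_ : (fun u => _) = (fun u => Im (f u)) + (fun u => Im (g u))).
  exact: is_deriveD.
by apply/funext => u; rewrite cImD.
Qed.

Lemma cderivM f df g dg t : cderiv f df t -> cderiv g dg t ->
  cderiv (fun u => f u * g u) (df * g t + f t * dg) t.
Proof.
move=> [f1 f2] [g1 g2]; split.
  rewrite (_ : (fun u => _) = (fun u => Re (f u)) * (fun u => Re (g u)) -
     (fun u => Im (f u)) * (fun u => Im (g u))).
    apply: is_derive_eq; rewrite cReD !cReM /GRing.scale /=.
    by move: (Re (f t)) (Im (f t)) (Re (g t)) (Im (g t)) (Re df) (Im df) (Re dg) (Im dg) => *; ring.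
  by apply/funext => u; rewrite cReM.
rewrite (_ : (fun u => _) = (fun u => Re (f u)) * (fun u => Im (g u)) +
   (fun u => Im (f u)) * (fun u => Re (g u))).
  apply: (is_derive_eq (is_deriveD (is_deriveM f1 g2) (is_deriveM f2 g1))); rewrite cImD !cImM /GRing.scale /=.
  by move: (Re (f t)) (Im (f t)) (Re (g t)) (Im (g t)) (Re df) (Im df) (Re dg) (Im dg) => *; ring.
by apply/funext => u; rewrite cImM.
Qed.

Lemma cnorm2_neq0 z : z != 0 -> Re z ^+ 2 + Im z ^+ 2 != 0.
Proof. by move=> z0; rewrite -normc_sq expf_neq0// gt_eqF// normc_gt0. Qed.

Lemma cderivV f df t : f t != 0 -> cderiv f df t ->
  cderiv (fun u => (f u)^-1) (- (df / f t ^+ 2)) t.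
Proof.
move=> f0 [f1 f2]; have n0 := cnorm2_neq0 f0.
pose N : R -> R := (fun u => Re (f u)) * (fun u => Re (f u)) + (fun u => Im (f u)) * (fun u => Im (f u)).
have N0 : N t != 0 by move: n0; rewrite !expr2.
have dN : is_derive t 1 N (2 * (Re (f t) * Re df + Im (f t) * Im df)).
  apply: (is_derive_eq (is_deriveD (is_deriveM f1 f1) (is_deriveM f2 f2))); rewrite /GRing.scale /=.
  by move: (Re (f t)) (Im (f t)) (Re df) (Im df) => *; ring.
have dV : is_derive t 1 (fun u => (N u)^-1) (- (N t) ^- 2 *: (2 * (Re (f t) * Re df + Im (f t) * Im df))).
  exact: is_deriveV.
have NE u : N u = Re (f u) ^+ 2 + Im (f u) ^+ 2 by rewrite !expr2.
have E (a b : R) : (a * a - b * b) ^+ 2 + (a * b + b * a) ^+ 2 = (a ^+ 2 + b ^+ 2) ^+ 2 by ring.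
split.
  rewrite (_ : (fun u => _) = (fun u => Re (f u)) * (fun u => (N u)^-1)).
    apply: is_derive_eq; rewrite cReN cReM !cReV !cImV expr2 !cReM !cImM /GRing.scale /= NE.
    by rewrite E; move: n0; move: (Re _) (Im _) (Re _) (Im _) => a b p q n0; field.
  by apply/funext => u; rewrite cReV -NE.
rewrite (_ : (fun u => _) = - ((fun u => Im (f u)) * (fun u => (N u)^-1))).
  apply: is_derive_eq; rewrite cImN cImM !cReV !cImV expr2 !cReM !cImM /GRing.scale /= NE.
  by rewrite E; move: n0; move: (Re _) (Im _) (Re _) (Im _) => a b p q n0; field.
by apply/funext => u; rewrite cImV -NE.
Qed.

Lemma cc_cst z t : cc (fun=> z) t.
Proof. by split => /=; exact: cst_continuous. Qed.

Lemma ccD f g t : cc f t -> cc g t -> cc (fun u => f u + g u) t.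
Proof.
move=> [f1 f2] [g1 g2]; split.
  rewrite (_ : (fun u => _) = (fun u => Re (f u)) + (fun u => Re (g u))); first exact: continuousD.
  by apply/funext => u; rewrite cReD.
rewrite (_ : (fun u => _) = (fun u => Im (f u)) + (fun u => Im (g u))); first exact: continuousD.
by apply/funext => u; rewrite cImD.
Qed.

Lemma ccM f g t : cc f t -> cc g t -> cc (fun u => f u * g u) t.
Proof.
move=> [f1 f2] [g1 g2]; split.
  rewrite (_ : (fun u => _) = (fun u => Re (f u)) * (fun u => Re (g u)) -
     (fun u => Im (f u)) * (fun u => Im (g u))).
    by apply: continuousB; exact: continuousM.
  by apply/funext => u; rewrite cReM.
rewrite (_ : (fun u => _) = (fun u => Re (f u)) * (fun u => Im (g u)) +
   (fun u => Im (f u)) * (fun u => Re (g u))).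
  by apply: continuousD; exact: continuousM.
by apply/funext => u; rewrite cImM.
Qed.

Lemma ccX f n t : cc f t -> cc (fun u => f u ^+ n) t.
Proof.
move=> h; elim: n => [|n IH]; first exact: cc_cst.
rewrite (_ : (fun u => _) = fun u => f u * f u ^+ n); first exact: ccM.
by apply/funext => u; rewrite exprS.
Qed.

Lemma ccV f t : f t != 0 -> cc f t -> cc (fun u => (f u)^-1) t.
Proof.
move=> f0 [f1 f2].
pose N : R -> R := (fun u => Re (f u)) * (fun u => Re (f u)) + (fun u => Im (f u)) * (fun u => Im (f u)).
have NE u : N u = Re (f u) ^+ 2 + Im (f u) ^+ 2 by rewrite !expr2.
have cN : {for t, continuous N} by apply: continuousD; exact: continuousM.
have cV : {for t, continuous (fun u => (N u)^-1)}.
  by apply: continuousV => //; rewrite NE cnorm2_neq0.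
split.
  rewrite (_ : (fun u => _) = (fun u => Re (f u)) * (fun u => (N u)^-1)); first exact: continuousM.
  by apply/funext => u; rewrite cReV -NE.
rewrite (_ : (fun u => _) = - ((fun u => Im (f u)) * (fun u => (N u)^-1))).
  by apply: continuousN; exact: continuousM.
by apply/funext => u; rewrite cImV -NE.
Qed.

Lemma cc_near f t e : cc f t -> 0 < e -> \forall u \near t, normc (f u - f t) <= e.
Proof.
move=> [f1 f2] e0; have e20 : 0 < e / 2 by rewrite divr_gt0.
have /cvgrPdist_le/(_ _ e20) h1 := f1; have /cvgrPdist_le/(_ _ e20) h2 := f2.
near=> u; apply: (le_trans (normc_le _)); rewrite cReD cImD cReN cImN [e]splitr.
by apply: lerD; rewrite distrC; near: u.
Unshelve. all: by end_near. Qed.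

End ComplexCalculus.

(** * Complex structures on a Banach space *)

Section ComplexAction.
Variables (R : realType) (V : completeNormedModType R) (j : V -> V).
Local Notation C := R[i].

Definition act (z : C) (v : V) : V := Re z *: v + Im z *: j v.

Hypothesis jD : forall x y, j (x + y) = j x + j y.
Hypothesis jZ : forall (r : R) x, j (r *: x) = r *: j x.
Hypothesis jj : forall x, j (j x) = - x.
Hypothesis norm_act : forall z v, `|act z v| = normc z * `|v|.
Implicit Types (z w h : C) (v : V).

Lemma actDl z w v : act (z + w) v = act z v + act w v.
Proof. by rewrite /act cReD cImD; lmod. Qed.
Lemma actDr z (u v : V) : act z (u + v) = act z u + act z v.
Proof. by rewrite /act jD; lmod. Qed.
Lemma actZr z (r : R) v : act z (r *: v) = r *: act z v.
Proof. by rewrite /act jZ; lmod. Qed.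
Lemma actM z w v : act (z * w) v = act z (act w v).
Proof. by rewrite /act cReM cImM jD !jZ jj; lmod. Qed.
Lemma act_real (r : R) v : act r%:C%C v = r *: v.
Proof. by rewrite /act /= scale0r addr0. Qed.
Lemma act1 v : act 1 v = v.
Proof. by rewrite -[1]/(1%:C%C) act_real scale1r. Qed.
Lemma act0 v : act 0 v = 0.
Proof. by rewrite -[0]/(0%:C%C) act_real scale0r. Qed.
Lemma actNl z v : act (- z) v = - act z v.
Proof. by rewrite /act cReN cImN; lmod. Qed.
Lemma actNr z v : act z (- v) = - act z v.
Proof. by rewrite -scaleN1r actZr scaleN1r. Qed.
Lemma act0r z : act z 0 = 0.
Proof. by rewrite -(scale0r (0 : V)) actZr !scale0r. Qed.
Lemma actC z w v : act z (act w v) = act w (act z v).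
Proof. by rewrite -!actM mulrC. Qed.
Lemma actK z v : z != 0 -> act z^-1 (act z v) = v.
Proof. by move=> z0; rewrite -actM mulVf// act1. Qed.
Lemma act_sum (I : Type) (s : seq I) (F : I -> V) z :
  act z (\sum_(i <- s) F i) = \sum_(i <- s) act z (F i).
Proof. by elim/big_rec2: _ => [|i a b _ <-]; rewrite ?act0r// actDr. Qed.
Lemma act_suml (I : Type) (s : seq I) (F : I -> C) v :
  act (\sum_(i <- s) F i) v = \sum_(i <- s) act (F i) v.
Proof. by elim/big_rec2: _ => [|i a b _ <-]; rewrite ?act0// actDl. Qed.

Lemma norm_j v : `|j v| = `|v|.
Proof.
have := norm_act (Complex 0 1) v; rewrite /act /= scale0r add0r scale1r => ->.
by rewrite expr0n expr1n /= add0r sqrtr1 mul1r.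
Qed.

Lemma j_continuous (F : R -> V) t : {for t, continuous F} -> {for t, continuous (fun u => j (F u))}.
Proof.
move=> cF; apply/cvgrPdist_le => e e0; have /cvgrPdist_le/(_ e e0) := cF.
apply: filterS => u; have -> : j (F t) - j (F u) = j (F t - F u).
  by rewrite jD -[in RHS]scaleN1r jZ scaleN1r.
by rewrite norm_j.
Qed.

Lemma act_continuous (q : R -> C) (F : R -> V) t : cc q t -> {for t, continuous F} ->
  {for t, continuous (fun u => act (q u) (F u))}.
Proof.
move=> [q1 q2] cF; have cjF := j_continuous cF.
by apply: continuousD; apply: continuousZ.
Qed.

Lemma integ_act (a b : R) (g : R -> V) z : a <= b -> ucont g a b ->
  integ a b (fun t => act z (g t)) = act z (integ a b g).
Proof.
move=> ab U; apply: (@integ_map R V V (act z) (normc z)) => //.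
- by move=> x y; rewrite actDr.
- by move=> r x; rewrite actZr.
- exact: normc_ge0.
- by move=> x; rewrite norm_act.
Qed.

Lemma prim_scale (f df : R -> R) (a b : R) v : (forall t, a <= t <= b -> is_derive t 1 f (df t)) ->
  (forall t, a <= t <= b -> {for t, continuous df}) ->
  primitive (fun t => df t *: v) (fun t => f t *: v) a b.
Proof.
move=> D cdf; have P : primitive (df : R -> R^o) (f : R -> R^o) a b.
  by apply: prim_C1 => //; apply: (@ucont_cont R R^o) => t /cdf.
apply: (@prim_map R R^o V (fun x : R^o => x *: v) `|v| df f) => //.
- by move=> x y; rewrite scalerDl.
- by move=> r x; rewrite scalerA.
- by move=> x; rewrite normrZ mulrC.
Qed.

Lemma prim_exact (f df : R -> C) (a b : R) v : (forall t, a <= t <= b -> cderiv f (df t) t) ->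
  (forall t, a <= t <= b -> cc df t) ->
  primitive (fun t => act (df t) v) (fun t => act (f t) v) a b.
Proof.
by move=> D c; apply: prim_add; apply: prim_scale => t ht;
  case: (D t ht) => ? ?; case: (c t ht).
Qed.

Lemma integ_exact (f df : R -> C) (a b : R) v : a <= b -> (forall t, a <= t <= b -> cderiv f (df t) t) ->
  (forall t, a <= t <= b -> cc df t) ->
  integ a b (fun t => act (df t) v) = act (f b - f a) v.
Proof.
move=> ab D c; rewrite (integE ab (prim_exact v D c)).
by rewrite actDl actNl.
Qed.

Definition hol (phi : C -> V) (p : C) := exists2 d, 0 < d & exists M : R,
  forall z, normc (z - p) < d -> exists2 w : V, `|w| <= M & forall h, normc h < d ->
   `|phi (z + h) - phi z - act h w| <= M * normc h ^+ 2.

Lemma hol_unique (f : C -> V) z (d1 d2 M1 M2 : R) (w1 w2 : V) : 0 < d1 -> 0 < d2 ->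
  (forall h, normc h < d1 -> `|f (z + h) - f z - act h w1| <= M1 * normc h ^+ 2) ->
  (forall h, normc h < d2 -> `|f (z + h) - f z - act h w2| <= M2 * normc h ^+ 2) ->
  w1 = w2.
Proof.
move=> d10 d20 H1 H2; apply/eqP; rewrite -subr_eq0 -normr_le0; apply/ler_addgt0Pr => e e0.
rewrite add0r; pose c := Num.max (M1 + M2) 1.
have c0 : 0 < c by rewrite lt_max ltr01 orbT.
pose x := Num.min (Num.min (d1 / 2) (d2 / 2)) (e / c).
have x0 : 0 < x by rewrite !lt_min !divr_gt0.
have xd1 : x < d1 by apply: (@le_lt_trans _ _ (d1 / 2)); [rewrite !ge_min lexx|lra].
have xd2 : x < d2 by apply: (@le_lt_trans _ _ (d2 / 2)); [rewrite !ge_min lexx orbT|lra].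
have nx : normc x%:C%C = x by rewrite normc_real ger0_norm ?ltW.
have := H1 x%:C%C; have := H2 x%:C%C; rewrite nx !act_real => /(_ xd2) k2 /(_ xd1) k1.
set A := f _ - f _ in k1 k2.
have k3 : x * `|w1 - w2| <= (M1 + M2) * x ^+ 2.
  rewrite -[in leLHS](ger0_norm (ltW x0)) -normrZ.
  have -> : x *: (w1 - w2) = (A - x *: w2) - (A - x *: w1) by lmod.
  by rewrite (le_trans (ler_normB _ _))// mulrDl addrC lerD.
have : `|w1 - w2| <= (M1 + M2) * x.
  by rewrite -(ler_pM2l x0) (le_trans k3)// expr2 mulrCA.
move/le_trans; apply; apply: (@le_trans _ _ (c * x)).
  by apply: ler_wpM2r; [exact: ltW|rewrite le_max lexx].
by rewrite mulrC -ler_pdivlMr// !ge_min lexx orbT.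
Qed.

Lemma hol_uniform (f : C -> V) (B : R) : (forall p, hol f p) ->
  exists2 d, 0 < d & exists M : R, exists df : C -> V, forall z, normc z <= B ->
   `|df z| <= M /\ forall h, normc h < d ->
   `|f (z + h) - f z - act h (df z)| <= M * normc h ^+ 2.
Proof.
move=> H.
have E z : exists w : V, exists2 d, 0 < d & exists M, forall h, normc h < d ->
   `|f (z + h) - f z - act h w| <= M * normc h ^+ 2.
  have [d d0 [M /(_ z)]] := H z; rewrite subrr Normc.normc0 => /(_ d0)[w _ Hw].
  by exists w; exists d => //; exists M.
have [df Hdf] := choice E.
pose P N (p : R * R) := let z := Complex p.1 p.2 in `|df z| <= N%:R /\
  forall h, normc h < N.+1%:R^-1 -> `|f (z + h) - f z - act h (df z)| <= N%:R * normc h ^+ 2.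
have [] := @compact_uniform (R * R)%type (`[- B, B] `*` `[- B, B]) P.
- by apply: compact_setX; exact: segment_compact.
- move=> n m p nm [P1 P2]; split; first by rewrite (le_trans P1)// ler_nat.
  move=> h hm; apply: (@le_trans _ _ (n%:R * normc h ^+ 2)).
    apply: P2; apply: (lt_le_trans hm).
    by rewrite lef_pV2 ?posrE// ler_nat.
  by apply: ler_wpM2r; [rewrite sqr_ge0|rewrite ler_nat].
- move=> [x y] _ /=; have [d d0 [M HM]] := H (Complex x y).
  have [n hn] := small_inv d0.
  pose N := maxn n (Num.bound `|M|).
  have MN : M <= N%:R.
    apply: (le_trans (ler_norm _)); apply/ltW; apply: (lt_le_trans (archi_boundP (normr_ge0 M))).
    by rewrite ler_nat leq_maxr.
  have dN : N.+1%:R^-1 < d.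
    by apply: le_lt_trans hn; rewrite lef_pV2 ?posrE// ler_nat ltnS leq_maxl.
  exists N; have d20 : 0 < d / 2 by rewrite divr_gt0.
  apply/nbhs_normP; exists (d / 2) => //= -[x' y'] /=; rewrite prod_normE /= => hxy _.
  have [|w wM Hw] := HM (Complex x' y').
    apply: (le_lt_trans (normc_le _)) => /=.
    move: hxy; rewrite gt_max => /andP[h1 h2].
    by rewrite [d]splitr distrC [`|y' - y|]distrC ltrD.
  have [d' d'0 [M' HM']] := Hdf (Complex x' y').
  have dfw : df (Complex x' y') = w by exact: (hol_unique d'0 d0 HM' Hw).
  rewrite /P /= dfw; split; first exact: le_trans MN.
  move=> h hh; apply: (le_trans (Hw h (lt_trans hh dN))).
  by apply: ler_wpM2r MN; rewrite sqr_ge0.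
move=> N HN; exists N.+1%:R^-1; first by rewrite invr_gt0.
exists N%:R, df => -[x y] hz; apply: (HN (x, y)); split; rewrite /= in_itv /= -ler_norml.
  by apply: le_trans hz; exact: (normc_Re (Complex x y)).
by apply: le_trans hz; exact: (normc_Im (Complex x y)).
Qed.
End ComplexAction.

(** * Liouville's theorem *)

Lemma bernoulli (R : realType) (s : R) n : 0 <= s -> 1 + n%:R * s <= (1 + s) ^+ n.
Proof.
move=> s0; elim: n => [|n IH]; first by rewrite mul0r addr0 expr0.
rewrite exprS; apply: (@le_trans _ _ ((1 + s) * (1 + n%:R * s))).
  by rewrite -natr1; have := mulr_ge0 (ler0n R n) (sqr_ge0 s); nra.
by rewrite ler_pM2l// ltr_wpDr.
Qed.

Lemma small_root_of_unity (R : realType) (eta : R) : 0 < eta -> exists N (w : R[i]),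
  [/\ (0 < N)%N, w ^+ N = 1, Re w ^+ 2 + Im w ^+ 2 = 1, 0 < Im w < eta & 0 <= Re w].
Proof.
move=> eta0.
pose e (t : R) : R[i] := Complex (cos t) (sin t).
have eD t u : e (t + u) = e t * e u.
  by apply: complex_ext; rewrite ?cReM ?cImM /= ?cosD ?sinD//; ring.
have e0 : e 0 = 1 by rewrite /e cos0 sin0.
have eX t n : e t ^+ n = e (n%:R * t).
  by elim: n => [|n IH]; rewrite ?mul0r ?e0// exprS IH -eD -natr1; congr e; ring.
have e2 : e (2 * pi) = 1.
  by rewrite /e mulr_natl cos_mulr2n sin_mulr2n cospi sinpi; apply: complex_ext => /=; ring.
have /cvgrPdist_lt/(_ eta eta0)/nbhs_normP[d d0 Hd] := @continuous_sin R 0.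
have p0 := @pi_gt0 R.
have m0 : 0 < Num.min d (pi / 2) by rewrite lt_min d0 divr_gt0.
have [n /(_ n (leqnn n))] := small_div (2 * pi) m0.
set t := 2 * pi / n.+1%:R => ht.
have t0 : 0 < t by rewrite divr_gt0// mulr_gt0.
move: ht; rewrite lt_min => /andP[td tp].
exists n.+1, (e t); split => //.
- by rewrite eX /t mulrC divfK ?pnatr_eq0.
- exact: cos2Dsin2.
- rewrite /= sin_gt0_pi ?t0 /=; last by apply: (lt_trans tp); lra.
  have := Hd t; rewrite /= sin0 !sub0r !normrN (gtr0_norm t0) => /(_ td).
  by apply: le_lt_trans; exact: ler_norm.
- by apply: cos_ge0_pihalf; rewrite (ltW tp) andbT; lra.
Qed.

Section Liouville.
Variables (R : realType) (V : completeNormedModType R) (j : V -> V).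
Local Notation C := R[i].
Local Notation act := (act j).
Hypothesis jD : forall x y, j (x + y) = j x + j y.
Hypothesis jZ : forall (r : R) x, j (r *: x) = r *: j x.
Hypothesis jj : forall x, j (j x) = - x.
Hypothesis norm_act : forall z v, `|act z v| = normc z * `|v|.

Definition circle_sum (f : C -> V) (z0 w : C) N (r : R) : V :=
  \sum_(0 <= k < N) f (z0 + r%:C%C * w ^+ k).

(* The radial increment [r s w^k] and [-i] times the rotational increment [r w^k (w - 1)] agree up
   to [O(s^2)], and the rotational increments of [f] telescope around the circle to zero. *)
Lemma circle_sum_step f (z0 w : C) N (r R0 d M : R) (df : C -> V) :
  w ^+ N = 1 -> Re w ^+ 2 + Im w ^+ 2 = 1 -> 0 < Im w -> 0 <= Re w ->
  0 <= r <= R0 -> 2 * R0 * Im w < d ->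
  (forall k, let z := z0 + r%:C%C * w ^+ k in `|df z| <= M /\ forall h, normc h < d ->
    `|f (z + h) - f z - act h (df z)| <= M * normc h ^+ 2) ->
  `|circle_sum f z0 w N (r * (1 + Im w)) - circle_sum f z0 w N r|
     <= N%:R * ((3 * M * R0 ^+ 2 + R0 * M) * Im w ^+ 2).
Proof.
move=> wN w1 s0 c0 /andP[r0 rR] sd Hf; set s := Im w in s0 sd w1 *; set c := Re w in c0 w1.
have nw k : normc (w ^+ k) = 1.
  elim: k => [|k IH]; first by rewrite expr0 Normc.normc1.
  by rewrite exprS Normc.normcM IH normcE -/s -/c w1 sqrtr1 mulr1.
have R00 : 0 <= R0 := le_trans r0 rR.
have M0 : 0 <= M by have [/(le_trans (normr_ge0 _))] := Hf 0%N.
have c1 : 1 - c <= s ^+ 2 by nra.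
have c1' : 0 <= 1 - c by nra.
pose mi : C := Complex 0 (-1).
have nmi : normc mi = 1 by rewrite normcE /= expr0n add0r sqrrN expr1n sqrtr1.
pose z k := z0 + r%:C%C * w ^+ k.
pose h1 k := s%:C%C * (r%:C%C * w ^+ k).
pose h2 k := (w - 1) * (r%:C%C * w ^+ k).
have nrw k : normc (r%:C%C * w ^+ k) = r by rewrite Normc.normcM nw mulr1 normc_real ger0_norm.
have nh1 k : normc (h1 k) = s * r.
  by rewrite Normc.normcM nrw normc_real ger0_norm ?(ltW s0).
have nw1 : normc (w - 1) ^+ 2 <= 2 * s ^+ 2.
  rewrite normc_sq cReD cImD cReN cImN /= subr0 -/s -/c; nra.
have nh2 k : normc (h2 k) ^+ 2 <= 2 * s ^+ 2 * r ^+ 2.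
  by rewrite Normc.normcM nrw exprMn ler_wpM2r ?sqr_ge0.
have h1d k : normc (h1 k) < d.
  by rewrite nh1; apply: le_lt_trans sd; nra.
have h2d k : normc (h2 k) < d.
  apply: le_lt_trans sd; rewrite -(@ler_pXn2r _ 2)// ?nnegrE ?normc_ge0 ?mulr_ge0 ?(ltW s0)//.
  apply: (le_trans (nh2 k)); have : r ^+ 2 <= R0 ^+ 2 by rewrite ler_pXn2r ?nnegrE.
  have := sqr_ge0 s; have := sqr_ge0 r; have := sqr_ge0 R0; rewrite !exprMn; nra.
have step k : `|f (z k + h1 k) - f (z k) - act mi (f (z k + h2 k) - f (z k))| <=
   (3 * M * R0 ^+ 2 + R0 * M) * s ^+ 2.
  have [kM kH] := Hf k; have k1 := kH _ (h1d k); have k2 := kH _ (h2d k).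
  rewrite -/(z k) in kM k1 k2.
  set u := df (z k) in kM k1 k2.
  have -> : f (z k + h1 k) - f (z k) - act mi (f (z k + h2 k) - f (z k)) =
    (f (z k + h1 k) - f (z k) - act (h1 k) u)
    - act mi (f (z k + h2 k) - f (z k) - act (h2 k) u) + act (h1 k - mi * h2 k) u.
    rewrite (actDl j (h1 k)) actNl (actM jD jZ jj mi (h2 k)).
    have e1 a b : act mi (a - b) = act mi a - act mi b by rewrite (actDr jD) (actNr jZ).
    rewrite !e1.
    have gen (a b c' p q r' : V) : a - b - (p - q) = a - b - c' - (p - q - r') + (c' - r') by lmod.
    exact: gen.
  have nh3 : normc (h1 k - mi * h2 k) <= s ^+ 2 * r.
    have -> : h1 k - mi * h2 k = (Complex 0 (c - 1)) * (r%:C%C * w ^+ k).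
      transitivity ((s%:C%C - mi * (w - 1)) * (r%:C%C * w ^+ k)); first by rewrite /h1 /h2; ring.
      congr (_ * _); apply: complex_ext;
        rewrite !(cReD, cImD, cReN, cImN, cReM, cImM) /= -/s -/c; ring.
    rewrite Normc.normcM nrw; apply: ler_wpM2r => //.
    by rewrite normcE /= expr0n add0r sqrtr_sqr distrC ger0_norm.
  have -> : (3 * M * R0 ^+ 2 + R0 * M) * s ^+ 2 =
     (M * (R0 * s) ^+ 2 + M * (2 * (R0 * s) ^+ 2)) + s ^+ 2 * R0 * M by ring.
  have rs : (r * s) ^+ 2 <= (R0 * s) ^+ 2.
    by rewrite ler_pXn2r ?nnegrE ?mulr_ge0 ?(ltW s0)// ler_wpM2r ?(ltW s0).
  apply: (le_trans (ler_normD _ _)); apply: lerD.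
    apply: (le_trans (ler_normB _ _)); apply: lerD.
      apply: (le_trans k1); rewrite nh1 ler_wpM2l//; by rewrite mulrC.
    rewrite norm_act nmi mul1r; apply: (le_trans k2); rewrite ler_wpM2l//.
    by apply: (le_trans (nh2 k)); rewrite -mulrA -exprMn mulrC [s * r]mulrC mulrC ler_wpM2l.
  rewrite norm_act; apply: ler_pM => //; first exact: normc_ge0.
  by apply: (le_trans nh3); rewrite ler_wpM2l ?sqr_ge0.
have tele : \sum_(0 <= k < N) act mi (f (z k + h2 k) - f (z k)) = 0.
  rewrite -(act_sum jD jZ).
  have zS k : z k + h2 k = z k.+1 by rewrite /z /h2 exprS; ring.
  under eq_bigr do rewrite zS.
  rewrite (telescope_sumr (fun k => f (z k)))// /z wN expr0 subrr.
  by rewrite (act0r jZ).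
rewrite /circle_sum -sumrB.
have -> : \sum_(0 <= k < N) (f (z0 + (r * (1 + s))%:C%C * w ^+ k) - f (z0 + r%:C%C * w ^+ k)) =
  \sum_(0 <= k < N) (f (z k + h1 k) - f (z k) - act mi (f (z k + h2 k) - f (z k))).
  rewrite [in RHS]sumrB tele subr0; apply: eq_bigr => k _; congr (f _ - _).
  rewrite /z /h1 -addrA; congr (_ + _).
  by rewrite rmorphM rmorphD rmorph1; ring.
apply: (le_trans (ler_norm_sum _ _ _)).
apply: (@le_trans _ _ (\sum_(0 <= k < N) (3 * M * R0 ^+ 2 + R0 * M) * s ^+ 2)).
  by apply: ler_sum => k _; exact: step.
by rewrite sumr_const_nat subn0 [leRHS]mulr_natl.
Qed.

Theorem liouville (f : C -> V) : (forall p, hol j f p) ->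
  (forall e, 0 < e -> exists B, forall z, B <= normc z -> `|f z| <= e) ->
  forall z, f z = 0.
Proof.
move=> hf lim z0; apply/eqP; rewrite -normr_le0; apply/ler_addgt0Pr => e e0; rewrite add0r.
pose e1 := e / 3; have e10 : 0 < e1 by rewrite divr_gt0.
have [B HB] := lim _ e10.
pose R0 := Num.max (B + normc z0) 1.
have R01 : 1 <= R0 by rewrite le_max lexx orbT.
have R00 : 0 < R0 by apply: lt_le_trans R01.
have [d d0 [M [df Hdf]]] := hol_uniform (normc z0 + R0) hf.
have M0 : 0 <= M.
  by have [|/(le_trans (normr_ge0 _))] := Hdf z0; rewrite // lerDl ltW.
pose r0 := Num.min (d / 2) (Num.min (1 / 2) (e1 / (2 * M + 1))).
have M1 : 0 < 2 * M + 1 by rewrite ltr_wpDl// mulr_ge0.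
have r00 : 0 < r0 by rewrite !lt_min !divr_gt0.
have r0d : r0 < d by apply: (@le_lt_trans _ _ (d / 2)); [rewrite ge_min lexx|lra].
have r0h : r0 <= 1 / 2 by rewrite !ge_min lexx orbT.
have r0R : r0 < R0 by apply: (le_lt_trans r0h); apply: lt_le_trans R01; lra.
have r0e : 2 * M * r0 <= e1.
  apply: (@le_trans _ _ ((2 * M + 1) * r0)); first by rewrite ler_wpM2r ?(ltW r00)// lerDl.
  by rewrite mulrC -ler_pdivlMr// !ge_min lexx !orbT.
pose K := 3 * M * R0 ^+ 2 + R0 * M.
have K0 : 0 <= K by rewrite addr_ge0 ?mulr_ge0 ?sqr_ge0 ?(ltW R00).
pose Q := R0 / r0 + 1; have Q0 : 0 < Q by rewrite ltr_wpDl// divr_ge0 ?ltW.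
pose eta := Num.min 1 (Num.min (d / (2 * R0)) (e1 / (Q * (K + 1)))).
have K1 : 0 < K + 1 by rewrite ltr_wpDl.
have eta0 : 0 < eta by rewrite !lt_min ltr01 !divr_gt0 ?mulr_gt0.
have [N [w [N0 wN w1 /andP[s0 sE] c0]]] := small_root_of_unity eta0.
set s := Im w in s0 sE.
move: sE; rewrite !lt_min => /and3P[s1 sd sQ].
have {}sd : 2 * R0 * s < d by move: sd; rewrite ltr_pdivlMr ?mulr_gt0// mulrC.
have nw k : normc (w ^+ k) = 1.
  elim: k => [|k IH]; first by rewrite expr0 Normc.normc1.
  by rewrite exprS Normc.normcM IH normcE w1 sqrtr1 mulr1.
have nrw r k : 0 <= r -> normc (r%:C%C * w ^+ k) = r.
  by move=> ?; rewrite Normc.normcM nw mulr1 normc_real ger0_norm.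
pose A := circle_sum f z0 w N.
have Astep r : 0 <= r <= R0 -> `|A (r * (1 + s)) - A r| <= N%:R * (K * s ^+ 2).
  move=> hr; apply: (circle_sum_step wN w1 s0 c0 hr sd (df := df)) => k.
  apply: Hdf; apply: (le_trans (normc_triangle _ _)).
  by case/andP: hr => ? ?; rewrite nrw// lerD2l.
have [n nP] : exists n, R0 <= r0 * (1 + s) ^+ n.
  have [n hn] : exists n : nat, R0 / r0 / s < n%:R.
    by exists (Num.bound (R0 / r0 / s)); apply: archi_boundP; rewrite !divr_ge0 ?ltW.
  exists n; rewrite mulrC -ler_pdivrMr//.
  apply: le_trans (bernoulli n (ltW s0)).
  by rewrite ltr_pdivrMr// in hn; rewrite ler_wpDl// ltW.
have [{nP}{}n nP nmin] := ex_minnP (ex_intro (fun n => R0 <= r0 * (1 + s) ^+ n) n nP).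
have below m : (m < n)%N -> r0 * (1 + s) ^+ m < R0.
  by move=> mn; rewrite ltNge; apply: contraL mn => /nmin; rewrite -leqNgt.
have s10 : 0 <= 1 + s by rewrite addr_ge0// ltW.
have Aiter m : (m <= n)%N -> `|A (r0 * (1 + s) ^+ m) - A r0| <= m%:R * (N%:R * (K * s ^+ 2)).
  elim: m => [|m IH] mn; first by rewrite expr0 mulr1 subrr normr0 mul0r.
  have -> : A (r0 * (1 + s) ^+ m.+1) - A r0 =
    (A (r0 * (1 + s) ^+ m * (1 + s)) - A (r0 * (1 + s) ^+ m)) + (A (r0 * (1 + s) ^+ m) - A r0).
    by rewrite exprSr mulrA addrA subrK.
  rewrite -natr1 mulrDl mul1r [leRHS]addrC (le_trans (ler_normD _ _))// lerD ?IH ?(ltnW mn)//.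
  apply: Astep; apply/andP; split; last exact: ltW (below _ mn).
  by rewrite mulr_ge0 ?exprn_ge0// ltW.
have ns : n%:R * s <= Q.
  case: n nP nmin below Aiter => [|n] nP nmin below Aiter; first by rewrite mul0r ltW.
  rewrite -natr1 mulrDl mul1r lerD ?(ltW s1)//.
  have := below n (leqnn _); rewrite mulrC -ltr_pdivlMr// => /ltW.
  by apply: le_trans; apply: le_trans (bernoulli n (ltW s0)); rewrite lerDr.
have NR0 : 0 < N%:R :> R by rewrite ltr0n.
have b1 : `|A (r0 * (1 + s) ^+ n) - A r0| <= N%:R * e1.
  apply: (le_trans (Aiter n (leqnn n))).
  rewrite mulrCA ler_wpM2l ?(ltW NR0)//.
  have -> : n%:R * (K * s ^+ 2) = (n%:R * s) * (K * s) by ring.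
  apply: (@le_trans _ _ (Q * ((K + 1) * s))).
    apply: ler_pM => //; rewrite ?mulr_ge0 ?(ltW s0)//.
    by rewrite ler_wpM2r ?(ltW s0)// lerDl.
  by rewrite mulrA mulrC -ler_pdivlMr ?mulr_gt0// ltW.
have b2 : `|A (r0 * (1 + s) ^+ n)| <= N%:R * e1.
  rewrite /A /circle_sum (le_trans (ler_norm_sum _ _ _))//.
  apply: (@le_trans _ _ (\sum_(0 <= k < N) e1)); last by rewrite sumr_const_nat subn0 [leRHS]mulr_natl.
  apply: ler_sum => k _; apply: HB; set r := r0 * _ in nP *.
  have nz : normc (r%:C%C * w ^+ k) = r by rewrite nrw// (le_trans (ltW R00)).
  have := normcBl (r%:C%C * w ^+ k) (- z0); rewrite nz normcN opprK [_ + z0]addrC.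
  apply: le_trans; rewrite lerBrDr; apply: le_trans nP.
  by rewrite le_max lexx.
have b3 : `|A r0 - N%:R *: f z0| <= N%:R * e1.
  have -> : A r0 - N%:R *: f z0 = \sum_(0 <= k < N) (f (z0 + r0%:C%C * w ^+ k) - f z0).
    by rewrite sumrB sumr_const_nat subn0 scaler_nat.
  rewrite (le_trans (ler_norm_sum _ _ _))//.
  apply: (@le_trans _ _ (\sum_(0 <= k < N) e1)); last by rewrite sumr_const_nat subn0 [leRHS]mulr_natl.
  apply: ler_sum => k _; set h := _ * _.
  have nh : normc h = r0 by rewrite nrw// ltW.
  have [|dM /(_ h)] := Hdf z0; first by rewrite lerDl ltW.
  rewrite nh => /(_ r0d) H.
  have -> : f (z0 + h) - f z0 = (f (z0 + h) - f z0 - act h (df z0)) + act h (df z0) by lmod.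
  apply: (le_trans (ler_normD _ _)); rewrite norm_act nh.
  apply: le_trans r0e; have -> : 2 * M * r0 = M * r0 + r0 * M by ring.
  apply: lerD; last by rewrite ler_wpM2l// ltW.
  apply: (le_trans H); rewrite ler_wpM2l// expr2 ler_piMr ?(ltW r00)//.
  by apply: (le_trans r0h); lra.
have : N%:R * `|f z0| <= N%:R * (e1 + e1 + e1).
  rewrite -[N%:R in leLHS]ger0_norm ?ler0n// -normrZ.
  have -> : N%:R *: f z0 = A (r0 * (1 + s) ^+ n) - (A (r0 * (1 + s) ^+ n) - A r0)
     - (A r0 - N%:R *: f z0) by lmod.
  rewrite !mulrDr (le_trans (ler_normB _ _))// lerD//.
  by rewrite (le_trans (ler_normB _ _))// lerD.
by rewrite ler_pM2l// => /le_trans; apply; rewrite /e1; lra.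
Qed.
End Liouville.

(** * Resolvents *)

Lemma contraction_fixpoint (R : realType) (V : completeNormedModType R) (f : V -> V) (q : R) :
  0 <= q -> q < 1 -> (forall x y, `|f x - f y| <= q * `|x - y|) -> exists p, p = f p.
Proof.
move=> q0 q1 H; have fS : {homo f : x / [set: V] x >-> [set: V] x} by [].
have ctr : is_contraction (mkfun fS).
  exists (NngNum q0); split=> // -[x y] _ /=; exact: H.
have [] := banach_fixed_point ctr closedT; first by exists 0.
by move=> p _ pE; exists p.
Qed.

Section BoundedLinear.
Variables (R : realType) (V : completeNormedModType R) (f : V -> V).
Hypothesis Hf : bdd_lin f.

Lemma blD x y : f (x + y) = f x + f y. Proof. by case: Hf. Qed.
Lemma blZ (r : R) x : f (r *: x) = r *: f x. Proof. by case: Hf => _ []. Qed.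
Lemma blN x : f (- x) = - f x. Proof. by rewrite -scaleN1r blZ scaleN1r. Qed.
Lemma blB x y : f (x - y) = f x - f y. Proof. by rewrite blD blN. Qed.
Lemma bl0 : f 0 = 0. Proof. by rewrite -(scale0r (0 : V)) blZ !scale0r. Qed.
Lemma bl_bound : exists2 M : R, 0 < M & forall x, `|f x| <= M * `|x|.
Proof.
case: Hf => _ [_ [C HC]]; exists (`|C| + 1); first by rewrite ltr_wpDl.
move=> x; apply: (le_trans (HC x)); apply: ler_wpM2r => //.
by apply: (le_trans (ler_norm C)); rewrite lerDl.
Qed.
End BoundedLinear.

Section Resolvent.
Variables (R : realType) (V : completeNormedModType R) (j : V -> V).
Local Notation C := R[i].
Local Notation act := (act j).
Hypothesis jD : forall x y, j (x + y) = j x + j y.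
Hypothesis jZ : forall (r : R) x, j (r *: x) = r *: j x.
Hypothesis jj : forall x, j (j x) = - x.
Hypothesis norm_act : forall z v, `|act z v| = normc z * `|v|.
Variables (T : V -> V) (X : V -> Prop).
Hypothesis HT : bdd_lin T.

Let actB z u v : act z (u - v) = act z u - act z v.
Proof. by rewrite (actDr jD) (actNr jZ). Qed.

Definition pencil (z : C) (v : V) : V := act z v - T v.
Definition resolvent (z : C) : V -> V := opinv (pencil z).
Local Notation K := pencil.
Local Notation S := resolvent.
Local Notation Inv z := (invertible (K z)).

Lemma resolvent_spec z : Inv z -> bdd_lin (S z) /\ cancel (K z) (S z) /\ cancel (S z) (K z).
Proof. by rewrite /S /opinv; case: pselect => // H _; case: (cid H). Qed.
Lemma resolvent_bl z : Inv z -> bdd_lin (S z).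
Proof. by case/resolvent_spec. Qed.
Lemma pencilK z v : Inv z -> S z (K z v) = v.
Proof. by case/resolvent_spec => _ [h _]; exact: h. Qed.
Lemma resolventK z v : Inv z -> K z (S z v) = v.
Proof. by case/resolvent_spec => _ [_ h]; exact: h. Qed.

Lemma pencil_shift z w v : K w v = K z v + act (w - z) v.
Proof. by rewrite /K actDl actNl; lmod. Qed.
Lemma pencilD z u v : K z (u + v) = K z u + K z v.
Proof. by rewrite /K (actDr jD) (blD HT); lmod. Qed.
Lemma pencilZ z (r : R) v : K z (r *: v) = r *: K z v.
Proof. by rewrite /K (actZr jZ) (blZ HT); lmod. Qed.
Lemma pencilN z v : K z (- v) = - K z v.
Proof. by rewrite -scaleN1r pencilZ scaleN1r. Qed.

Lemma resolvent_identity z w u : Inv z -> Inv w -> S w (act (w - z) (S z u)) = S z u - S w u.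
Proof.
move=> hz hw; have := pencil_shift z w (S z u); rewrite (resolventK _ hz) => h.
have := congr1 (S w) h; rewrite (pencilK _ hw) (blD (resolvent_bl hw)) => e.
by rewrite {2}e addrAC subrr add0r.
Qed.

Lemma pencil_lower z w M y : Inv z -> (forall u, `|S z u| <= M * `|u|) -> 0 <= M ->
  (1 - M * normc (w - z)) * `|y| <= M * `|K w y|.
Proof.
move=> hz hM M0; rewrite mulrBl mul1r lerBlDr.
apply: (@le_trans _ _ (M * `|K z y|)); first by rewrite -{1}(pencilK y hz).
rewrite -mulrA -mulrDr ler_wpM2l// -norm_act -[K z y](addrK (act (w - z) y)) -pencil_shift.
exact: ler_normB.
Qed.

Lemma neumann z w M : Inv z -> (forall u, `|S z u| <= M * `|u|) -> 0 < M ->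
  M * normc (w - z) < 1 -> Inv w.
Proof.
move=> hz hM M0 q1; set q := M * _ in q1.
have q0 : 0 <= q by rewrite mulr_ge0 ?normc_ge0 ?ltW.
have bS := resolvent_bl hz.
have E u : exists y, K w y = u.
  have [|y yE] := @contraction_fixpoint R V (fun y => S z (u - act (w - z) y)) q q0 q1.
    move=> x y; have -> : S z (u - act (w - z) x) - S z (u - act (w - z) y) =
        S z (act (w - z) (y - x)).
      by rewrite -(blB bS); congr (S z _); rewrite actB; lmod.
    apply: (le_trans (hM _)); rewrite norm_act /q -mulrA ler_wpM2l ?(ltW M0)//.
    by rewrite distrC.
  exists y; rewrite (pencil_shift z) {1}yE (resolventK _ hz) subrK//.
have [g gE] := choice E.
have low y : (1 - q) * `|y| <= M * `|K w y| by apply: pencil_lower => //; exact: ltW.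
have p0 : 0 < 1 - q by rewrite subr_gt0.
have inj y y' : K w y = K w y' -> y = y'.
  move=> h; apply/eqP; rewrite -subr_eq0 -normr_le0 -(ler_pM2l p0) mulr0.
  by apply: (le_trans (low _)); rewrite pencilD pencilN h subrr normr0 mulr0.
exists g; split; last by split=> // y; exact: inj.
split=> [x y|]; first by apply: inj; rewrite pencilD !gE.
split=> [r x|]; first by apply: inj; rewrite pencilZ !gE.
exists (M / (1 - q)) => x; have := low (g x); rewrite gE => h.
by rewrite mulrAC ler_pdivlMr// mulrC.
Qed.

Lemma resolvent_bound_near z w M : Inv z -> (forall u, `|S z u| <= M * `|u|) -> 0 < M ->
  2 * M * normc (w - z) < 1 -> Inv w /\ forall u, `|S w u| <= 2 * M * `|u|.
Proof.
move=> hz hM M0 q1; have q0 : 0 <= M * normc (w - z) by rewrite mulr_ge0 ?normc_ge0 ?ltW.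
have hw : Inv w by apply: (neumann hz hM M0); lra.
split=> // u; have := @pencil_lower z w M (S w u) hz hM (ltW M0); rewrite (resolventK _ hw).
have := normr_ge0 (S w u); have := normr_ge0 u; nra.
Qed.

Lemma resolvent_lipschitz z w M u : Inv z -> Inv w -> (forall u, `|S z u| <= M * `|u|) ->
  (forall u, `|S w u| <= M * `|u|) -> 0 <= M -> `|S w u - S z u| <= M ^+ 2 * normc (w - z) * `|u|.
Proof.
move=> hz hw bz bw M0; rewrite distrC -resolvent_identity//.
apply: (le_trans (bw _)); rewrite norm_act expr2 -!mulrA ler_wpM2l//.
by rewrite [leRHS]mulrCA ler_wpM2l ?normc_ge0.
Qed.

Definition pgood z := Inv z /\ forall n v lam, X v ->
  iter n (S z) (act lam v) = act lam (iter n (S z) v).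

(* With [D m n mu] the defect of [S w ^m o S z ^n] at [act mu v], the resolvent identity gives
   [D m+1 n mu = D m (n+1) mu - D (m+1) (n+1) (h mu) + act mu (D (m+1) (n+1) h)], [h = w - z];
   iterating [k] times bounds the defect by [(2 M |h|)^k]. *)
Lemma pgood_near z w M : pgood z -> (forall u, `|S z u| <= M * `|u|) -> 0 < M ->
  2 * M * normc (w - z) < 1 -> pgood w.
Proof.
move=> [hz gz] bz M0 q1; have [hw bw] := resolvent_bound_near hz bz M0 q1.
split=> // m v lam Xv; set h := w - z in q1 *.
set q := 2 * M * normc h in q1.
have q0 : 0 <= q by rewrite !mulr_ge0 ?normc_ge0 ?ltW.
have bSw := resolvent_bl hw.
pose a m n mu := iter m (S w) (act mu (iter n (S z) v)).
suff H : forall m n mu, a m n mu = act mu (a m n 1).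
  by have := H m 0%N lam; rewrite /a /= act1.
move=> {lam}{}m; elim: m => [n mu|m IH n mu]; first by rewrite /a /= act1.
have rec n' mu' : a m.+1 n' mu' = a m n'.+1 mu' - a m.+1 n'.+1 (h * mu').
  rewrite /a !(iterSr m) -(blB (_ : bdd_lin (iter m (S w)))); last first.
    elim: (m) => [|k IHk]; first by split=> //; split=> //; exists 1 => x; rewrite mul1r.
    split=> [x y|]; first by rewrite /= (blD IHk) (blD bSw).
    split=> [r x|]; first by rewrite /= (blZ IHk) (blZ bSw).
    have [M1 M10 H1] := bl_bound IHk; exists (2 * M * M1) => x /=.
    by apply: (le_trans (bw _)); rewrite -[leRHS]mulrA ler_wpM2l// mulr_ge0 ?ltW.
  congr (iter m (S w) _).
  have e1 : act mu' (iter n'.+1 (S z) v) = S z (act mu' (iter n' (S z) v)).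
    by rewrite -!gz.
  rewrite (actM jD jZ jj) e1.
  have := resolvent_identity (act mu' (iter n' (S z) v)) hz hw; rewrite -/h => ->.
  by rewrite subKr.
pose D n mu := a m.+1 n mu - act mu (a m.+1 n 1).
have Drec n' mu' : D n' mu' = act mu' (D n'.+1 h) - D n'.+1 (h * mu').
  rewrite /D (rec n' mu') (rec n' 1) (IH n'.+1 mu') mulr1 !actB -(actM jD jZ jj) (mulrC h).
  have gen (x y b c : V) : x - y - (x - b) = b - c - (y - c) by lmod.
  exact: gen.
have itb k x : `|iter k (S z) x| <= M ^+ k * `|x|.
  elim: k => [|k IHk]; first by rewrite expr0 mul1r.
  by rewrite iterS (le_trans (bz _))// exprS -mulrA ler_wpM2l// ltW.
have itw k x : `|iter k (S w) x| <= (2 * M) ^+ k * `|x|.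
  elim: k => [|k IHk]; first by rewrite expr0 mul1r.
  by rewrite iterS (le_trans (bw _))// exprS -[leRHS]mulrA ler_wpM2l// mulr_ge0 ?ltW.
have M20 : 0 <= 2 * M by rewrite mulr_ge0 ?ltW.
pose B := 2 * (2 * M) ^+ m.+1 * `|v|.
have Db k : forall n' mu', `|D n' mu'| <= q ^+ k * (B * M ^+ n' * normc mu').
  elim: k => [|k IHk] n' mu'.
    have ab mu1 : `|a m.+1 n' mu1| <= (2 * M) ^+ m.+1 * (normc mu1 * (M ^+ n' * `|v|)).
      by rewrite (le_trans (itw _ _))// ler_wpM2l ?exprn_ge0// norm_act ler_wpM2l ?normc_ge0.
    rewrite expr0 mul1r (le_trans (ler_normB _ _))//.
    have := ab mu'; have := ab 1; rewrite Normc.normc1 mul1r => h1 h2.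
    rewrite norm_act.
    have -> : B * M ^+ n' * normc mu' = (2 * M) ^+ m.+1 * (normc mu' * (M ^+ n' * `|v|)) +
       normc mu' * ((2 * M) ^+ m.+1 * (M ^+ n' * `|v|)) by rewrite /B; ring.
    by rewrite lerD// ler_wpM2l ?normc_ge0.
  rewrite Drec (le_trans (ler_normB _ _))// norm_act.
  have -> : q ^+ k.+1 * (B * M ^+ n' * normc mu') =
    normc mu' * (q ^+ k * (B * M ^+ n'.+1 * normc h)) + q ^+ k * (B * M ^+ n'.+1 * (normc h * normc mu')).
    by rewrite !exprS /q; ring.
  rewrite lerD//; first by rewrite ler_wpM2l ?normc_ge0.
  by apply: (le_trans (IHk _ _)); rewrite Normc.normcM.
suff : D n mu = 0 by move/subr0_eq.
apply/eqP; rewrite -normr_le0; apply/ler_addgt0Pr => e e0; rewrite add0r.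
set c := B * M ^+ n * normc mu in Db *.
have c0 : 0 <= c.
  by rewrite /c /B !mulr_ge0 ?exprn_ge0 ?normc_ge0 ?(ltW M0)// exprn_ge0.
have /cvgrPdist_le : (fun k => c * q ^+ k) @ \oo --> c * 0.
  by apply: cvgMr; apply: cvg_expr; rewrite ger0_norm.
rewrite mulr0 => /(_ e e0)[k _ /(_ k (leqnn _))]; rewrite sub0r normrN => h1.
apply: (le_trans (Db k n mu)); rewrite mulrC; apply: le_trans h1; exact: ler_norm.
Qed.

Lemma resolvent_act z u lam : pgood z -> X u -> S z (act lam u) = act lam (S z u).
Proof. by move=> [_ /(_ 1%N u lam)]. Qed.

Lemma resolvent2_act z w u lam : pgood z -> pgood w -> X u ->
  S w (act lam (S z u)) = act lam (S w (S z u)).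
Proof.
move=> gz gw Xu; have [hz _] := gz; have [hw _] := gw.
have [->|wz] := eqVneq w z.
  have [_ /(_ 2%N u lam Xu) /=] := gz.
  by have [_ /(_ 1%N u lam Xu) /= ->] := gz.
have dz : w - z != 0 by rewrite subr_eq0.
have E mu : S w (act mu (S z u)) = act (mu / (w - z)) (S z u - S w u).
  have -> : act mu (S z u) = act (w - z) (S z (act (mu / (w - z)) u)).
    by rewrite (resolvent_act _ gz Xu) -(actM jD jZ jj) mulrC divfK.
  rewrite resolvent_identity// (resolvent_act _ gz Xu) (resolvent_act _ gw Xu).
  by rewrite actB.
by rewrite E -[S z u in RHS](act1 j) E -(actM jD jZ jj) div1r.
Qed.

Lemma resolvent3_act z w u lam : pgood z -> pgood w -> X u ->
  S w (act lam (S z (S z u))) = act lam (S w (S z (S z u))).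
Proof.
move=> gz gw Xu; have [hz _] := gz; have [hw _] := gw.
have [->|wz] := eqVneq w z.
  have [_ g] := gz; have := g 3%N u lam Xu; have := g 2%N u lam Xu; rewrite /= => -> //.
have dz : w - z != 0 by rewrite subr_eq0.
have E mu : S w (act mu (S z (S z u))) = act (mu / (w - z)) (S z (S z u) - S w (S z u)).
  have -> : act mu (S z (S z u)) = act (w - z) (S z (act (mu / (w - z)) (S z u))).
    by rewrite (resolvent2_act _ gz gz Xu) -(actM jD jZ jj) mulrC divfK.
  rewrite resolvent_identity// (resolvent2_act _ gz gz Xu) (resolvent2_act _ gz gw Xu).
  by rewrite actB.
by rewrite E -[S z (S z u) in RHS](act1 j) E -(actM jD jZ jj) div1r.
Qed.

Lemma resolvent_quotient z w u : pgood z -> pgood w -> X u -> w != z ->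
  S w (S z u) = act (w - z)^-1 (S z u - S w u).
Proof.
move=> gz gw Xu wz; have [hz _] := gz; have [hw _] := gw.
have dz : w - z != 0 by rewrite subr_eq0.
by rewrite -resolvent_identity// (resolvent2_act _ gz gw Xu) (actK jD jZ jj).
Qed.

Lemma hol_resolvent (A : V -> V) p u d M : 0 < d -> 0 <= M -> X u -> bdd_lin A ->
  (forall z, normc (z - p) < d -> [/\ pgood z, (forall v, `|S z v| <= M * `|v|) &
     forall lam, A (act lam (S z (S z u))) = act lam (A (S z (S z u)))]) ->
  hol j (fun z => A (S z u)) p.
Proof.
move=> d0 M0 Xu bA H; have [CA CA0 hCA] := bl_bound bA.
have d20 : 0 < d / 2 by rewrite divr_gt0.
exists (d / 2) => //; exists (Num.max (CA * (M * (M * `|u|))) (CA * (M ^+ 3 * `|u|))) => z zd.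
have [gz bz Az] : [/\ pgood z, (forall v, `|S z v| <= M * `|v|) &
     forall lam, A (act lam (S z (S z u))) = act lam (A (S z (S z u)))].
  by apply: H; apply: (lt_trans zd); lra.
exists (- A (S z (S z u))).
  rewrite normrN le_max; apply/orP; left; apply: (le_trans (hCA _)); rewrite ler_wpM2l ?(ltW CA0)//.
  by apply: (le_trans (bz _)); rewrite ler_wpM2l.
move=> h hd; set w := z + h.
have [gw bw _] : [/\ pgood w, (forall v, `|S w v| <= M * `|v|) &
     forall lam, A (act lam (S w (S w u))) = act lam (A (S w (S w u)))].
  apply: H; rewrite /w addrAC; apply: (le_lt_trans (normc_triangle _ _)).
  by rewrite [d]splitr ltrD.
have hwz : w - z = h by rewrite /w addrAC subrr add0r.
have -> : A (S w u) - A (S z u) - act h (- A (S z (S z u))) =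
   A (act h (S z (S z u) - S w (S z u))).
  rewrite (actNr jZ) opprK -Az -!(blB bA) -(blD bA); congr A.
  have [hz _] := gz; have [hw _] := gw.
  have := @resolvent_identity z w u hz hw; rewrite hwz (resolvent2_act _ gz gw Xu) actB => ->.
  lmod.
apply: (le_trans (hCA _)); rewrite norm_act.
apply: (@le_trans _ _ (CA * (M ^+ 3 * `|u|) * normc h ^+ 2)); last first.
  by apply: ler_wpM2r; [rewrite sqr_ge0|rewrite le_max lexx orbT].
have [hz _] := gz; have [hw _] := gw.
have := @resolvent_lipschitz z w M (S z u) hz hw bz bw M0; rewrite distrC hwz => h1.
rewrite -[leRHS]mulrA ler_wpM2l ?(ltW CA0)//.
have -> : M ^+ 3 * `|u| * normc h ^+ 2 = normc h * (M ^+ 2 * normc h * (M * `|u|)) by ring.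
rewrite ler_wpM2l ?normc_ge0// (le_trans h1)// ler_wpM2l//.
by rewrite mulr_ge0 ?sqr_ge0 ?normc_ge0.
Qed.

Lemma resolvent_far (tau : R) z u : (forall x, `|T x| <= tau * `|x|) -> tau < normc z ->
  Inv z -> `|S z u| <= `|u| / (normc z - tau).
Proof.
move=> bT tz hz; rewrite ler_pdivlMr ?subr_gt0// mulrBr lerBlDr.
have := resolventK u hz; rewrite /K => /eqP; rewrite subr_eq => /eqP h.
rewrite mulrC -norm_act h (le_trans (ler_normD _ _))// lerD2l mulrC; exact: bT.
Qed.
End Resolvent.

(** * Cauchy integrals and Dixon's argument *)

Section Bounds.
Variable R : realType.
Local Notation C := R[i].

Lemma cc_bound (f : R -> C) (a b : R) : (forall t, a <= t <= b -> cc f t) ->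
  exists2 G : R, 0 <= G & forall t, a <= t <= b -> normc (f t) <= G.
Proof.
move=> cf; have [|t ht|N HN] := @segment_uniform R a b (fun N t => normc (f t) <= N%:R).
- by move=> n m x nm /le_trans; apply; rewrite ler_nat.
- have /nbhs_normP[d d0 Hd] := cc_near (cf t ht) ltr01.
  exists (Num.bound (normc (f t) + 1)), d => // u _ ut.
  have := Hd u; rewrite /= distrC => /(_ ut) h.
  have h0 : 0 <= normc (f t) + 1 by rewrite addr_ge0 ?normc_ge0.
  apply/ltW; apply: le_lt_trans (archi_boundP h0).
  by rewrite -[f u](subrK (f t)) addrC (le_trans (normc_triangle _ _))// addrC [leRHS]addrC lerD2r.
by exists N%:R.
Qed.

Lemma cont_bound (V : completeNormedModType R) (f : R -> V) (a b : R) : cont_on f a b ->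
  exists2 G : R, 0 <= G & forall t, a <= t <= b -> `|f t| <= G.
Proof.
move=> cf; have [|t ht|N HN] := @segment_uniform R a b (fun N t => `|f t| <= N%:R).
- by move=> n m x nm /le_trans; apply; rewrite ler_nat.
- have /cvgrPdist_le/(_ 1 ltr01)/nbhs_normP[d d0 Hd] := cf t ht.
  exists (Num.bound (`|f t| + 1)), d => // u _ ut.
  have := Hd u; rewrite /= distrC => /(_ ut) h.
  have h0 : 0 <= `|f t| + 1 by rewrite addr_ge0.
  apply/ltW; apply: le_lt_trans (archi_boundP h0).
  rewrite -[f u](subrK (f t)) addrC (le_trans (ler_normD _ _))// lerD2l distrC//.
by exists N%:R.
Qed.
End Bounds.

Section HolomorphicOperations.
Variables (R : realType) (V : completeNormedModType R) (j : V -> V).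
Local Notation C := R[i].
Local Notation act := (act j).
Hypothesis jD : forall x y, j (x + y) = j x + j y.
Hypothesis jZ : forall (r : R) x, j (r *: x) = r *: j x.
Hypothesis jj : forall x, j (j x) = - x.
Hypothesis norm_act : forall z v, `|act z v| = normc z * `|v|.

Lemma hol_near (f g : C -> V) p d : 0 < d -> (forall z, normc (z - p) < d -> f z = g z) ->
  hol j g p -> hol j f p.
Proof.
move=> d0 fg [d1 d10 [M HM]].
exists (Num.min (d / 2) d1); first by rewrite lt_min d10 divr_gt0.
exists M => z; rewrite lt_min => /andP[z1 z2]; have [w wM Hw] := HM z z2.
exists w => // h; rewrite lt_min => /andP[h1 h2].
rewrite !fg; first exact: Hw.
  by apply: (lt_trans z1); lra.
rewrite addrAC; apply: (le_lt_trans (normc_triangle _ _)).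
by rewrite [d]splitr ltrD.
Qed.

Lemma hol_add (f g : C -> V) p : hol j f p -> hol j g p -> hol j (fun z => f z + g z) p.
Proof.
move=> [d1 d10 [M1 H1]] [d2 d20 [M2 H2]].
exists (Num.min d1 d2); first by rewrite lt_min d10.
exists (M1 + M2) => z; rewrite lt_min => /andP[/H1[w1 b1 K1] /H2[w2 b2 K2]].
exists (w1 + w2); first by rewrite (le_trans (ler_normD _ _))// lerD.
move=> h; rewrite lt_min => /andP[/K1 k1 /K2 k2].
have -> : f (z + h) + g (z + h) - (f z + g z) - act h (w1 + w2) =
  (f (z + h) - f z - act h w1) + (g (z + h) - g z - act h w2).
  by rewrite (actDr jD); lmod.
by rewrite mulrDl (le_trans (ler_normD _ _))// lerD.
Qed.

Lemma hol_sum n (F : 'I_n -> C -> V) p : (forall k, hol j (F k) p) ->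
  hol j (fun z => \sum_(k < n) F k z) p.
Proof.
elim: n F => [F _|n IH F HF].
  exists 1 => //; exists 0 => z _; exists 0; first by rewrite normr0.
  by move=> h _; rewrite !big_ord0 (act0r jZ) !subr0 normr0 mul0r.
apply: (@hol_near _ (fun z => \sum_(k < n) F (widen_ord (leqnSn n) k) z + F ord_max z) p 1) => //.
  by move=> z _; rewrite big_ord_recr.
by apply: hol_add => //; apply: IH.
Qed.

Lemma hol_cauchy_transform (g : R -> C) (F : R -> V) (a b : R) p d0 : a <= b ->
  (forall t, a <= t <= b -> cc g t) -> cont_on F a b -> 0 < d0 ->
  (forall t, a <= t <= b -> d0 <= normc (g t - p)) ->
  hol j (fun z => integ a b (fun t => act (g t - z)^-1 (F t))) p.
Proof.
move=> ab cg cF d00 far; have [B B0 HB] := cont_bound cF.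
have d40 : 0 < d0 / 4 by rewrite divr_gt0.
pose r := d0 / 2; have r0 : 0 < r by rewrite divr_gt0.
have ri0 : 0 <= r^-1 by rewrite invr_ge0 ltW.
have ba : 0 <= b - a by rewrite subr_ge0.
have far1 z t : normc (z - p) < d0 / 2 -> a <= t <= b -> r <= normc (g t - z).
  move=> zp /far h; have := normcBl (g t - p) (z - p).
  have -> : g t - p - (z - p) = g t - z by ring.
  by apply: le_trans; rewrite /r; lra.
have ne z t : normc (z - p) < d0 / 2 -> a <= t <= b -> g t - z != 0.
  by move=> zp ht; rewrite -normc_gt0; apply: lt_le_trans (far1 z t zp ht).
have ninv z t : normc (z - p) < d0 / 2 -> a <= t <= b -> normc (g t - z)^-1 <= r^-1.
  move=> zp ht; rewrite Normc.normcV lef_pV2 ?posrE ?far1//.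
  by apply: lt_le_trans (far1 z t zp ht).
have cinv z t : normc (z - p) < d0 / 2 -> a <= t <= b -> cc (fun t => (g t - z)^-1) t.
  move=> zp ht; apply: (@ccV R (fun t => g t - z)); first exact: ne.
  by apply: ccD; [exact: cg|exact: cc_cst].
have U (q : R -> C) : (forall t, a <= t <= b -> cc q t) -> ucont (fun t => act (q t) (F t)) a b.
  move=> cq; apply: ucont_cont => t ht.
  by apply: act_continuous => //; [exact: cq|exact: cF].
exists (d0 / 4) => //; exists (Num.max (r^-1 ^+ 2 * B * (b - a)) (r^-1 ^+ 3 * B * (b - a))) => z zp.
have zp2 : normc (z - p) < d0 / 2 by apply: (lt_trans zp); lra.
pose q3 t := (g t - z)^-1 ^+ 2.
have c3 t : a <= t <= b -> cc q3 t by move=> ht; apply: ccX; exact: cinv.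
exists (integ a b (fun t => act (q3 t) (F t))).
  rewrite le_max; apply/orP; left; apply: integ_bound => //; first exact: U.
  move=> t ht; rewrite norm_act /q3 expr2 Normc.normcM.
  by rewrite ler_pM ?mulr_ge0 ?normc_ge0 ?HB// expr2 ler_pM ?normc_ge0 ?ninv.
move=> h hd.
have zh2 : normc (z + h - p) < d0 / 2.
  rewrite addrAC; apply: (le_lt_trans (normc_triangle _ _)); move: zp hd; lra.
pose q1 t := (g t - (z + h))^-1; pose q2 t := (g t - z)^-1.
pose q4 t := q1 t * h ^+ 2 * q2 t ^+ 2.
have c1 t : a <= t <= b -> cc q1 t by exact: cinv.
have c2 t : a <= t <= b -> cc q2 t by exact: cinv.
have c4 t : a <= t <= b -> cc q4 t.
  move=> ht; apply: ccM; last exact: c3.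
  by apply: ccM; [exact: c1|exact: cc_cst].
have E : integ a b (fun t => act (q1 t) (F t)) =
   integ a b (fun t => act (q4 t) (F t)) + (integ a b (fun t => act (q2 t) (F t)) +
     act h (integ a b (fun t => act (q3 t) (F t)))).
  have c5 t : a <= t <= b -> cc (fun t => h * q3 t) t.
    by move=> ht; apply: ccM; [exact: cc_cst|exact: c3].
  have c6 t : a <= t <= b -> cc (fun t => q2 t + h * q3 t) t.
    by move=> ht; apply: ccD; [exact: c2|exact: c5].
  have e1 : integ a b (fun t => act (h * q3 t) (F t)) = act h (integ a b (fun t => act (q3 t) (F t))).
    rewrite -(integ_act jD jZ norm_act)//; last exact: U.
    by apply: integ_ext => //; [exact: U|move=> t _; rewrite (actM jD jZ jj)].
  have e2 : integ a b (fun t => act (q2 t + h * q3 t) (F t)) =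
      integ a b (fun t => act (q2 t) (F t)) + integ a b (fun t => act (h * q3 t) (F t)).
    rewrite -integD//; try exact: U.
    by apply: integ_ext => //; [exact: U|move=> t _; rewrite actDl].
  rewrite -e1 -e2 -integD//; try exact: U.
  apply: integ_ext => //; first exact: U.
  move=> t ht; rewrite -actDl; congr (act _ _).
  rewrite /q4 /q3 /q1 /q2; have n1 := ne _ t zh2 ht; have n2 := ne _ t zp2 ht.
  have e0 : g t - (z + h) = g t - z - h by ring.
  rewrite e0 in n1 *; move: (g t - z) n1 n2 => x n1 n2.
  by field; rewrite n1 n2.
rewrite E; have -> : forall x y w : V, x + (y + w) - y - w = x by move=> x y w; lmod.
apply: (@le_trans _ _ (r^-1 ^+ 3 * B * (b - a) * normc h ^+ 2)); last first.
  by apply: ler_wpM2r; [rewrite sqr_ge0|rewrite le_max lexx orbT].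
have -> : r^-1 ^+ 3 * B * (b - a) * normc h ^+ 2 = (r^-1 ^+ 3 * normc h ^+ 2 * B) * (b - a) by ring.
apply: integ_bound => //; first exact: U.
move=> t ht; rewrite norm_act; apply: ler_pM; rewrite ?normc_ge0 ?HB//.
rewrite /q4 /q1 /q2 !expr2 !Normc.normcM.
have -> : r^-1 ^+ 3 * (normc h * normc h) = r^-1 * (normc h * normc h) * (r^-1 * r^-1) by ring.
by rewrite ler_pM ?mulr_ge0 ?normc_ge0// ?ler_wpM2r ?mulr_ge0 ?normc_ge0 ?ninv// ler_pM ?normc_ge0 ?ninv.
Qed.
End HolomorphicOperations.

Section DixonArgument.
Variables (R : realType) (V : completeNormedModType R) (j : V -> V).
Local Notation C := R[i].
Local Notation act := (act j).
Hypothesis jD : forall x y, j (x + y) = j x + j y.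
Hypothesis jZ : forall (r : R) x, j (r *: x) = r *: j x.
Hypothesis jj : forall x, j (j x) = - x.
Hypothesis norm_act : forall z v, `|act z v| = normc z * `|v|.
Variables (T : V -> V) (X : V -> Prop).
Hypothesis HT : bdd_lin T.
Local Notation S := (resolvent j T).
Local Notation Inv z := (invertible (pencil j T z)).
Local Notation pgood := (pgood j T X).

Variables (n : nat) (g dg : 'I_n -> R -> C) (a b : 'I_n -> R) (D : C -> Prop).
Hypothesis ab : forall k, a k < b k.
Hypothesis g_deriv : forall k t, cderiv (g k) (dg k t) t.
Hypothesis dg_cont : forall k t, cc (dg k) t.
Hypothesis g_closed : forall k, g k (a k) = g k (b k).
Hypothesis D_open : forall z, D z -> exists2 d, 0 < d & forall w, normc (w - z) < d -> D w.
Hypothesis g_off : forall k t, a k <= t <= b k -> ~ D (g k t).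
Hypothesis D_compl : forall p, ~ D p -> Inv p /\
  forall e, 0 < e -> exists2 z, pgood z & normc (z - p) < e.
Hypothesis T_pow : forall m v lam, X v -> iter m T (act lam v) = act lam (iter m T v).
Hypothesis D_bounded : exists B : R, forall z, D z -> normc z <= B.
Hypothesis winding : forall z, D z -> forall w : V,
  \sum_(k < n) integ (a k) (b k) (fun t => act (dg k t / (g k t - z)) w) =
  act (Complex 0 (2 * pi)) w.

Lemma resolvent_near p : ~ D p -> exists2 d, 0 < d & exists2 M, 0 < M &
  forall z, normc (z - p) < d -> pgood z /\ forall u, `|S z u| <= M * `|u|.
Proof.
move=> /D_compl[hp near_p]; have [M M0 HM] := bl_bound (resolvent_bl hp).
have e0 : 0 < (16 * M)^-1 by rewrite invr_gt0 mulr_gt0.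
have [z gz zp] := near_p _ e0; exists (16 * M)^-1 => //; exists (2 * (2 * M)).
  by rewrite !mulr_gt0.
have l1 w : normc w < (16 * M)^-1 -> 16 * M * normc w < 1.
  by move=> h; rewrite mulrC -ltr_pdivlMr ?mulr_gt0// div1r.
have M20 : 0 < 2 * M by rewrite mulr_gt0.
have zp1 := l1 _ zp.
have nz0 : 0 <= M * normc (z - p) by rewrite mulr_ge0 ?normc_ge0 ?ltW.
have [hz bz] : Inv z /\ forall u, `|S z u| <= 2 * M * `|u|.
  apply: (resolvent_bound_near jD jZ norm_act HT hp HM M0); nra.
move=> w wp; have wp1 := l1 _ wp.
have nw : M * normc (w - z) <= M * normc (w - p) + M * normc (z - p).
  rewrite -mulrDr ler_wpM2l ?(ltW M0)// [normc (z - p)]normc_sub.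
  have -> : w - z = (w - p) + (p - z) by ring.
  exact: normc_triangle.
have cond : 2 * (2 * M) * normc (w - z) < 1 by nra.
split; first exact: (pgood_near jD jZ jj norm_act HT gz bz M20 cond).
by have [] := resolvent_bound_near jD jZ norm_act HT hz bz M20 cond.
Qed.

Lemma resolvent_continuous k t w : a k <= t <= b k ->
  {for t, continuous (fun u => S (g k u) w)}.
Proof.
move=> ht; have [d d0 [M M0 H]] := resolvent_near (g_off ht).
have cg := cderiv_cc (g_deriv k t).
apply/cvgrPdist_le => e e0.
have c0 : 0 < M ^+ 2 * `|w| + 1 by rewrite ltr_wpDl// mulr_ge0// sqr_ge0.
have m0 : 0 < Num.min (d / 2) (e / (M ^+ 2 * `|w| + 1)) by rewrite lt_min !divr_gt0.
apply: filterS (cc_near cg m0) => u; rewrite le_min => /andP[u1 u2].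
have [] := H (g k t); first by rewrite subrr Normc.normc0.
have [] := H (g k u); first by apply: (le_lt_trans u1); lra.
move=> [hu _] bu [ht' _] bt /=; rewrite distrC.
apply: (le_trans (resolvent_lipschitz norm_act w ht' hu bt bu (ltW M0))).
rewrite mulrAC mulrC; apply: (@le_trans _ _ (normc (g k u - g k t) * (M ^+ 2 * `|w| + 1))).
  by rewrite ler_wpM2l ?normc_ge0// lerDl.
by rewrite -ler_pdivlMr.
Qed.

Definition kernel k (w : V) (t : R) : V := act (dg k t) (S (g k t) w).

Lemma kernel_cont k w : cont_on (kernel k w) (a k) (b k).
Proof.
by move=> t ht; apply: (act_continuous jD jZ norm_act); [exact: dg_cont|exact: resolvent_continuous].
Qed.

Lemma act_kernel_ucont k w (q : R -> C) : (forall t, a k <= t <= b k -> cc q t) ->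
  ucont (fun t => act (q t) (kernel k w t)) (a k) (b k).
Proof.
move=> cq; apply: ucont_cont => t ht.
by apply: (act_continuous jD jZ norm_act); [exact: cq|exact: kernel_cont].
Qed.

Lemma resolvent_uniform_bound k : exists2 M : R, 0 <= M & forall t, a k <= t <= b k ->
  forall u, `|S (g k t) u| <= M * `|u|.
Proof.
have [|t ht|N HN] := @segment_uniform R (a k) (b k)
    (fun N t => forall u, `|S (g k t) u| <= N%:R * `|u|).
- by move=> m m' x mm H u; rewrite (le_trans (H u))// ler_wpM2r// ler_nat.
- have [d d0 [M M0 H]] := resolvent_near (g_off ht).
  have d20 : 0 < d / 2 by rewrite divr_gt0.
  have /nbhs_normP[d' d'0 Hd] := cc_near (cderiv_cc (g_deriv k t)) d20.
  exists (Num.bound M), d' => // u _ ut v.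
  have [|_ /(_ v)/le_trans] := H (g k u).
    by have := Hd u; rewrite /= distrC => /(_ ut) h; apply: (le_lt_trans h); lra.
  by apply; rewrite ler_wpM2r// ltW// archi_boundP// ltW.
by exists N%:R.
Qed.

Definition spectral_int (w : V) : V := \sum_(k < n) integ (a k) (b k) (kernel k w).

Lemma spectral_int_bl : bdd_lin spectral_int.
Proof.
have Sbl k t : a k <= t <= b k -> bdd_lin (S (g k t)).
  by move=> ht; have [/resolvent_bl] := D_compl (g_off ht).
split=> [x y|].
  rewrite /spectral_int -big_split; apply: eq_bigr => k _ /=.
  rewrite -integD; try exact: ltW; try (apply: ucont_cont; exact: kernel_cont).
  apply: integ_ext; [exact: ltW|apply: ucont_cont; exact: kernel_cont|].
  by move=> t ht; rewrite /kernel (blD (Sbl k t ht)) (actDr jD).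
split=> [r x|].
  rewrite /spectral_int scaler_sumr; apply: eq_bigr => k _.
  rewrite -[RHS](act_real j) -(integ_act jD jZ norm_act); try exact: ltW; last first.
    by apply: ucont_cont; exact: kernel_cont.
  apply: integ_ext; [exact: ltW|apply: ucont_cont; exact: kernel_cont|].
  by move=> t ht; rewrite /kernel (blZ (Sbl k t ht)) act_real (actZr jZ).
have H k : exists M : R, forall x, `|integ (a k) (b k) (kernel k x)| <= M * `|x|.
  have [M M0 HM] := resolvent_uniform_bound k.
  have [G G0 HG] := cc_bound (fun t (_ : a k <= t <= b k) => dg_cont k t).
  exists (G * M * (b k - a k)).
  move=> x; rewrite mulrAC; apply: integ_bound; first exact: ltW.
    by apply: ucont_cont; exact: kernel_cont.
  move=> t ht; rewrite /kernel norm_act -mulrA ler_pM ?normc_ge0 ?HG ?HM//.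
have [M HM] := choice H.
exists (\sum_(k < n) M k) => x; rewrite mulr_suml.
rewrite (le_trans (ler_norm_sum _ _ _))//; apply: ler_sum => k _.
exact: HM.
Qed.

Lemma spectral_int_act u lam : (forall k t, a k <= t <= b k ->
    S (g k t) (act lam u) = act lam (S (g k t) u)) ->
  spectral_int (act lam u) = act lam (spectral_int u).
Proof.
move=> H; rewrite /spectral_int (act_sum jD jZ); apply: eq_bigr => k _.
rewrite -(integ_act jD jZ norm_act); try exact: ltW; last first.
  by apply: ucont_cont; exact: kernel_cont.
apply: integ_ext; [exact: ltW|apply: ucont_cont; exact: kernel_cont|].
by move=> t ht; rewrite /kernel H// (actC jD jZ jj).
Qed.

Lemma curve_pgood k t : a k <= t <= b k -> pgood (g k t).
Proof.
move=> ht; have [d d0 [M M0 H]] := resolvent_near (g_off ht).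
by have [] := H (g k t); first by rewrite subrr Normc.normc0.
Qed.

Definition cauchy_int (v : V) (z : C) : V :=
  \sum_(k < n) integ (a k) (b k) (fun t => act (g k t - z)^-1 (kernel k v t)).

Definition defect (y : V) : V := act (Complex 0 (2 * pi)) y - spectral_int y.

Lemma defect_bl : bdd_lin defect.
Proof.
have bP := spectral_int_bl; have [M M0 HM] := bl_bound bP.
split=> [x y|]; first by rewrite /defect (actDr jD) (blD bP); lmod.
split=> [r x|]; first by rewrite /defect (actZr jZ) (blZ bP) scalerBr.
exists (normc (Complex 0 (2 * pi) : C) + M) => x; rewrite mulrDl (le_trans (ler_normB _ _))//.
by rewrite lerD// norm_act.
Qed.

Lemma cauchy_int_defect v z : X v -> D z -> pgood z -> cauchy_int v z = defect (S z v).
Proof.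
move=> Xv Dz gz; rewrite /defect -(winding Dz) /spectral_int -sumrB; apply: eq_bigr => k _.
have akb := ltW (ab k).
have ne t : a k <= t <= b k -> g k t - z != 0.
  by move=> ht; rewrite subr_eq0; apply/eqP => E; apply: (g_off ht); rewrite E.
have cinv t : a k <= t <= b k -> cc (fun t => (g k t - z)^-1) t.
  move=> ht; apply: (@ccV R (fun t => g k t - z)); first exact: ne.
  by apply: ccD; [exact: cderiv_cc (g_deriv k t)|exact: cc_cst].
have U1 : ucont (fun t => act (g k t - z)^-1 (kernel k v t)) (a k) (b k).
  exact: act_kernel_ucont.
have U2 : ucont (kernel k (S z v)) (a k) (b k) by apply: ucont_cont; exact: kernel_cont.
apply/eqP; rewrite eq_sym subr_eq -integD//; apply/eqP; apply: integ_ext => //.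
  apply: ucont_cont => t ht; apply: (act_continuous jD jZ norm_act); last exact: cst_continuous.
  by apply: ccM; [exact: dg_cont|exact: cinv].
move=> t ht; rewrite /kernel (resolvent_quotient jD jZ jj gz (curve_pgood ht) Xv).
  rewrite -!(actM jD jZ jj) (actDr jD) (actNr jZ) [_^-1 * dg k t]mulrC.
  by rewrite addrCA subrr addr0.
by rewrite -subr_eq0 ne.
Qed.

Lemma spectral_int_id v : X v -> spectral_int v = act (Complex 0 (2 * pi)) v.
Proof.
move=> Xv; have bA := defect_bl; have [CA CA0 HA] := bl_bound bA.
have [tau tau0 Ht] := bl_bound HT; have [B HB] := D_bounded.
pose phi z := if pselect (D z) then cauchy_int v z else defect (S z v).
have far z : Num.max B tau < normc z -> ~ D z /\ `|S z v| <= `|v| / (normc z - tau).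
  rewrite gt_max => /andP[zB zt]; have nD : ~ D z by move=> /HB; rewrite leNgt zB.
  by split=> //; have [hz _] := D_compl nD; exact: (resolvent_far norm_act).
have small c e : 0 <= c -> 0 < e -> exists2 r, Num.max B tau < r &
    forall x, r <= x -> c / (x - tau) <= e.
  move=> c0 e0; exists (Num.max (Num.max B tau) (tau + c / e) + 1).
    by rewrite ltr_pwDr// le_max lexx.
  move=> x xr; have h : tau + c / e + 1 <= x.
    by apply: le_trans xr; rewrite lerD2r le_max lexx orbT.
  have ce : 0 <= c / e by rewrite divr_ge0// ltW.
  rewrite ler_pdivrMr; last by lra.
  by rewrite mulrC -ler_pdivrMr//; lra.
have phi0 : forall z, phi z = 0.
  apply: (liouville jD jZ jj norm_act) => [p|e e0].
    have [Dp|nDp] := pselect (D p).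
      have [d d0 Hd] := D_open Dp.
      apply: (@hol_near _ _ _ phi (cauchy_int v) p d d0).
        by move=> z zp; rewrite /phi; case: pselect => // nD; case: (nD (Hd z zp)).
      apply: (hol_sum jD jZ) => k.
      apply: (hol_cauchy_transform jD jZ jj norm_act (ltW (ab k)) _ _ d0) => t ht.
      - exact: cderiv_cc (g_deriv k t).
      - exact: kernel_cont.
      - by rewrite leNgt; apply/negP => /Hd; exact: g_off.
    have [d d0 [M M0 H]] := resolvent_near nDp.
    apply: (@hol_near _ _ _ phi (fun z => defect (S z v)) p d d0).
      move=> z zp; rewrite /phi; case: pselect => // Dz.
      by apply: cauchy_int_defect => //; have [] := H z zp.
    apply: (hol_resolvent jD jZ jj norm_act d0 (ltW M0) Xv bA) => z /H[gz bz]; split=> // lam.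
    rewrite /defect (actC jD jZ jj) spectral_int_act ?(actDr jD) ?(actNr jZ)// => k t ht.
    exact: (resolvent3_act jD jZ jj lam gz (curve_pgood ht) Xv).
  have c0 : 0 <= CA * `|v| by rewrite mulr_ge0// ltW.
  have [r rm rP] := small _ _ c0 e0; exists r => z rz.
  have [nD Sz] := far z (lt_le_trans rm rz); rewrite /phi; case: pselect => // ?.
  apply: (le_trans (HA _)); apply: (le_trans _ (rP _ rz)).
  by rewrite -mulrA ler_wpM2l// ltW.
apply/eqP; rewrite eq_sym -subr_eq0 -normr_le0; apply/ler_addgt0Pr => e e0; rewrite add0r.
have c0 : 0 <= CA * (tau * `|v|) by rewrite !mulr_ge0// ltW.
have [r rm rP] := small _ _ c0 e0.
have rt0 : 0 <= r by apply/ltW; apply: lt_trans rm; rewrite lt_max tau0 orbT.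
pose z : C := r%:C%C; have nz : normc z = r by rewrite normc_real ger0_norm.
have [nD Sz] := far z (lt_le_trans rm (eq_ind_r (fun x => r <= x) (lexx r) nz)).
have A0 : defect (S z v) = 0 by have := phi0 z; rewrite /phi; case: pselect.
have [hz _] := D_compl nD.
have := resolventK v hz; rewrite /pencil act_real => /eqP; rewrite subr_eq => /eqP E.
have := congr1 defect E; rewrite (blZ bA) (blD bA) A0 scaler0 => /esym/eqP.
rewrite addr_eq0 -/(defect v) => /eqP ->; rewrite normrN.
apply: (le_trans (HA _)); apply: le_trans (rP r (lexx r)).
rewrite -mulrA ler_wpM2l ?(ltW CA0)// (le_trans (Ht _))// -mulrA ler_wpM2l ?(ltW tau0)//.
by rewrite -nz.
Qed.

Lemma pgood_T_act z v lam : pgood z -> X v -> T (act lam (S z v)) = act lam (T (S z v)).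
Proof.
move=> gz Xv; have [hz _] := gz.
have TS u : T (S z u) = act z (S z u) - u.
  by have := resolventK u hz; rewrite /pencil => /eqP; rewrite subr_eq addrC -subr_eq => /eqP ->.
rewrite -(resolvent_act _ gz Xv) !TS (resolvent_act _ gz Xv) (actDr jD) (actNr jZ).
by rewrite (actC jD jZ jj).
Qed.

Lemma spectral_int_power m v : X v ->
  \sum_(k < n) integ (a k) (b k) (fun t => act (g k t ^+ m) (kernel k v t)) =
  act (Complex 0 (2 * pi)) (iter m T v).
Proof.
move=> Xv; elim: m => [|m IH].
  rewrite -spectral_int_id//; apply: eq_bigr => k _.
  have akb := ltW (ab k).
  apply: integ_ext => //; first by apply: act_kernel_ucont => t ht; exact: cc_cst.
  by move=> t _; rewrite expr0 act1.
have cX k t : cc (fun t => g k t ^+ m) t by apply: ccX; exact: cderiv_cc (g_deriv k t).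
have [tau tau0 Ht] := bl_bound HT.
have eT k : integ (a k) (b k) (fun t => act (g k t ^+ m.+1) (kernel k v t)) =
    T (integ (a k) (b k) (fun t => act (g k t ^+ m) (kernel k v t))).
  have akb := ltW (ab k).
  have U1 : ucont (fun t => act (g k t ^+ m) (kernel k v t)) (a k) (b k).
    by apply: act_kernel_ucont => t _.
  have cD t : cc (fun t => dg k t * g k t ^+ m) t by apply: ccM.
  have U2 : ucont (fun t => act (dg k t * g k t ^+ m) v) (a k) (b k).
    apply: ucont_cont => t _; apply: (act_continuous jD jZ norm_act) => //.
    exact: cst_continuous.
  rewrite -(integ_map (blD HT) (blZ HT) (ltW tau0) Ht)//.
  have -> : integ (a k) (b k) (fun t => T (act (g k t ^+ m) (kernel k v t))) =
     integ (a k) (b k) (fun t => T (act (g k t ^+ m) (kernel k v t))) +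
     integ (a k) (b k) (fun t => act (dg k t * g k t ^+ m) v).
    pose q : R -> C := fun t => g k t ^+ m.+1 / m.+1%:R.
    have m1 : m.+1%:R != 0 :> C by rewrite pnatr_eq0.
    have dX t p : cderiv (fun t => g k t ^+ p.+1) (p.+1%:R * (dg k t * g k t ^+ p)) t.
      elim: p => [|p IHp].
        by rewrite mul1r expr0 mulr1 (_ : (fun t => g k t ^+ 1) = g k)//; apply/funext => x; rewrite expr1.
      have := cderivM (g_deriv k t) IHp; rewrite (_ : (fun u => _) = fun t => g k t ^+ p.+2).
        by rewrite (_ : _ + _ = p.+2%:R * (dg k t * g k t ^+ p.+1))// -[p.+2%:R]natr1 exprS; ring.
      by apply/funext => x; rewrite [RHS]exprS.
    have dq t : cderiv q (dg k t * g k t ^+ m) t.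
      have := cderivM (dX t m) (cderiv_cst (m.+1%:R^-1 : C) t).
      by rewrite mulr0 addr0 (_ : _ / _ = dg k t * g k t ^+ m)//; field.
    rewrite (integ_exact j v akb (fun t _ => dq t) (fun t _ => cD t)).
    by rewrite /q g_closed subrr act0 addr0.
  have UT : ucont (fun t => T (act (g k t ^+ m) (kernel k v t))) (a k) (b k).
    move=> e e0; have e10 : 0 < e / tau by rewrite divr_gt0.
    have [d d0 Hd] := U1 _ e10; exists d => // t u h1 h2 h3.
    rewrite -(blB HT) (le_trans (Ht _))// mulrC -ler_pdivlMr//; exact: Hd.
  rewrite -integD//; apply: integ_ext => //.
    by apply: act_kernel_ucont => t _; apply: ccX; exact: cderiv_cc (g_deriv k t).
  move=> t ht; have gt := curve_pgood ht; have [hz _] := gt.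
  rewrite /kernel -!(actM jD jZ jj) (pgood_T_act _ gt Xv).
  have := resolventK v hz; rewrite /pencil => /eqP; rewrite subr_eq addrC => /eqP h.
  rewrite [dg k t * _]mulrC -(actDr jD) -h exprSr -!(actM jD jZ jj); congr (act _ _); ring.
under eq_bigr do rewrite eT.
have -> : \sum_(k < n) T (integ (a k) (b k) (fun t => act (g k t ^+ m) (kernel k v t))) =
   T (\sum_(k < n) integ (a k) (b k) (fun t => act (g k t ^+ m) (kernel k v t))).
  by elim/big_rec2: _ => [|k x y _ ->]; rewrite ?(bl0 HT)// (blD HT).
by rewrite IH -T_pow// -iterS T_pow.
Qed.
End DixonArgument.

(** * Turning numbers of Jordan curves *)

Section Curves.
Variable R : realType.
Local Notation C := R[i].
Implicit Types (c : pcurve R) (p : R * R) (t : R).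

Local Notation rint := (integ (W := R^o)).

Definition toC p : C := Complex p.1 p.2.
Definition gam c t : C := Complex (cx c t) (cy c t).
Definition dgam c t : C := Complex ((derive1 (cx c)) t) ((derive1 (cy c)) t).

Local Notation dangle c z := (fun t => Im (dgam c t / (gam c t - z))).

Lemma gam_deriv c t : C1_jordan c -> cderiv (gam c) (dgam c t) t.
Proof.
move=> [_ [dx [dy _]]]; split; rewrite /= derive1E; exact: DeriveDef.
Qed.

Lemma gam_cc c t : C1_jordan c -> cc (gam c) t.
Proof. by move=> /gam_deriv/cderiv_cc. Qed.

Lemma dgam_cc c t : C1_jordan c -> cc (dgam c) t.
Proof. by move=> [_ [_ [_ [c1 [c2 _]]]]]; split; [exact: c1|exact: c2]. Qed.

Lemma gam_closed c : C1_jordan c -> gam c (ca c) = gam c (cb c).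
Proof. by move=> [_ [_ [_ [_ [_ [h1 [h2 _]]]]]]]; rewrite /gam h1 h2. Qed.

Lemma wind_integrandE c p t : wind_integrand c p t = Im (dgam c t / (gam c t - toC p)).
Proof.
rewrite /wind_integrand cImM cReV cImV !cReD !cImD !cReN !cImN /=; ring.
Qed.

Lemma curve_away (g : R -> C) (a b : R) z : (forall t, a <= t <= b -> cc g t) ->
  (forall t, a <= t <= b -> g t != z) ->
  exists2 eta : R, 0 < eta & forall t, a <= t <= b -> eta <= normc (g t - z).
Proof.
move=> cg ne.
have [|t ht|N HN] := @segment_uniform R a b (fun N t => N.+1%:R^-1 <= normc (g t - z)).
- by move=> n m x nm; apply: le_trans; rewrite lef_pV2 ?posrE// ler_nat.
- have n0 : 0 < normc (g t - z) by rewrite normc_gt0 subr_eq0 ne.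
  have n20 : 0 < normc (g t - z) / 2 by rewrite divr_gt0.
  have /nbhs_normP[d d0 Hd] := cc_near (cg t ht) n20.
  have [N HN] := small_inv n20; exists N, d => // u _ ut.
  have := Hd u; rewrite /= distrC normc_sub => /(_ ut) h.
  apply: (le_trans (ltW HN)); have := normcBl (g t - z) (g t - g u).
  have -> : g t - z - (g t - g u) = g u - z by ring.
  by apply: le_trans; lra.
by exists N.+1%:R^-1.
Qed.

Lemma integ_Im_exact (f df : R -> C) (a b : R) : a <= b ->
  (forall t, a <= t <= b -> cderiv f (df t) t) -> (forall t, a <= t <= b -> cc df t) ->
  rint a b (fun t => Im (df t)) = Im (f b) - Im (f a).
Proof.
move=> ab D cdf; apply: (@integE R R^o _ (fun t => Im (f t))) => //.
apply: prim_C1; first by move=> t /D[].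
by apply: (@ucont_cont R R^o) => t /cdf[].
Qed.

Lemma Im_cont (f : R -> C) (a b : R) : (forall t, a <= t <= b -> cc f t) ->
  ucont (W := R^o) (fun t => Im (f t)) a b.
Proof. by move=> cf; apply: (@ucont_cont R R^o) => t /cf[]. Qed.

Lemma integ_ImD (f g : R -> C) (a b : R) : a <= b -> (forall t, a <= t <= b -> cc f t) ->
  (forall t, a <= t <= b -> cc g t) ->
  rint a b (fun t => Im (f t + g t)) =
  rint a b (fun t => Im (f t)) + rint a b (fun t => Im (g t)).
Proof.
move=> ab cf cg; rewrite -(@integD _ R^o)//; try exact: Im_cont.
apply: (@integ_ext _ R^o) => //; last by move=> t _; rewrite cImD.
by apply: (Im_cont (f := fun t => f t + g t)) => t ht; apply: ccD; [exact: cf|exact: cg].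
Qed.

Lemma cauchy_kernel_cc c z (a b : R) : C1_jordan c ->
  (forall t, a <= t <= b -> gam c t != z) ->
  forall t, a <= t <= b -> cc (fun t => (gam c t - z)^-1) t.
Proof.
move=> Hc ne t ht; apply: (@ccV R (fun t => gam c t - z)); first by rewrite subr_eq0 ne.
by apply: ccD; [exact: gam_cc|exact: cc_cst].
Qed.

Lemma kernel_cc c z (a b : R) : C1_jordan c -> (forall t, a <= t <= b -> gam c t != z) ->
  forall t, a <= t <= b -> cc (fun t => dgam c t / (gam c t - z)) t.
Proof. by move=> Hc ne t ht; apply: ccM; [exact: dgam_cc|exact: (cauchy_kernel_cc Hc ne ht)]. Qed.

Definition turning c (z : C) : R := rint (ca c) (cb c) (dangle c z).

Lemma turning_rint c p w : C1_jordan c ->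
  (forall t, ca c <= t <= cb c -> gam c t != toC p) ->
  is_rint (wind_integrand c p) (ca c) (cb c) w -> w = turning c (toC p).
Proof.
move=> Hc ne I; have ab : ca c < cb c by case: Hc.
have U := Im_cont (kernel_cc Hc ne).
have [G P E] := @integ_prim R R^o _ _ _ (ltW ab) U.
rewrite /turning E; apply: (rint_unique ab _ I).
by apply: prim_ext P => t _; rewrite wind_integrandE.
Qed.

(* The linear term in [h] is the integral of the exact form d(-h / (zeta - z)), hence vanishes. *)
Lemma turning_quadratic c (p : C) (d0 : R) : C1_jordan c -> 0 < d0 ->
  (forall t, ca c <= t <= cb c -> d0 <= normc (gam c t - p)) ->
  exists K : R, forall z h, normc (z - p) <= d0 / 4 -> normc (z + h - p) <= d0 / 4 ->
    `|turning c (z + h) - turning c z| <= K * normc h ^+ 2.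
Proof.
move=> Hc d00 far; have ab : ca c < cb c by case: Hc.
have [G G0 HG] := cc_bound (fun t (_ : ca c <= t <= cb c) => dgam_cc t Hc).
pose r := d0 / 2; have r0 : 0 < r by rewrite divr_gt0.
have far1 z t : normc (z - p) <= d0 / 4 -> ca c <= t <= cb c -> r <= normc (gam c t - z).
  move=> zp /far h; have := normcBl (gam c t - p) (z - p).
  have -> : gam c t - p - (z - p) = gam c t - z by ring.
  by apply: le_trans; rewrite /r; lra.
have ne z : normc (z - p) <= d0 / 4 -> forall t, ca c <= t <= cb c -> gam c t != z.
  by move=> zp t ht; rewrite -subr_eq0 -normc_gt0; apply: lt_le_trans (far1 z t zp ht).
exists (G * r^-1 ^+ 3 * (cb c - ca c)) => z h zp zhp.
have ci z' (zp' : normc (z' - p) <= d0 / 4) t ht := @cauchy_kernel_cc c z' _ _ Hc (ne z' zp') t ht.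
pose q1 t := (gam c t - (z + h))^-1; pose q2 t := (gam c t - z)^-1.
pose e2 t := h * (dgam c t * q2 t ^+ 2).
pose e3 t := dgam c t * (h ^+ 2 * (q2 t ^+ 2 * q1 t)).
have c2 t : ca c <= t <= cb c -> cc (fun t => q2 t ^+ 2) t by move=> ht; apply: ccX; exact: ci.
have ce2 t : ca c <= t <= cb c -> cc e2 t.
  move=> ht; apply: ccM; first exact: cc_cst.
  by apply: ccM; [exact: dgam_cc|exact: c2].
have ce3 t : ca c <= t <= cb c -> cc e3 t.
  move=> ht; apply: ccM; first exact: dgam_cc.
  by apply: ccM; [exact: cc_cst|apply: ccM; [exact: c2|exact: ci]].
have ce1 t : ca c <= t <= cb c -> cc (fun t => dgam c t / (gam c t - z)) t.
  exact: (kernel_cc Hc (ne z zp)).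
have e20 : rint (ca c) (cb c) (fun t => Im (e2 t)) = 0.
  rewrite (@integ_Im_exact (fun t => - h * q2 t) e2)//; last 2 first.
  - exact: ltW.
  - move=> t ht; have n0 : gam c t - z != 0 by rewrite subr_eq0 ne.
    have d1 : cderiv (fun t => gam c t - z) (dgam c t) t.
      by have := cderivD (gam_deriv t Hc) (cderiv_cst (- z) t); rewrite addr0.
    have := cderivM (cderiv_cst (- h) t) (cderivV n0 d1).
    by rewrite (_ : _ + _ = e2 t)// /e2 /q2; field.
  by rewrite /q2 gam_closed// subrr.
have ce23 t : ca c <= t <= cb c -> cc (fun t => e2 t + e3 t) t.
  by move=> ht; apply: ccD; [exact: ce2|exact: ce3].
have ce123 t : ca c <= t <= cb c -> cc (fun t => dgam c t / (gam c t - z) + (e2 t + e3 t)) t.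
  by move=> ht; apply: ccD; [exact: ce1|exact: ce23].
have -> : turning c (z + h) = turning c z + rint (ca c) (cb c) (fun t => Im (e3 t)).
  have h1 := integ_ImD (ltW ab) ce2 ce3; rewrite e20 add0r in h1.
  rewrite -h1 -(integ_ImD (ltW ab) ce1 ce23).
  apply/esym; apply: (@integ_ext _ R^o); [exact: ltW|exact: Im_cont|move=> t ht; congr Im].
  have n1 := ne _ zp t ht; have n2 := ne _ zhp t ht; rewrite -subr_eq0 in n1; rewrite -subr_eq0 in n2.
  rewrite /e2 /e3 /q1 /q2; have e0 : gam c t - (z + h) = gam c t - z - h by ring.
  rewrite e0 in n2 *; move: (gam c t - z) n1 n2 => x n1 n2.
  by field; rewrite n1 n2.
rewrite addrAC subrr add0r.
have -> : G * r^-1 ^+ 3 * (cb c - ca c) * normc h ^+ 2 =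
  G * (normc h ^+ 2 * (r^-1 ^+ 2 * r^-1)) * (cb c - ca c) by ring.
apply: (@integ_bound _ R^o); [exact: ltW|exact: Im_cont|move=> t ht].
have ninv z' : normc (z' - p) <= d0 / 4 -> normc (gam c t - z')^-1 <= r^-1.
  move=> zp'; have h1 := far1 z' t zp' ht.
  by rewrite Normc.normcV lef_pV2 ?posrE//; exact: lt_le_trans h1.
apply: (le_trans (normc_Im _)); rewrite /e3 !Normc.normcM ler_pM ?mulr_ge0 ?normc_ge0 ?HG//.
rewrite -expr2 ler_wpM2l ?sqr_ge0// ler_pM ?mulr_ge0 ?normc_ge0 ?ninv//.
by rewrite expr2 ler_pM ?normc_ge0 ?ninv.
Qed.

Lemma turning_far c (z : C) (B G : R) : C1_jordan c ->
  (forall t, ca c <= t <= cb c -> normc (gam c t) <= B) ->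
  (forall t, ca c <= t <= cb c -> normc (dgam c t) <= G) -> 0 <= G ->
  B < normc z -> `|turning c z| <= G / (normc z - B) * (cb c - ca c).
Proof.
move=> Hc HB HG G0 Bz; have ab : ca c < cb c by case: Hc.
have p0 : 0 < normc z - B by rewrite subr_gt0.
have far t : ca c <= t <= cb c -> normc z - B <= normc (gam c t - z).
  move=> /HB h; rewrite normc_sub; apply: (le_trans _ (normcBl _ _)); lra.
have ne t : ca c <= t <= cb c -> gam c t != z.
  by move=> /far h; rewrite -subr_eq0 -normc_gt0; apply: lt_le_trans h.
apply: (@integ_bound _ R^o); [exact: ltW|exact: (Im_cont (kernel_cc Hc ne))|move=> t ht].
apply: (le_trans (normc_Im _)); rewrite Normc.normcM ler_pM ?normc_ge0 ?HG//.
rewrite Normc.normcV lef_pV2 ?posrE ?far//; exact: lt_le_trans (far t ht).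
Qed.

Lemma log_derivative (f : R -> C) df t : cderiv f df t -> f t != 0 ->
  is_derive t 1 (fun u => ln (Re (f u) ^+ 2 + Im (f u) ^+ 2) / 2) (Re (df / f t)).
Proof.
move=> [f1 f2] f0; have n0 := cnorm2_neq0 f0.
have N0 : 0 < Re (f t) ^+ 2 + Im (f t) ^+ 2 by rewrite lt_neqAle eq_sym n0 addr_ge0 ?sqr_ge0.
have dN : is_derive t 1 (fun u => Re (f u) ^+ 2 + Im (f u) ^+ 2)
    (2 * (Re (f t) * Re df + Im (f t) * Im df)).
  rewrite (_ : (fun u => _) = (fun u => Re (f u)) * (fun u => Re (f u)) + (fun u => Im (f u)) * (fun u => Im (f u))).
    apply: (is_derive_eq (is_deriveD (is_deriveM f1 f1) (is_deriveM f2 f2))); rewrite /GRing.scale /=.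
    by move: (Re (f t)) (Im (f t)) (Re df) (Im df) => *; ring.
  by apply/funext => u; rewrite !expr2.
pose N u := Re (f u) ^+ 2 + Im (f u) ^+ 2.
have dL := @is_derive1_comp R (@ln R) N t _ _ (is_derive1_ln N0) dN.
rewrite (_ : (fun u => _) = 2^-1 *: (@ln R \o N)).
  apply: (is_derive_eq (is_deriveZ 2^-1 dL)); rewrite cReM cReV cImV /GRing.scale /=.
  by move: n0; move: (Re (f t)) (Im (f t)) (Re df) (Im df) => a b x y n0; field.
by apply/funext => u; rewrite /= mulrC /N.
Qed.

Lemma integ_log c z : C1_jordan c -> (forall t, ca c <= t <= cb c -> gam c t != z) ->
  rint (ca c) (cb c) (fun t => Re (dgam c t / (gam c t - z))) = 0.
Proof.
move=> Hc ne; have ab : ca c < cb c by case: Hc.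
have U : ucont (W := R^o) (fun t => Re (dgam c t / (gam c t - z))) (ca c) (cb c).
  by apply: (@ucont_cont R R^o) => t ht; case: (kernel_cc Hc ne ht).
have P : primitive (W := R^o) (fun t => Re (dgam c t / (gam c t - z)))
    (fun u => ln (Re (gam c u - z) ^+ 2 + Im (gam c u - z) ^+ 2) / 2) (ca c) (cb c).
  apply: prim_C1 => // t ht; apply: (log_derivative (f := fun t => gam c t - z)).
    by have := cderivD (gam_deriv t Hc) (cderiv_cst (- z) t); rewrite addr0.
  by rewrite subr_eq0 ne.
by rewrite (@integE _ R^o _ _ _ _ (ltW ab) P) gam_closed// subrr.
Qed.

Lemma integ_act_turning (V : completeNormedModType R) (j : V -> V) c z v :
  C1_jordan c -> (forall t, ca c <= t <= cb c -> gam c t != z) ->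
  integ (ca c) (cb c) (fun t => act j (dgam c t / (gam c t - z)) v) =
  act j (Complex 0 (turning c z)) v.
Proof.
move=> Hc ne; have ab : ca c < cb c by case: Hc.
have UI := Im_cont (kernel_cc Hc ne).
have UR : ucont (W := R^o) (fun t => Re (dgam c t / (gam c t - z))) (ca c) (cb c).
  by apply: (@ucont_cont R R^o) => t ht; case: (kernel_cc Hc ne ht).
have sc (q : R -> R^o) (w : V) : ucont (W := R^o) q (ca c) (cb c) ->
    integ (ca c) (cb c) (fun t => q t *: w) = rint (ca c) (cb c) q *: w.
  move=> U; apply: (@integ_map R R^o V (fun x : R^o => x *: w) `|w|) => //; try exact: ltW.
  - by move=> x y; rewrite scalerDl.
  - by move=> r x; rewrite scalerA.
  - by move=> x; rewrite normrZ mulrC.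
have Usc (q : R -> R^o) (w : V) : ucont (W := R^o) q (ca c) (cb c) ->
    ucont (fun t => q t *: w) (ca c) (cb c).
  move=> U e e0; have e10 : 0 < e / (`|w| + 1) by rewrite divr_gt0// ltr_wpDl.
  have [d d0 Hd] := U _ e10; exists d => // t u h1 h2 h3.
  rewrite -scalerBl normrZ; apply: (@le_trans _ _ (`|q t - q u| * (`|w| + 1))).
    by rewrite ler_wpM2l// lerDl.
  by rewrite -ler_pdivlMr ?ltr_wpDl//; exact: Hd.
rewrite /act /= integD ?(ltW ab)//; try exact: Usc.
by rewrite !sc// integ_log// /turning.
Qed.
End Curves.

Section Turning.
Variable R : realType.
Local Notation C := R[i].
Local Notation rint := (integ (W := R^o)).
Local Notation dangle c z := (fun t => Im (dgam c t / (gam c t - z))).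
Implicit Types (c : pcurve R) (p q : R * R).

Lemma nbhs_toC p (A : set (R * R)) :
  nbhs p A <-> exists2 d, 0 < d & forall q, normc (toC q - toC p) < d -> A q.
Proof.
split=> [/nbhs_ballP[d d0 Hd]|[d d0 Hd]].
  exists d => // q qp; apply: Hd; split; rewrite /ball /= distrC.
    by apply: le_lt_trans qp; have := normc_Re (toC q - toC p); rewrite cReD cReN.
  by apply: le_lt_trans qp; have := normc_Im (toC q - toC p); rewrite cImD cImN.
have d20 : 0 < d / 2 by rewrite divr_gt0.
apply/nbhs_ballP; exists (d / 2) => // q [q1 q2]; apply: Hd.
apply: (le_lt_trans (normc_le _)); rewrite cReD cImD cReN cImN [d]splitr.
by rewrite ltrD//= distrC.
Qed.

Lemma turning_locally_constant c (p : C) (d0 : R) : C1_jordan c -> 0 < d0 ->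
  (forall t, ca c <= t <= cb c -> d0 <= normc (gam c t - p)) ->
  forall q : C, normc (q - p) <= d0 / 4 -> turning c q = turning c p.
Proof.
move=> Hc d00 far q qp; have [K HK] := turning_quadratic Hc d00 far.
pose H (s : R) : R^o := turning c (p + s%:C%C * (q - p)).
have inball (s : R) : 0 <= s <= 1 -> normc (p + s%:C%C * (q - p) - p) <= d0 / 4.
  move=> /andP[s0 s1]; rewrite addrAC subrr add0r Normc.normcM normc_real ger0_norm//.
  by apply: le_trans qp; rewrite ler_piMl ?normc_ge0.
have hyp (c0 : R) : 0 < c0 -> `|H 1 - H 0| <= c0 * (1 - 0).
  move=> c00; set k := normc (q - p).
  have l0 : 0 < `|K| * k ^+ 2 + 1 by rewrite ltr_wpDl// mulr_ge0// sqr_ge0.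
  apply: (@chop R R^o H 0 1 c0 (c0 / (`|K| * k ^+ 2 + 1))); rewrite ?ler01 ?divr_gt0//.
  move=> t u t0 tu u1; rewrite ltr_pdivlMr// => small.
  have t01 : 0 <= t <= 1 by rewrite t0 (le_trans tu).
  have u01 : 0 <= u <= 1 by rewrite u1 (le_trans t0).
  have := HK (p + t%:C%C * (q - p)) ((u - t)%:C%C * (q - p)) (inball t t01).
  have -> : p + t%:C%C * (q - p) + (u - t)%:C%C * (q - p) = p + u%:C%C * (q - p).
    by rewrite rmorphB /=; ring.
  move=> /(_ (inball u u01)) h; apply: (le_trans h).
  rewrite Normc.normcM normc_real exprMn -/k ger0_norm ?subr_ge0//.
  have ut : 0 <= u - t by rewrite subr_ge0.
  have k0 : 0 <= k ^+ 2 by rewrite sqr_ge0.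
  have KK := ler_norm K; have h1 : 0 <= (u - t) ^+ 2 by rewrite sqr_ge0.
  apply: (@le_trans _ _ ((u - t) * (`|K| * k ^+ 2 + 1) * (u - t))); last first.
    by rewrite ler_wpM2r// ltW.
  rewrite [leRHS](_ : _ = (u - t) ^+ 2 * (`|K| * k ^+ 2 + 1)); last by ring.
  by rewrite mulrCA ler_wpM2l// (le_trans (ler_wpM2r k0 KK))// lerDl.
have : H 1 = H 0.
  apply/eqP; rewrite -subr_eq0 -normr_le0; apply/ler_addgt0Pr => e e0; rewrite add0r.
  by have := hyp e e0; rewrite subr0 mulr1.
rewrite /H mul1r mul0r addr0 => <-; congr turning; ring.
Qed.

Lemma turning_constant c (D : set (R * R)) : C1_jordan c -> open D -> connected D ->
  (forall t, ca c <= t <= cb c -> ~ D (cx c t, cy c t)) ->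
  forall p q, D p -> D q -> turning c (toC p) = turning c (toC q).
Proof.
move=> Hc oD cD off p q Dp Dq.
have loc r : D r -> \forall s \near r, turning c (toC s) = turning c (toC r).
  move=> Dr; have [|eta eta0 Heta] := @curve_away R (gam c) (ca c) (cb c) (toC r) (fun t _ => gam_cc t Hc).
    by move=> t ht; apply/eqP => E; apply: (off t ht); case: r Dr E => r1 r2 Dr [-> ->].
  apply/nbhs_toC; exists (eta / 4); first by rewrite divr_gt0.
  by move=> s /ltW; exact: turning_locally_constant.
pose O (P : R -> Prop) := [set r | D r /\ P (turning c (toC r))].
have oO P : open (O P).
  rewrite openE => r [Dr Pr]; rewrite /interior.
  apply: filterS (filterI (loc r Dr) (open_nbhs_nbhs (conj oD Dr))).
  by move=> s [E Ds]; split=> //; rewrite E.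
suff E : O (fun x => x = turning c (toC q)) = D by move: Dp; rewrite -E => -[].
apply: cD; first by exists q.
  exists (O (fun x => x = turning c (toC q))); first exact: oO.
  by apply/seteqP; split=> r; [case=> ? ?; split|case].
exists (~` O (fun x => x <> turning c (toC q))); first exact/open_closedC/oO.
apply/seteqP; split=> r; first by move=> [Dr Er]; split=> // -[].
by move=> [Dr nr]; split=> //; apply: contrapT => h; apply: nr.
Qed.

Lemma angle_derivative (f : R -> C) df t : cderiv f df t -> Im (f t) != 0 ->
  is_derive t 1 (fun u => - atan (Re (f u) / Im (f u))) (Im (df / f t)).
Proof.
move=> [f1 f2] n0; pose h := (fun u => Re (f u)) * (fun u => (Im (f u))^-1).
have d1 : is_derive t 1 (fun u => (Im (f u))^-1) (- (Im (f t)) ^- 2 *: Im df) by exact: is_deriveV.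
have d2 := is_deriveM f1 d1.
have d3 := @is_derive1_comp R (@atan R) h t _ _ (is_derive1_atan _) d2.
have hE : h t = Re (f t) / Im (f t) by [].
apply: (is_derive_eq (is_deriveN d3)); rewrite hE cImM cReV cImV /GRing.scale /=.
have N0 : Re (f t) ^+ 2 + Im (f t) ^+ 2 != 0.
  by rewrite gt_eqF// ltr_wpDl ?sqr_ge0// lt_neqAle eq_sym sqrf_eq0 n0 sqr_ge0.
move: n0 N0; move: (Re (f t)) (Im (f t)) (Re df) (Im df) => a b x y n0 N0.
by field; rewrite n0 N0.
Qed.

Lemma integ_cauchy_diff c (z w : C) (a b G eta : R) : C1_jordan c -> a <= b -> 0 < eta ->
  (forall t, a <= t <= b -> [/\ normc (dgam c t) <= G, eta <= normc (gam c t - z) &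
     eta <= normc (gam c t - w)]) ->
  `|rint a b (dangle c z) -
    rint a b (dangle c w)| <=
  G * (normc (z - w) * (eta^-1 * eta^-1)) * (b - a).
Proof.
move=> Hc ab eta0 H.
have ne (y : C) t : eta <= normc (gam c t - y) -> gam c t != y.
  by move=> h; rewrite -subr_eq0 -normc_gt0; exact: lt_le_trans h.
have nz t : a <= t <= b -> gam c t != z by move=> /H[_ h _]; exact: ne.
have nw t : a <= t <= b -> gam c t != w by move=> /H[_ _ h]; exact: ne.
have iz := cauchy_kernel_cc Hc nz; have iw := cauchy_kernel_cc Hc nw.
pose e t := dgam c t * ((z - w) * ((gam c t - z)^-1 * (gam c t - w)^-1)).
have ce t : a <= t <= b -> cc e t.
  move=> ht; apply: ccM; first exact: dgam_cc.
  by apply: ccM; [exact: cc_cst|apply: ccM; [exact: iz|exact: iw]].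
have -> : rint a b (dangle c z) =
    rint a b (dangle c w) +
    rint a b (fun t => Im (e t)).
  rewrite -(integ_ImD ab (kernel_cc Hc nw) ce).
  apply: (@integ_ext _ R^o) => //; first exact: (Im_cont (kernel_cc Hc nz)).
  move=> t ht; congr Im; rewrite /e.
  have := nz t ht; have := nw t ht; rewrite -subr_eq0 -(subr_eq0 _ z) => n1 n2.
  have -> : z - w = (gam c t - w) - (gam c t - z) by ring.
  by move: (gam c t - w) (gam c t - z) n1 n2 => x y n1 n2; field; rewrite n1 n2.
rewrite addrAC subrr add0r.
apply: (@integ_bound _ R^o) => //; first exact: Im_cont.
move=> t ht; have [hG h1 h2] := H t ht.
apply: (le_trans (normc_Im _)); rewrite /e !Normc.normcM ler_pM ?mulr_ge0 ?normc_ge0//.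
rewrite ler_wpM2l ?normc_ge0// ler_pM ?normc_ge0// Normc.normcV lef_pV2 ?posrE//.
  exact: lt_le_trans h1.
exact: lt_le_trans h2.
Qed.

Lemma integ_angle c (z : C) (p q : R) : C1_jordan c -> p <= q ->
  (forall t, p <= t <= q -> Im (gam c t - z) != 0) ->
  rint p q (dangle c z) =
  atan (Re (gam c p - z) / Im (gam c p - z)) - atan (Re (gam c q - z) / Im (gam c q - z)).
Proof.
move=> Hc pq ne.
have U : ucont (W := R^o) (dangle c z) p q.
  apply: (Im_cont (kernel_cc Hc _)) => t /ne; apply: contraNneq => ->.
  by rewrite cImD cImN subrr.
have P : primitive (W := R^o) (dangle c z)
    (fun u => - atan (Re (gam c u - z) / Im (gam c u - z))) p q.
  apply: prim_C1 => // t ht; apply: (angle_derivative (f := fun t => gam c t - z)) (ne t ht).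
  by have := cderivD (gam_deriv t Hc) (cderiv_cst (- z) t); rewrite addr0.
by rewrite (@integE _ R^o _ _ _ _ pq P) opprK addrC.
Qed.

Lemma atan_gap (x y s : R) : x * y < 0 -> 0 < s -> s <= `|x| -> s <= `|y| ->
  pi / 2 <= `|atan (x / s) - atan (y / s)|.
Proof.
move=> xy s0 sx sy.
have key (a : R) : s <= a -> pi / 4 <= atan (a / s).
  by move=> h; rewrite -atan1; apply: le_atan; rewrite ler_pdivlMr// mul1r.
have keyN (a : R) : s <= - a -> atan (a / s) <= - (pi / 4).
  by move=> h; rewrite -[a]opprK mulNr atanN lerN2; exact: key.
have [x0|x0|x0] := ltrgtP x 0.
- have y0 : 0 < y by rewrite nmulr_rlt0 in xy.
  rewrite ltr0_norm// in sx; rewrite gtr0_norm// in sy.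
  rewrite distrC; apply: le_trans (ler_norm _); have := key _ sy; have := keyN _ sx; lra.
- have y0 : y < 0 by rewrite pmulr_rlt0 in xy.
  rewrite gtr0_norm// in sx; rewrite ltr0_norm// in sy.
  apply: le_trans (ler_norm _); have := key _ sx; have := keyN _ sy; lra.
by move: xy; rewrite x0 mul0r ltxx.
Qed.

Lemma no_flat_arc c (D : set (R * R)) (p t1 q e : R) : C1_jordan c -> open D -> connected D ->
  (forall t, ca c <= t <= cb c -> ~ D (cx c t, cy c t)) ->
  ca c < p -> p < t1 -> t1 < q -> q < cb c -> (forall t, p <= t <= q -> cy c t = 0) -> 0 < e ->
  ~ (forall s : R, 0 < s -> s < e -> D (cx c t1, s) /\ D (cx c t1, - s)).
Proof.
move=> Hc oD cD off ap pt1 t1q qb flatpq e0; set x1 := cx c t1 => box.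
have inj : forall t u, ca c <= t < cb c -> ca c <= u < cb c -> gam c t = gam c u -> t = u.
  by move=> t u ht hu [h1 h2]; case: Hc => _ [_ [_ [_ [_ [_ [_]]]]]]; apply=> //; rewrite h1 h2.
have closed_c := gam_closed Hc.
have pq := ltW (lt_trans pt1 t1q); have pcb := ltW (le_lt_trans pq qb).
have [acp qcb] := (ltW ap, ltW qb); have acq := le_trans acp pq; have acb := le_trans acp pcb.
have inpq t : p <= t <= q -> ca c <= t < cb c.
  by move=> /andP[h1 h2]; rewrite (le_trans acp h1) (le_lt_trans h2 qb).
have [Ip I1 Iq] : [/\ p \in `[p, q], t1 \in `[p, q] & q \in `[p, q]].
  by rewrite !in_itv /= !lexx pq !ltW.
have gt1 : gam c t1 = Complex x1 0 by rewrite /gam flatpq// !ltW.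
have t1ab : ca c <= t1 < cb c by apply: inpq; rewrite !ltW.
have opp : (cx c p - x1) * (cx c q - x1) < 0.
  have xinj : {in `[p, q] &, injective (cx c)}.
    move=> t u; rewrite !in_itv /= => ht hu E; apply: inj.
    - exact: inpq.
    - exact: inpq.
    - by rewrite /gam E !flatpq.
  have xcont : {within `[p, q], continuous (cx c)}.
    by apply: continuous_subspaceT => t; have [] := gam_cc t Hc.
  have [mono|mono] := itv_continuous_inj_mono xcont xinj.
    have h1 := mono _ _ Ip I1 pt1; have h2 := mono _ _ I1 Iq t1q.
    by rewrite nmulr_rlt0 ?subr_gt0 ?subr_lt0.
  have h1 := mono _ _ I1 Ip pt1; have h2 := mono _ _ Iq I1 t1q.
  by rewrite pmulr_rlt0 ?subr_gt0 ?subr_lt0.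
have away (u v : R) : u <= v -> (forall t, u <= t <= v -> ca c <= t <= p \/ q <= t <= cb c) ->
    exists2 eta : R, 0 < eta & forall t, u <= t <= v -> eta <= normc (gam c t - Complex x1 0).
  move=> uv Huv; apply: curve_away => t ht; first exact: gam_cc.
  rewrite -gt1; apply/eqP => E.
  have [tb|tb] := eqVneq t (cb c).
    rewrite tb -closed_c in E.
    have H : ca c = t1 by apply: (inj _ _ _ t1ab E); rewrite lexx (lt_le_trans ap).
    by move: (lt_trans ap pt1); rewrite H ltxx.
  have tab : ca c <= t < cb c.
    by rewrite lt_neqAle tb; case: (Huv t ht) => /andP[h1 h2]; rewrite ?h1 ?h2 ?(le_trans h2 pcb) ?(le_trans acq h1).
  move: (Huv t ht); rewrite (inj _ _ tab t1ab E) => -[/andP[_]|/andP[+ _]].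
    by rewrite leNgt pt1.
  by rewrite leNgt t1q.
have [e1 e10 he1] := away (ca c) p acp (fun t ht => or_introl ht).
have [e2 e20 he2] := away q (cb c) qcb (fun t ht => or_intror ht).
have [G G0 HG] := cc_bound (fun t (_ : ca c <= t <= cb c) => dgam_cc t Hc).
pose eta := Num.min e1 e2; have eta0 : 0 < eta by rewrite lt_min e10.
pose K := G * (2 * ((eta / 2)^-1 * (eta / 2)^-1)) * (cb c - ca c).
have K0 : 0 <= K.
  by rewrite !mulr_ge0 ?invr_ge0 ?subr_ge0// divr_ge0// ltW.
have X0 : cx c p - x1 != 0 by apply/eqP => E; rewrite E mul0r ltxx in opp.
have Y0 : cx c q - x1 != 0 by apply/eqP => E; rewrite E mulr0 ltxx in opp.
have [s [s0 sX sY [se seta sK]]] : exists s : R, [/\ 0 < s, s <= `|cx c p - x1|, s <= `|cx c q - x1| &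
    [/\ s < e, s <= eta / 2 & K * s < 1]].
  pose m1 := Num.min `|cx c p - x1| `|cx c q - x1|; pose m2 := Num.min (e / 2) (eta / 2).
  have K1 : 0 < K + 1 by rewrite ltr_wpDl.
  exists (Num.min (Num.min m1 m2) (K + 1)^-1).
  have e20' : e / 2 < e by lra.
  split; [|by rewrite !ge_min lexx|by rewrite !ge_min lexx orbT|split].
  - by rewrite !lt_min !normr_gt0 X0 Y0 !divr_gt0// invr_gt0.
  - by rewrite !gt_min e20' !orbT.
  - by rewrite !ge_min lexx !orbT.
  - apply: (@le_lt_trans _ _ (K * (K + 1)^-1)); first by rewrite ler_wpM2l// ge_min lexx orbT.
    by rewrite ltr_pdivrMr// mul1r ltrDl.
pose zp : C := Complex x1 s; pose zm : C := Complex x1 (- s).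
have zpm : normc (zp - zm) = 2 * s.
  rewrite /zp /zm normcE cReD cImD cReN cImN /= subrr expr0n add0r opprK sqrtr_sqr ger0_norm; lra.
have [Dp Dm] := box s s0 se.
have turn : turning c zp = turning c zm := turning_constant Hc oD cD off Dp Dm.
have z0s (z : C) (t : R) : z = zp \/ z = zm -> eta <= normc (gam c t - Complex x1 0) ->
    eta / 2 <= normc (gam c t - z).
  move=> hz h; have hs : normc (z - Complex x1 0) = s.
    by case: hz => ->; rewrite normcE cReD cImD cReN cImN /= subrr subr0 expr0n add0r sqrtr_sqr ?normrN gtr0_norm.
  have := normcBl (gam c t - Complex x1 0) (z - Complex x1 0); rewrite hs.
  have -> : gam c t - Complex x1 0 - (z - Complex x1 0) = gam c t - z by ring.
  by apply: le_trans; lra.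
have out (u v : R) : ca c <= u -> u <= v -> v <= cb c ->
    (forall t, u <= t <= v -> eta <= normc (gam c t - Complex x1 0)) ->
    `|rint u v (dangle c zp) -
      rint u v (dangle c zm)| < 1.
  move=> au uv vb far; apply: le_lt_trans sK.
  have e2' : 0 < eta / 2 by rewrite divr_gt0.
  apply: (le_trans (integ_cauchy_diff Hc uv e2' (G := G) _)).
    move=> t ht; have := far t ht => h; split.
    - by apply: HG; move: ht => /andP[h1 h2]; rewrite (le_trans au h1) (le_trans h2 vb).
    - by apply: z0s => //; left.
    - by apply: z0s => //; right.
  rewrite zpm /K.
  have -> : G * (2 * ((eta / 2)^-1 * (eta / 2)^-1)) * (cb c - ca c) * s =
     G * (2 * s * ((eta / 2)^-1 * (eta / 2)^-1)) * (cb c - ca c) by ring.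
  rewrite ler_wpM2l ?lerB//.
  by rewrite !mulr_ge0 ?invr_ge0 ?(ltW s0) ?(ltW e2').
have nep (z : C) : z = zp \/ z = zm -> forall t, ca c <= t <= cb c -> gam c t != z.
  move=> hz t ht; apply/eqP => E; apply: (off t ht).
  have -> : (cx c t, cy c t) = (Re z, Im z) by rewrite -E.
  by case: hz => ->.
have split3 (z : C) : z = zp \/ z = zm -> turning c z =
    rint (ca c) p (dangle c z) +
    (rint p q (dangle c z) +
     rint q (cb c) (dangle c z)).
  move=> hz; have U := Im_cont (kernel_cc Hc (nep z hz)).
  rewrite /turning (integ_cat acp pcb U); congr (_ + _); apply: (@integ_cat _ R^o) => //.
  move=> e' /U[d' d'0 H]; exists d' => // t u /andP[h1 h2] /andP[h3 h4].
  by apply: H; rewrite ?h2 ?h4 (le_trans acp).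
have eta1 : eta <= e1 by rewrite ge_min lexx.
have eta2 : eta <= e2 by rewrite ge_min lexx orbT.
have o1 := out (ca c) p (lexx _) acp pcb (fun t ht => le_trans eta1 (he1 t ht)).
have o2 := out q (cb c) acq qcb (lexx _) (fun t ht => le_trans eta2 (he2 t ht)).
have mp : rint p q (dangle c zp) =
    atan ((cx c q - x1) / s) - atan ((cx c p - x1) / s).
  rewrite integ_angle//; last by move=> t ht; rewrite cImD cImN /= flatpq// sub0r oppr_eq0 gt_eqF.
  by rewrite !cReD !cImD !cReN !cImN /= !flatpq ?lexx ?andbT// !sub0r !invrN !mulrN !atanN opprK addrC.
have mm : rint p q (dangle c zm) =
    atan ((cx c p - x1) / s) - atan ((cx c q - x1) / s).
  rewrite integ_angle//; last by move=> t ht; rewrite cImD cImN /= flatpq// sub0r opprK gt_eqF.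
  by rewrite !cReD !cImD !cReN !cImN /= !flatpq ?lexx ?andbT// !sub0r !opprK.
have gap := atan_gap opp s0 sX sY; have pi2 := pi_ge2 R.
move: turn; rewrite (split3 zp (or_introl erefl)) (split3 zm (or_intror erefl)) mp mm.
move: o1 o2 gap pi2; clear.
move: (integ _ _ _) (integ _ _ _) (integ _ _ _) (integ _ _ _) => B' A' B A.
move: (atan _) (atan _) => b a o1 o2 gap pi2 eq.
have : pi <= `|(A - B) + (A' - B')|.
  have -> : (A - B) + (A' - B') = 2 * (a - b) by lra.
  by rewrite normrM ger0_norm//; lra.
have := ler_normD (A - B) (A' - B'); lra.
Qed.

End Turning.

Section JordanBoundary.
Variables (R : realType) (D : set (R * R)) (n : nat) (cs : 'I_n -> pcurve R).
Local Notation C := R[i].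
Local Notation rint := (integ (W := R^o)).
Local Notation dangle c z := (fun t => Im (dgam c t / (gam c t - z))).
Hypothesis oD : open D.
Hypothesis HJ : forall k, C1_jordan (cs k).
Hypothesis HD : bdry D = \bigcup_(k in [set: 'I_n]) curve_img (cs k).

Lemma curve_off k t : ca (cs k) <= t <= cb (cs k) -> ~ D (cx (cs k) t, cy (cs k) t).
Proof.
move=> ht Dt; have : bdry D (cx (cs k) t, cy (cs k) t) by rewrite HD; exists k => //; exists t.
by case=> _; apply; exact: (open_nbhs_nbhs (conj oD Dt)).
Qed.

(* If a slit of the real axis near [x0] were all that is missing from [D], a boundary curve would run
   along it; its turning number, constant on the connected [D], would jump across the slit. *)
Lemma no_real_slit (x0 e : R) : connected D -> ~ D (x0, 0) -> 0 < e ->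
  exists x y, [/\ ~ D (x, y), y != 0, `|x - x0| < e & `|y| < e].
Proof.
move=> cD nD e0; apply: contrapT => N.
have box (x y : R) : y != 0 -> `|x - x0| < e -> `|y| < e -> D (x, y).
  by move=> h1 h2 h3; apply: contrapT => h; apply: N; exists x, y.
have : bdry D (x0, 0).
  split; last by move=> /interior_subset.
  move=> B /nbhs_toC[d d0 Hd].
  have [m [m0 md me]] : exists m : R, [/\ 0 < m, m < d & m < e].
    by case: (leP d e) => h; [exists (d / 2)|exists (e / 2)]; split; lra.
  exists (x0, m); split; first by apply: box; rewrite ?subrr ?normr0// ?gt_eqF// gtr0_norm.
  apply: Hd; apply: (le_lt_trans (normc_le _)).
  by rewrite cReD cImD cReN cImN /= subrr subr0 normr0 add0r gtr0_norm.
rewrite HD => -[k _ [t0 t0ab E0]]; set c := cs k in t0ab E0.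
have Hc : C1_jordan c := HJ k.
have ab : ca c < cb c by case: Hc.
have E0' : gam c t0 = Complex x0 0 by case: E0 => -> ->.
have /nbhs_normP[d d0 Hd] : \forall t \near t0, normc (gam c t - gam c t0) <= e / 2.
  by apply: cc_near; [exact: gam_cc|rewrite divr_gt0].
rewrite /= in d0.
have [l [r [al lr rb lrd]]] : exists l r, [/\ ca c <= l, l < r, r <= cb c &
    forall t, l < t < r -> `|t0 - t| < d].
  exists (Num.max (ca c) (t0 - d)), (Num.min (cb c) (t0 + d)); move: t0ab => /andP[t1 t2]; split.
  - by rewrite le_max lexx.
  - by rewrite gt_max !lt_min ab /=; apply/and3P; split; lra.
  - by rewrite ge_min lexx.
  - by move=> t; rewrite gt_max lt_min => /andP[/andP[_ h1] /andP[_ h2]]; rewrite ltr_norml; apply/andP; split; lra.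
have flat t : l < t < r -> cy c t = 0 /\ `|cx c t - x0| < e.
  move=> ht; have h : normc (gam c t - gam c t0) <= e / 2 := Hd t (lrd t ht).
  rewrite E0' in h.
  have h1 : `|cx c t - x0| <= e / 2 := le_trans (normc_Re (gam c t - Complex x0 0)) h.
  have h2 : `|cy c t - 0| <= e / 2 := le_trans (normc_Im (gam c t - Complex x0 0)) h.
  rewrite subr0 in h2; have h3 : `|cx c t - x0| < e by lra.
  split=> //; apply/eqP/negPn/negP => y0.
  apply: (@curve_off k t); last by rewrite -/c; apply: box => //; lra.
  by move: ht => /andP[u1 u2]; apply/andP; split; rewrite -/c; lra.
have [p [t1 [q [lp pt1 t1q qr]]]] : exists p t1 q, [/\ l < p, p < t1, t1 < q & q < r].
  by exists ((3 * l + r) / 4), ((l + r) / 2), ((l + 3 * r) / 4); split; lra.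
have pq_lr t : p <= t <= q -> l < t < r.
  by move=> /andP[h1 h2]; rewrite (lt_le_trans lp) ?(le_lt_trans h2).
apply: (@no_flat_arc R c D p t1 q (e / 2) Hc oD cD) => //; rewrite ?(le_lt_trans al) ?(lt_le_trans qr) ?divr_gt0//.
- by move=> t ht; exact: (@curve_off k).
- by move=> t /pq_lr/flat[].
have x1e : `|cx c t1 - x0| < e by have [] := flat t1; first by apply: pq_lr; rewrite !ltW.
move=> s s0 se; have {}se : s < e by lra.
by split; apply: box; rewrite ?oppr_eq0 ?gt_eqF// ?normrN gtr0_norm.
Qed.
End JordanBoundary.

Section PositiveBoundary.
Variables (R : realType) (D : set (R * R)) (n : nat) (cs : 'I_n -> pcurve R).
Local Notation C := R[i].
Hypothesis oD : open D.
Hypothesis HD : pos_bdry_param D cs.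

Let HJ k : C1_jordan (cs k). Proof. by case: HD. Qed.

Lemma boundary_off k t : ca (cs k) <= t <= cb (cs k) -> ~ D (cx (cs k) t, cy (cs k) t).
Proof. by case: HD => _ [h _]; exact: curve_off. Qed.

Lemma curve_neq k p t : D p -> ca (cs k) <= t <= cb (cs k) -> gam (cs k) t != toC p.
Proof.
move=> Dp ht; apply/eqP => -[e1 e2]; apply: (boundary_off ht).
by rewrite e1 e2; case: p Dp {e1 e2}.
Qed.

Lemma total_turning p : D p -> \sum_(k < n) turning (cs k) (toC p) = 2 * pi.
Proof.
move=> Dp; have [_ [_ /(_ p)]] := HD; case; first by case=> _; apply; exact: (open_nbhs_nbhs (conj oD Dp)).
move=> w [Hw]; case: pselect => // _ /= <-; apply: eq_bigr => k _; apply/esym.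
by apply: turning_rint (Hw k) => // t; exact: curve_neq.
Qed.

Lemma winding_act (V : completeNormedModType R) (j : V -> V) p v : D p ->
  \sum_(k < n) integ (ca (cs k)) (cb (cs k))
     (fun t => act j (dgam (cs k) t / (gam (cs k) t - toC p)) v) = act j (Complex 0 (2 * pi)) v.
Proof.
move=> Dp; rewrite -(total_turning Dp).
rewrite (eq_bigr (fun k => act j (Complex 0 (turning (cs k) (toC p))) v)); last first.
  by move=> k _; apply: integ_act_turning => // t; exact: curve_neq.
rewrite -act_suml; congr (act j _ v); apply: complex_ext => /=.
  by elim/big_ind: _ => // x y /= hx hy; rewrite cReD hx hy addr0.
by elim/big_rec2: _ => // k y x _ <-; rewrite cImD.
Qed.

Lemma interior_bounded : exists B : R, forall p, D p -> normc (toC p) <= B.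
Proof.
pose bound k (M : R) := 0 <= M /\ forall t, ca (cs k) <= t <= cb (cs k) ->
    [/\ normc (gam (cs k) t) <= M, normc (dgam (cs k) t) <= M & cb (cs k) - ca (cs k) <= M].
have /choice[M HM] : forall k, exists M, bound k M.
  move=> k.
  have [A A0 HA] := cc_bound (fun t (_ : ca (cs k) <= t <= cb (cs k)) => gam_cc t (HJ k)).
  have [B B0 HB] := cc_bound (fun t (_ : ca (cs k) <= t <= cb (cs k)) => dgam_cc t (HJ k)).
  have ab : ca (cs k) < cb (cs k) by case: (HJ k).
  exists (A + B + (cb (cs k) - ca (cs k))); split; first by lra.
  by move=> t ht; have := HA t ht; have := HB t ht; split; lra.
pose N := \sum_(k < n) M k.
have MN k : M k <= N.
  by rewrite /N (bigD1 k)//= lerDl sumr_ge0// => i _; case: (HM i).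
have N0 : 0 <= N by apply: sumr_ge0 => i _; case: (HM i).
exists (N + \sum_(k < n) N * N) => p Dp; rewrite leNgt; apply/negP => far.
have S0 : 0 <= \sum_(k < n) N * N by apply: sumr_ge0 => i _; rewrite mulr_ge0.
have pN : 0 < normc (toC p) - N by lra.
have le_turning k : `|turning (cs k) (toC p)| <= N / (normc (toC p) - N) * N.
  have [_ Hk] := HM k; have Mk := MN k.
  have ab : ca (cs k) < cb (cs k) by case: (HJ k).
  have hab : cb (cs k) - ca (cs k) <= N.
    by have [|_ _ h] := Hk (ca (cs k)); [rewrite lexx ltW|exact: le_trans Mk].
  apply: (le_trans (@turning_far R (cs k) (toC p) N N (HJ k) _ _ N0 _)).
  - by move=> t /Hk[h _ _]; exact: le_trans Mk.
  - by move=> t /Hk[_ h _]; exact: le_trans Mk.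
  - by lra.
  by rewrite ler_wpM2l// divr_ge0// ltW.
have := total_turning Dp; have pi2 := pi_ge2 R => tot.
have : 2 * pi <= \sum_(k < n) N / (normc (toC p) - N) * N.
  by rewrite -tot; apply: ler_sum => k _; exact: le_trans (ler_norm _) (le_turning k).
under eq_bigr do rewrite mulrAC; rewrite -mulr_suml.
rewrite ler_pdivlMr// => h; suff : 2 * pi * (normc (toC p) - N) > normc (toC p) - N by lra.
by rewrite ltr_pMl//; lra.
Qed.
End PositiveBoundary.

(** * Slices of the octonions *)

Section ImaginaryUnits.
Variable R : realType.
Local Notation oct := (oct R).
Local Notation e := (oe R).
Local Notation C := R[i].
Implicit Types (p q r : oct).

Definition odot p q : R := \sum_(i < 8) p 0 i * q 0 i.

Lemma odotDl p p' q : odot (p + p') q = odot p q + odot p' q.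
Proof. by rewrite -big_split; apply: eq_bigr => i _; rewrite /= oct_addE mulrDl. Qed.
Lemma odotDr p q q' : odot p (q + q') = odot p q + odot p q'.
Proof. by rewrite -big_split; apply: eq_bigr => i _; rewrite /= oct_addE mulrDr. Qed.
Lemma odotZl (a : R) p q : odot (a *: p) q = a * odot p q.
Proof. by rewrite mulr_sumr; apply: eq_bigr => i _; rewrite oct_scaleE mulrA. Qed.
Lemma odotZr (a : R) p q : odot p (a *: q) = a * odot p q.
Proof. by rewrite mulr_sumr; apply: eq_bigr => i _; rewrite oct_scaleE mulrCA. Qed.
Lemma odotC p q : odot p q = odot q p.
Proof. by apply: eq_bigr => i _; rewrite mulrC. Qed.
Lemma odot1 p : odot (one_o R) p = p 0 ord0.
Proof.
rewrite /odot (bigD1 ord0)//= big1 ?addr0; first by rewrite mxE !eqxx mul1r.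
by move=> i i0; rewrite mxE (negPf i0) andbF mul0r.
Qed.

Lemma odot_basis i j : (i < 8)%N -> (j < 8)%N -> odot (e i) (e j) = (i == j)%:R.
Proof.
move=> li lj; rewrite /odot (bigD1 (inord i))//= big1 ?addr0; last first.
  by move=> k ki; rewrite mxE (negPf ki) andbF mul0r.
by rewrite !mxE !eqxx /= mul1r -val_eqE /= !inordK.
Qed.

Lemma omul_anticomm p q : omul p q + omul q p =
  (2 * p 0 ord0) *: q + (2 * q 0 ord0) *: p - (2 * odot p q) *: one_o R.
Proof.
elim/oct_ind: p => [p p' Hp Hp'|a p Hp|i li].
- have -> : omul (p + p') q + omul q (p + p') =
    (omul p q + omul q p) + (omul p' q + omul q p').
    by rewrite omulDl omulDr addrACA.
  by rewrite Hp Hp' odotDl oct_addE; lmod.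
- have -> : omul (a *: p) q + omul q (a *: p) = a *: (omul p q + omul q p).
    by rewrite omulZl omulZr scalerDr.
  by rewrite Hp odotZl oct_scaleE; lmod.
elim/oct_ind: q => [q q' Hq Hq'|a q Hq|j lj].
- have -> : omul (e i) (q + q') + omul (q + q') (e i) =
    (omul (e i) q + omul q (e i)) + (omul (e i) q' + omul q' (e i)).
    by rewrite omulDl omulDr addrACA.
  by rewrite Hq Hq' odotDr oct_addE; lmod.
- have -> : omul (e i) (a *: q) + omul (a *: q) (e i) = a *: (omul (e i) q + omul q (e i)).
    by rewrite omulZl omulZr scalerDr.
  by rewrite Hq odotZr oct_scaleE; lmod.
rewrite odot_basis// !oct_coord0//.
case: (posnP i) => [->|i0].
  rewrite -one_oE omul1o omulo1; case: (posnP j) => [->|j0]; rewrite -?one_oE /=; first by lmod.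
  by rewrite (ltn_eqF j0) /=; lmod.
case: (posnP j) => [->|j0].
  by rewrite -one_oE omul1o omulo1 (gtn_eqF i0) /=; lmod.
rewrite !omul_basis//.
have [<-|ij] := eqVneq i j.
  have : all (fun i => osgn i i && (oidx i i == 0%N)) (iota 1 7) by vm_compute.
  move=> /allP/(_ i); rewrite mem_iota i0 => /(_ li) /andP[-> /eqP ->].
  by rewrite /= -one_oE expr1; lmod.
have /andP[/eqP -> /eqP ->] : (oidx i j == oidx j i) && (osgn i j == ~~ osgn j i).
  by apply: osgn_oidxC => //; rewrite ?i0 ?j0.
by rewrite signrN /= scaleNr addNr !mulr0 !scale0r addr0 subrr.
Qed.

Variable J : oct.
Hypothesis HJ : in_S J.

Lemma imag_unit : J 0 ord0 = 0 /\ odot J J = 1.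
Proof.
have H : (4 * J 0 ord0) *: J - (2 * odot J J) *: one_o R = - (2 *: one_o R).
  have := omul_anticomm J J; rewrite HJ => h.
  have -> : - (2 *: one_o R) = - one_o R - one_o R by lmod.
  by rewrite h; lmod.
have h1 := congr1 (fun x : oct => odot (one_o R) x) H.
have h2 := congr1 (fun x : oct => odot J x) H.
have NE p : - p = (-1) *: p by rewrite scaleN1r.
rewrite !NE !odotDr !odotZr !odot1 mxE eqxx /= in h1.
rewrite !NE !odotDr !odotZr !(odotC J (one_o R)) !odot1 in h2.
have J0 : J 0 ord0 = 0.
  apply/eqP; apply: contraT => n0.
  have h3 : odot J J = 2 * J 0 ord0 ^+ 2 + 1 by lra.
  have : J 0 ord0 * (odot J J + 1) = 0 by lra.
  move=> /eqP; rewrite mulf_eq0 (negPf n0) /= h3 => /eqP h4.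
  by have := sqr_ge0 (J 0 ord0); lra.
by split=> //; rewrite J0 in h1; lra.
Qed.

Definition slice (z : C) : oct := cJ J (Re z) (Im z).

Lemma sliceM z w : omul (slice z) (slice w) = slice (z * w).
Proof.
rewrite /slice /cJ !(omulDl, omulDr, omulZl, omulZr) omul1o !omulo1 omul1o HJ cReM cImM.
by lmod.
Qed.
Lemma sliceN z : slice (- z) = - slice z.
Proof. by rewrite /slice /cJ cReN cImN; lmod. Qed.
Lemma slice1 : slice 1 = one_o R.
Proof. by rewrite /slice /cJ /=; lmod. Qed.
Lemma slice_i : slice (Complex 0 1) = J.
Proof. by rewrite /slice /cJ /=; lmod. Qed.
Lemma slice_pow z m : opow (slice z) m = slice (z ^+ m).
Proof.
elim: m => [|m IH]; first by rewrite expr0 slice1.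
by rewrite /opow iterS -/(opow _ _) IH sliceM exprS.
Qed.
Lemma slice_in_CJ z : in_CJ J (slice z).
Proof. by exists (Re z), (Im z). Qed.

Lemma onormE p : onorm p = Num.sqrt (odot p p).
Proof. by rewrite /onorm; congr Num.sqrt; apply: eq_bigr => i _; rewrite expr2. Qed.

Lemma onorm_slice z : onorm (slice z) = normc z.
Proof.
have [J0 J1] := imag_unit.
rewrite onormE normcE; congr Num.sqrt; rewrite /slice /cJ.
rewrite !(odotDl, odotDr, odotZl, odotZr) J1 (odotC J) !odot1 J0 mxE eqxx /=.
by move: (Re z) (Im z) => x y; ring.
Qed.

End ImaginaryUnits.

Lemma slice_unique (R : realType) (J J' : oct R) (z : R[i]) lam : in_S J -> in_S J' -> Im z != 0 ->
  in_CJ J' (slice J z) -> in_CJ J lam -> in_CJ J' lam.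
Proof.
move=> HJ HJ' z0 [x' [y' E]] [a [b ->]].
have [J0 J1] := imag_unit HJ; have [J0' J1'] := imag_unit HJ'.
have h := congr1 (fun x : oct R => odot (one_o R) x) E.
rewrite /slice /cJ !odotDr !odotZr !odot1 J0 J0' !mulr0 !addr0 mxE eqxx /= !mulr1 in h.
have EJ : Im z *: J = y' *: J'.
  by apply: (addrI (Re z *: one_o R)); rewrite {2}h; exact: E.
exists a, (b * (Im z)^-1 * y'); rewrite /cJ; congr (_ + _).
by rewrite -scalerA -EJ scalerA mulrAC -mulrA mulrV ?unitfE// mulr1.
Qed.

Section SliceAction.
Variables (R : realType) (V : completeNormedModType R).
Variables (lm : oct R -> V -> V) (rm : V -> oct R -> V).
Hypothesis HV : banach_O_bimodule lm rm.
Variable J : oct R.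
Hypothesis HJ : in_S J.
Definition rmJ (v : V) : V := rm v J.

Lemma act_slice z v : act rmJ z v = rm v (slice J z).
Proof. by rewrite /act /rmJ /slice /cJ (rmDr HV) !(rmZr HV) (rm1 HV). Qed.
Lemma rmJD x y : rmJ (x + y) = rmJ x + rmJ y.
Proof. exact: (rmDl HV). Qed.
Lemma rmJZ (r : R) x : rmJ (r *: x) = r *: rmJ x.
Proof. exact: (rmZl HV). Qed.
Lemma rmJJ x : rmJ (rmJ x) = - x.
Proof.
have h : assoc_xpq rm x J J = 0.
  have := assocC HV J J x; rewrite -(assoc_xpqE HV) => h.
  have : 2 *: assoc_xpq rm x J J = 0 by rewrite scaler_nat mulr2n {2}h subrr.
  by move=> /eqP; rewrite scaler_eq0 pnatr_eq0 /= => /eqP.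
by move: h => /subr0_eq; rewrite HJ (rmN HV) (rm1 HV).
Qed.
Lemma norm_act_slice z v : `|act rmJ z v| = normc z * `|v|.
Proof. by rewrite act_slice (norm_rm HV) onorm_slice. Qed.
End SliceAction.

(** * The contour integral *)

Lemma integ_bigsum (R : realType) (W : completeNormedModType R) (I : Type) (s : seq I)
  (g : I -> R -> W) (a b : R) : a <= b -> (forall i, ucont (g i) a b) ->
  ucont (fun t => \sum_(i <- s) g i t) a b /\
  integ a b (fun t => \sum_(i <- s) g i t) = \sum_(i <- s) integ a b (g i).
Proof.
move=> ab U; elim: s => [|i s [IU IE]].
  have U0 : ucont (fun=> 0 : W) a b.
    by move=> e e0; exists 1 => // t u _ _ _; rewrite subrr normr0 ltW.
  split; first by under eq_fun do rewrite big_nil.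
  under eq_fun do rewrite big_nil.
  rewrite big_nil; apply/eqP; rewrite -normr_le0 -(mul0r (b - a)).
  by apply: integ_bound => // t _; rewrite normr0.
have E : (fun t => \sum_(i <- i :: s) g i t) = (fun t => g i t + \sum_(i <- s) g i t).
  by apply/funext => t; rewrite big_cons.
rewrite E big_cons; split; last by rewrite integD// IE.
move=> e e0; have e20 : 0 < e / 2 by rewrite divr_gt0.
have [d d0 Hd] := U i _ e20; have [d' d'0 Hd'] := IU _ e20.
exists (Num.min d d'); first by rewrite lt_min d0.
move=> t u ht hu; rewrite lt_min => /andP[h1 h2].
have -> : g i t + \sum_(i <- s) g i t - (g i u + \sum_(i <- s) g i u) =
  (g i t - g i u) + (\sum_(i <- s) g i t - \sum_(i <- s) g i u) by lmod.
by rewrite [e]splitr (le_trans (ler_normD _ _))// lerD ?Hd ?Hd'.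
Qed.

Lemma cc_modulus (R : realType) (f : R -> R[i]) (a b e : R) :
  (forall t, a <= t <= b -> cc f t) -> 0 < e ->
  exists2 d, 0 < d & forall t u, a <= t <= b -> a <= u <= b -> `|t - u| < d -> normc (f t - f u) <= e.
Proof.
move=> cf e0; have e20 : 0 < e / 2 by rewrite divr_gt0.
have [d d0 Hd] := @ucont_cont R R^o (fun t => Re (f t)) a b (fun t ht => (cf t ht).1) _ e20.
have [d' d'0 Hd'] := @ucont_cont R R^o (fun t => Im (f t)) a b (fun t ht => (cf t ht).2) _ e20.
exists (Num.min d d'); first by rewrite lt_min d0.
move=> t u ht hu; rewrite lt_min => /andP[h1 h2].
apply: (le_trans (normc_le _)); rewrite cReD cImD cReN cImN [e]splitr.
by rewrite lerD//; [exact: Hd|exact: Hd'].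
Qed.

Lemma ucont_scaled (R : realType) (W : completeNormedModType R) (F : R -> W) (a b c : R) : 0 <= c ->
  (forall e, 0 < e -> exists2 d, 0 < d & forall t u, a <= t <= b -> a <= u <= b ->
     `|t - u| < d -> `|F t - F u| <= e * c) -> ucont F a b.
Proof.
move=> c0 H e e0; have c1 : 0 < c + 1 by rewrite ltr_wpDl.
have [d d0 Hd] := H _ (divr_gt0 e0 c1); exists d => // t u ht hu tu.
by rewrite (le_trans (Hd t u ht hu tu))// mulrAC ler_pdivrMr// ler_wpM2l ?(ltW e0)// lerDl.
Qed.

Section SpectralIntegral.
Variables (R : realType) (V : completeNormedModType R).
Variables (lm : oct R -> V -> V) (rm : V -> oct R -> V).
Hypothesis HV : banach_O_bimodule lm rm.
Variables (T : V -> V) (J : oct R) (U : set (oct R)) (n : nat) (cs : 'I_n -> pcurve R).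
Hypothesis HT : in_BRO lm rm T.
Hypothesis HTpa : power_assoc lm rm T.
Hypothesis HU : left_admissible lm rm T U.
Hypothesis HJ : in_S J.
Hypothesis Hcs : pos_bdry_param (sliceJ U J) cs.
Local Notation C := R[i].
Local Notation X := (Defs.ReV lm rm).
Local Notation j := (rmJ rm J).
Local Notation S := (resolvent j T).
Local Notation sl := (slice J).

Let jD := rmJD HV J.
Let jZ := rmJZ HV J.
Let jj := rmJJ HV HJ.
Let norm_act := norm_act_slice HV HJ.
Let bT : bdd_lin T. Proof. by case: HT. Qed.

Definition domain (z : C) : Prop := sliceJ U J (Re z, Im z).

Lemma pencilE z : pencil j T z = RsT rm T (sl z).
Proof. by apply/funext => v; rewrite /pencil (act_slice HV). Qed.

Let oD : open (sliceJ U J).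
Proof. by case: HU => _ [[_ [_ [_ /(_ J HJ)[]]]]]. Qed.
Let cD : connected (sliceJ U J).
Proof. by case: HU => _ [[_ [_ [_ /(_ J HJ)[]]]]]. Qed.

Lemma domain_open z : domain z -> exists2 d, 0 < d & forall w, normc (w - z) < d -> domain w.
Proof.
move=> Dz; have /nbhs_toC[d d0 Hd] := open_nbhs_nbhs (conj oD Dz).
by exists d => // w wz; apply: Hd; case: z w {Dz} wz => [x y] [x' y'].
Qed.

Lemma domain_off k t : ca (cs k) <= t <= cb (cs k) -> ~ domain (gam (cs k) t).
Proof. exact: (boundary_off oD Hcs). Qed.

Lemma domain_compl_rho z : ~ domain z -> exists2 J', in_S J' & rhoJ lm rm T J' (sl z).
Proof.
move=> nD; apply: contrapT => N; apply: nD; case: HU => _ [_ [H _]].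
by apply: H => -[J' [h1 h2]]; apply: N; exists J'.
Qed.

Lemma domain_compl_inv z : ~ domain z -> invertible (pencil j T z).
Proof. by rewrite pencilE => /domain_compl_rho[J' _ [_ []]]. Qed.

Lemma domain_compl_pgood z : ~ domain z -> Im z != 0 -> pgood j T X z.
Proof.
move=> nD z0; split; first exact: domain_compl_inv.
have [J' HJ' [h1 [_ h2]]] := domain_compl_rho nD.
case=> [//|m] v lam Xv; rewrite !(act_slice HV) /resolvent pencilE h2//.
by apply: (slice_unique HJ HJ' z0 h1); exact: slice_in_CJ.
Qed.

Lemma domain_compl z : ~ domain z -> invertible (pencil j T z) /\
  forall e, 0 < e -> exists2 w, pgood j T X w & normc (w - z) < e.
Proof.
move=> nD; split; first exact: domain_compl_inv.
move=> e e0; have [z0|z0] := eqVneq (Im z) 0; last first.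
  by exists z; [exact: domain_compl_pgood|rewrite subrr Normc.normc0].
have nD' : ~ sliceJ U J (Re z, 0) by rewrite -z0.
have e20 : 0 < e / 2 by rewrite divr_gt0.
have [HC1 [Hb _]] := Hcs.
have [x [y [nxy y0 hx hy]]] := no_real_slit oD HC1 Hb cD nD' e20.
exists (Complex x y); first exact: domain_compl_pgood.
by apply: (le_lt_trans (normc_le _)); rewrite cReD cImD cReN cImN /= z0 subr0 [e]splitr ltrD.
Qed.

Lemma T_iter_act m v lam : X v -> iter m T (act j lam v) = act j lam (iter m T v).
Proof. by move=> Xv; rewrite !(act_slice HV); exact: (BRO_rm HV _ (HTpa m) Xv). Qed.

Lemma domain_bounded : exists B : R, forall z, domain z -> normc z <= B.
Proof.
have [B HB] := interior_bounded oD Hcs; exists B => z /HB.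
by case: z.
Qed.

Lemma domain_winding z : domain z -> forall w : V,
  \sum_(k < n) integ (ca (cs k)) (cb (cs k))
    (fun t => act j (dgam (cs k) t / (gam (cs k) t - z)) w) = act j (Complex 0 (2 * pi)) w.
Proof. by move=> Dz w; have := winding_act oD Hcs j w Dz; case: z Dz. Qed.

Let HC k : C1_jordan (cs k). Proof. by case: Hcs. Qed.
Let ab k : ca (cs k) < cb (cs k). Proof. by case: (HC k). Qed.

Definition weight m k t : C := - (dgam (cs k) t) * Complex 0 1 * gam (cs k) t ^+ m.

Lemma integrandE m k t v : ca (cs k) <= t <= cb (cs k) ->
  contour_integrand lm rm T J m (cs k) t v =
  \sum_(i < 8) rm (act j (weight m k t) (S (gam (cs k) t) (comp lm i v))) (obasis R i).
Proof.
move=> ht; have bS := resolvent_bl (domain_compl_inv (domain_off ht)).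
rewrite /contour_integrand /circ_inv -[cJ J (cx _ _) _]/(sl (gam (cs k) t)) -pencilE.
rewrite -[cJ J _ _]/(sl (dgam (cs k) t)) (odot_ext HV); [|exact: (blD bS)|exact: (blZ bS)].
apply: eq_bigr => i _; congr (rm _ _); rewrite (act_slice HV); congr (rm _ _).
by rewrite (slice_pow HJ) -sliceN -{2}(slice_i J) !(sliceM HJ).
Qed.

Lemma weight_cc m k t : cc (weight m k) t.
Proof.
apply: ccM; last by apply: ccX; exact: gam_cc.
apply: ccM; last exact: cc_cst.
have -> : (fun t => - dgam (cs k) t) = (fun t => (-1) * dgam (cs k) t).
  by apply/funext => u; rewrite mulN1r.
by apply: ccM; [exact: cc_cst|exact: dgam_cc].
Qed.

Lemma weighted_resolvent_modulus m k e : 0 < e -> exists2 d, 0 < d &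
  forall t u, ca (cs k) <= t <= cb (cs k) -> ca (cs k) <= u <= cb (cs k) -> `|t - u| < d -> forall w,
  `|act j (weight m k t) (S (gam (cs k) t) w) - act j (weight m k u) (S (gam (cs k) u) w)| <= e * `|w|.
Proof.
move=> e0; set a := ca _; set b := cb _.
have gd k' t := gam_deriv t (HC k').
have [M M0 HM] := resolvent_uniform_bound jD jZ jj norm_act bT gd domain_off domain_compl k.
have [Q Q0 HQ] := cc_bound (fun t (_ : a <= t <= b) => weight_cc m k t).
pose e1 := e / (M + Q * M ^+ 2 + 1).
have c0 : 0 < M + Q * M ^+ 2 + 1 by rewrite ltr_wpDl// addr_ge0// mulr_ge0// sqr_ge0.
have e10 : 0 < e1 by rewrite divr_gt0.
have [d d0 Hd] := cc_modulus (fun t (_ : a <= t <= b) => weight_cc m k t) e10.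
have [d' d'0 Hd'] := cc_modulus (fun t (_ : a <= t <= b) => gam_cc t (HC k)) e10.
exists (Num.min d d'); first by rewrite lt_min d0.
move=> t u ht hu; rewrite lt_min => /andP[h1 h2] w.
have it := domain_compl_inv (domain_off ht); have iu := domain_compl_inv (domain_off hu).
set q := weight m k; set St := S _; set Su := S (gam (cs k) u).
have -> : act j (q t) (St w) - act j (q u) (Su w) =
    act j (q t - q u) (St w) + act j (q u) (St w - Su w).
  by rewrite actDl actNl (actDr jD) (actNr jZ) subrKA.
apply: (le_trans (ler_normD _ _)); rewrite !norm_act.
have b1 : normc (q t - q u) * `|St w| <= e1 * (M * `|w|).
  by rewrite ler_pM ?normc_ge0//; [exact: Hd|exact: HM].
have b2 : normc (q u) * `|St w - Su w| <= Q * (M ^+ 2 * e1 * `|w|).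
  rewrite ler_pM ?normc_ge0//; first exact: HQ.
  apply: (le_trans (resolvent_lipschitz norm_act w iu it (HM u hu) (HM t ht) M0)).
  by rewrite ler_wpM2r// ler_wpM2l ?sqr_ge0//; exact: Hd'.
apply: (le_trans (lerD b1 b2)).
have -> : e1 * (M * `|w|) + Q * (M ^+ 2 * e1 * `|w|) = e1 * (M + Q * M ^+ 2) * `|w| by ring.
rewrite ler_wpM2r// /e1 mulrAC ler_pdivrMr// ler_wpM2l ?(ltW e0)//.
by rewrite lerDl.
Qed.

Lemma weighted_resolvent_ucont m k w :
  ucont (fun t => act j (weight m k t) (S (gam (cs k) t) w)) (ca (cs k)) (cb (cs k)).
Proof.
apply: (ucont_scaled (normr_ge0 w)) => e e0; have [d d0 Hd] := weighted_resolvent_modulus m k e0.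
by exists d => // t u ht hu tu; exact: Hd.
Qed.

Definition contour_op m k (v : V) : V :=
  integ (ca (cs k)) (cb (cs k)) (fun t => contour_integrand lm rm T J m (cs k) t v).

Lemma norm_rm_basis (i : 'I_8) v : `|rm v (obasis R i)| = `|v|.
Proof. by rewrite (norm_rm HV) -oe_ord onorm_basis// mul1r. Qed.

Lemma integrand_modulus m k e : 0 < e -> exists2 d, 0 < d &
  forall t u, ca (cs k) <= t <= cb (cs k) -> ca (cs k) <= u <= cb (cs k) -> `|t - u| < d -> forall v,
  `|contour_integrand lm rm T J m (cs k) t v - contour_integrand lm rm T J m (cs k) u v| <= e * `|v|.
Proof.
move=> e0; have e80 : 0 < e / 8 by rewrite divr_gt0.
have [d d0 Hd] := weighted_resolvent_modulus m k e80; exists d => // t u ht hu tu v.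
rewrite !integrandE// -sumrB; apply: (le_trans (ler_norm_sum _ _ _)).
apply: (@le_trans _ _ (\sum_(i < 8) e / 8 * `|v|)); last first.
  by rewrite sumr_const card_ord [X in X <= _](_ : _ = e * `|v|)// -[LHS]mulr_natr; field.
apply: ler_sum => i _; rewrite -(rmNl HV) -(rmDl HV) norm_rm_basis.
apply: (le_trans (Hd t u ht hu tu _)).
by rewrite ler_wpM2l ?(ltW e80)// (norm_comp HV).
Qed.

Lemma contour_op_is_oint m k :
  is_oint (contour_integrand lm rm T J m (cs k)) (ca (cs k)) (cb (cs k)) (contour_op m k).
Proof.
move=> e e0; set a := ca _; set b := cb _; have akb := ab k; rewrite -/a -/b in akb.
have ba : 0 < b - a by rewrite subr_gt0.
have e10 : 0 < e / (b - a) by rewrite divr_gt0.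
have [d d0 Hd] := integrand_modulus m k e10; exists d => // p tg Hp v.
pose F t := contour_integrand lm rm T J m (cs k) t v.
have UF : ucont F a b.
  apply: (ucont_scaled (normr_ge0 v)) => e' e'0; have [d' d'0 Hd'] := integrand_modulus m k e'0.
  by exists d' => // t u ht hu tu; exact: Hd'.
have [G P E] := integ_prim (ltW akb) UF.
rewrite /contour_op E; have Hm := prim_modulus P (fun t u ht hu tu => Hd t u ht hu tu v).
apply: (le_trans (tagged_sum Hm Hp)).
by rewrite mulrAC divfK// gt_eqF.
Qed.

Lemma contour_op_basis m k v : contour_op m k v =
  \sum_(i < 8) rm (integ (ca (cs k)) (cb (cs k))
     (fun t => act j (weight m k t) (S (gam (cs k) t) (comp lm i v)))) (obasis R i).
Proof.
have akb := ltW (ab k).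
pose F (i : 'I_8) t := act j (weight m k t) (S (gam (cs k) t) (comp lm i v)).
have UF i : ucont (F i) (ca (cs k)) (cb (cs k)) by exact: weighted_resolvent_ucont.
have UG (i : 'I_8) : ucont (fun t => rm (F i t) (obasis R i)) (ca (cs k)) (cb (cs k)).
  move=> e /(UF i)[d d0 Hd]; exists d => // t u ht hu tu.
  by rewrite -(rmNl HV) -(rmDl HV) norm_rm_basis; exact: Hd.
have [U8 E8] := integ_bigsum (index_enum 'I_8) akb UG.
rewrite /contour_op -(integ_ext akb U8) => [|t ht]; last by rewrite integrandE.
rewrite E8; apply: eq_bigr => i _.
apply: (@integ_map R V V (fun x => rm x (obasis R i)) 1) => //.
- by move=> x y; exact: (rmDl HV).
- by move=> r x; exact: (rmZl HV).
- by move=> x; rewrite norm_rm_basis mul1r.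
Qed.

Lemma sum_weighted_resolvent m w : X w ->
  \sum_(k < n) integ (ca (cs k)) (cb (cs k)) (fun t => act j (weight m k t) (S (gam (cs k) t) w)) =
  (2 * pi) *: iter m T w.
Proof.
move=> Xw; have gd k t := gam_deriv t (HC k); have dc k t := dgam_cc t (HC k).
have gc k := gam_closed (HC k).
have main := spectral_int_power jD jZ jj norm_act bT ab gd dc gc domain_open domain_off
  domain_compl T_iter_act domain_bounded domain_winding m Xw.
transitivity (act j (- Complex 0 1) (act j (Complex 0 (2 * pi)) (iter m T w))); last first.
  rewrite -(actM jD jZ jj) -(act_real j); congr (act j _ _).
  by apply: complex_ext; rewrite ?cReM ?cImM ?cReN ?cImN /=; ring.
rewrite -main (act_sum jD jZ); apply: eq_bigr => k _.
have akb := ltW (ab k).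
have U1 : ucont (fun t => act j (gam (cs k) t ^+ m)
    (kernel j T (fun k => gam (cs k)) (fun k => dgam (cs k)) k w t)) (ca (cs k)) (cb (cs k)).
  apply: (act_kernel_ucont jD jZ jj norm_act bT gd dc domain_off domain_compl) => t _.
  by apply: ccX; exact: gam_cc.
rewrite -(integ_act jD jZ norm_act _ akb U1).
apply: (integ_ext akb (weighted_resolvent_ucont m k w)) => t ht.
rewrite /kernel -!(actM jD jZ jj); congr (act j _ _); rewrite /weight; ring.
Qed.

Lemma sum_contour_op m v : \sum_(k < n) contour_op m k v = (2 * pi) *: iter m T v.
Proof.
under eq_bigr do rewrite contour_op_basis.
rewrite exchange_big /= {2}(decomposition HV v).
have [bTm _] := HTpa m.
transitivity (\sum_(i < 8) (2 * pi) *: iter m T (rm (comp lm i v) (obasis R i))).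
  apply: eq_bigr => i _; rewrite (BRO_rm HV _ (HTpa m) (ReV_comp HV i v)) -(rmZl HV).
  rewrite -sum_weighted_resolvent; last exact: (ReV_comp HV).
  by elim/big_rec2: _ => [|k x y _ ->]; rewrite ?(rm0 HV)// (rmDl HV).
rewrite -scaler_sumr; congr (_ *: _).
by elim/big_rec2: _ => [|i x y _ ->]; rewrite ?(bl0 bTm)// (blD bTm).
Qed.

End SpectralIntegral.

Theorem mainTheorem12 (R : realType) (V : completeNormedModType R)
  (lm : oct R -> V -> V) (rm : V -> oct R -> V)
  (HV : banach_O_bimodule lm rm)
  (T : V -> V) (HT : in_BRO lm rm T) (HTpa : power_assoc lm rm T)
  (U : set (oct R)) (HU : left_admissible lm rm T U)
  (J : oct R) (HJ : in_S J) (m : nat)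
  (n : nat) (cs : 'I_n -> pcurve R) (Hcs : pos_bdry_param (sliceJ U J) cs) :
  exists Ls : 'I_n -> (V -> V),
    (forall k, is_oint (contour_integrand lm rm T J m (cs k))
                       (ca (cs k)) (cb (cs k)) (Ls k)) /\
    (forall v, (2 * pi)^-1 *: \sum_(k < n) Ls k v = iter m T v).
Proof.
exists (contour_op lm rm T J cs m); split=> [k|v].
  exact: (contour_op_is_oint HV HT HU HJ Hcs).
rewrite (sum_contour_op HV HT HTpa HU HJ Hcs) scalerA mulVf ?scale1r//.
by rewrite gt_eqF// mulr_gt0// pi_gt0.
Qed.
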